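(* Let $n,m,p$ be positive integers with $p\le m\le n-p$. Let $\mathbf{G}\in\mathbb{C}^{n\times p}$ be a deterministic matrix of full column rank $p$ whose columns are $\mathbf{g}_i=\partial\mathbf{x}(\boldsymbol{\theta})/\partial\theta_i$, let $\sigma^2>0$, and let $\mathbf{\Phi}\in\mathbb{C}^{m\times n}$ be a random matrix having a density with respect to Lebesgue measure on $\mathbb{C}^{m\times n}$ of the form $g(\mathbf{\Phi}\mathbf{\Phi}^H)$ for some function $g$ (i.e., the distribution of $\mathbf{\Phi}$ is invariant under right multiplication by unitary matrices). Let $\mathbf{J}=\frac{1}{\sigma^2}\mathbf{G}^H\mathbf{G}$ be the Fisher information matrix before compression and $\hat{\mathbf{J}}=\frac{1}{\sigma^2}\mathbf{G}^H\mathbf{P}_{\mathbf{\Phi}^H}\mathbf{G}$ the Fisher information matrix after compression, where $\mathbf{P}_{\mathbf{\Phi}^H}=\mathbf{\Phi}^H(\mathbf{\Phi}\mathbf{\Phi}^H)^{-1}\mathbf{\Phi}$. Then the normalized Fisher information matrix $\mathbf{W}=\mathbf{J}^{-1/2}\hat{\mathbf{J}}\mathbf{J}^{-H/2}$ has the Type I complex multivariate beta distribution $\mathbb{C}B_p^I(m,n-m)$, i.e., it has density $$\frac{\tilde{\Gamma}_p(n)}{\tilde{\Gamma}_p(m)\tilde{\Gamma}_p(n-m)}\,|\mathbf{V}|^{m-p}\,|\mathbf{I}_p-\mathbf{V}|^{n-m-p},\qquad \mathbf{0}\le\mathbf{V}\le\mathbf{I}_p .$$ In particular, this holds when the entries of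 $\mathbf{\Phi}$ are i.i.d. $\mathcal{CN}(0,1)$.
   Context: Model: $\mathbf{y}\in\mathbb{C}^n$ is a proper complex normal vector distributed as $\mathcal{CN}(\mathbf{x}(\boldsymbol{\theta}),\sigma^2\mathbf{I}_n)$ with mean parameterized by $\boldsymbol{\theta}\in\mathbb{R}^p$; its Fisher information matrix is $\mathbf{J}=\frac{1}{\sigma^2}\mathbf{G}^H\mathbf{G}$. The compressed data $\mathbf{\Phi}\mathbf{y}\sim\mathcal{CN}(\mathbf{\Phi}\mathbf{x}(\boldsymbol{\theta}),\sigma^2\mathbf{\Phi}\mathbf{\Phi}^H)$ has (for given $\mathbf{\Phi}$) Fisher information matrix $\hat{\mathbf{J}}=\frac{1}{\sigma^2}\hat{\mathbf{G}}^H\hat{\mathbf{G}}$ with $\hat{\mathbf{G}}=\mathbf{P}_{\mathbf{\Phi}^H}\mathbf{G}$. The superscript $H$ is conjugate transpose; $\mathbf{J}^{1/2}$ is a square root with $\mathbf{J}^{1/2}\mathbf{J}^{H/2}=\mathbf{J}$, where $\mathbf{J}^{H/2}=(\mathbf{J}^{1/2})^H$, and $\mathbf{J}^{-1/2},\mathbf{J}^{-H/2}$ are the inverses of $\mathbf{J}^{1/2},\mathbf{J}^{H/2}$. $|\cdot|$ is the determinant; $\mathbf{A}\le\mathbf{B}$ for Hermitian matrices means $\mathbf{B}-\mathbf{A}$ is positive semidefinite. $\tilde{\Gamma}_p(a)=\pi^{p(p-1)/2}\prod_{i=1}^p\Gamma(a-i+1)$ is the complex multivariate Gamma function. Densities of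 Hermitian $p\times p$ random matrices are with respect to $\prod_i dV_{ii}\prod_{i<j}d\,\mathrm{Re}V_{ij}\,d\,\mathrm{Im}V_{ij}$. *)

(* Defs.v *)
From HB Require Import structures.
From mathcomp Require Import all_boot all_order all_algebra.
From mathcomp Require Import complex.
From mathcomp Require Import all_classical all_reals all_analysis.

Set Implicit Arguments.
Unset Strict Implicit.
Unset Printing Implicit Defensive.

Import Order.TTheory GRing.Theory Num.Theory.
Import numFieldNormedType.Exports.

Local Open Scope classical_set_scope.
Local Open Scope sesquilinear_scope.
Local Open Scope ring_scope.
Local Open Scope complex_scope.

HB.instance Definition _ (R : realType) := isPointed.Build R[i] 0.

Lemma conjCE (R : realType) (z : R[i]) : (z^*)%R = (z^*)%C.
Proof. by []. Qed.

Definition complex_coords (R : realType) (z : R[i]) : R * R :=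
  (complex.Re z, complex.Im z).

Definition complex_of_coords (R : realType) (z : R * R) : R[i] := z.1 +i* z.2.

Section complex_measurable.
Context {R : realType}.

Let S : set (set R[i]) :=
  preimage_set_system setT (@complex_coords R) measurable.

Let sigmaS : sigma_algebra setT S.
Proof. exact/sigma_algebra_preimage/sigma_algebra_measurable. Qed.

Let S0 : S set0. Proof. by case: sigmaS. Qed.

Let SC A : S A -> S (~` A).
Proof. by case: sigmaS => _ + _ => /[apply]; rewrite setTD. Qed.

Let SU (F : (set R[i])^nat) : (forall i, S (F i)) -> S (\bigcup_i F i).
Proof. by case: sigmaS => _ _; exact. Qed.

HB.instance Definition _ := @isMeasurable.Build default_measure_display
  R[i] S S0 SC SU.

Lemma measurable_complex_coords : measurable_fun setT (@complex_coords R).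
Proof. by move=> _ B mB; exists B. Qed.

Lemma measurable_complex_of_coords :
  measurable_fun setT (@complex_of_coords R).
Proof.
move=> _ A [B mB <-]; rewrite !setTI.
by rewrite (_ : _ @^-1` _ = B)//; apply/seteqP; split => -[].
Qed.

End complex_measurable.

Definition measure_matrix_display : measure_display -> measure_display.
Proof. exact. Qed.

(* The product sigma-algebra: the smallest one making every entry measurable *)
Section matrix_measurable.
Context {d} {T : measurableType d} {m n : nat}.

Definition mx_cylinder : set (set 'M[T]_(m, n)) :=
  [set C | exists i j,
     preimage_set_system setT (fun A : 'M[T]_(m, n) => A i j) measurable C].

HB.instance Definition _ := @isMeasurable.Build (measure_matrix_display d)
  'M[T]_(m, n) <<s mx_cylinder >> (@sigma_algebra0 _ setT mx_cylinder)
  (@sigma_algebraC _ mx_cylinder) (@sigma_algebra_bigcup _ setT mx_cylinder).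

Lemma measurable_mx_entry i j :
  measurable_fun setT (fun A : 'M[T]_(m, n) => A i j).
Proof. by move=> _ B mB; apply: sub_sigma_algebra; exists i, j, B. Qed.

Lemma measurable_fun_mxP d1 (U : measurableType d1) (f : U -> 'M[T]_(m, n)) :
  (forall i j, measurable_fun setT (fun u => f u i j)) <->
  measurable_fun setT f.
Proof.
split=> [mf|mf i j].
  apply: (measurability mx_cylinder) => // _ [_ [i [j [B mB <-]]] <-].
  by have := mf i j measurableT B mB; rewrite !setTI.
exact: (measurableT_comp (measurable_mx_entry i j) mf).
Qed.

End matrix_measurable.

Section is_sigma_finite_measure.
Context d (T : measurableType d) (R : realType).
Local Open Scope ereal_scope.

Definition is_sigma_finite_measure (mu : set T -> \bar R) : Prop :=
  [/\ mu set0 = 0, (forall A, 0 <= mu A), semi_sigma_additive mu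
    & sigma_finite setT mu].

Definition sigma_finite_pack mu & is_sigma_finite_measure mu := mu.

Variables (mu : set T -> \bar R) (mu_sfm : is_sigma_finite_measure mu).

Lemma sfm_set0 : mu set0 = 0. Proof. by case: mu_sfm. Qed.
Lemma sfm_ge0 A : 0 <= mu A. Proof. by case: mu_sfm. Qed.
Lemma sfm_sigma_additive : semi_sigma_additive mu.
Proof. by case: mu_sfm. Qed.
Lemma sfm_sigma_finite : sigma_finite setT mu. Proof. by case: mu_sfm. Qed.

HB.instance Definition _ := isMeasure.Build _ _ _ (sigma_finite_pack mu_sfm)
  sfm_set0 sfm_ge0 sfm_sigma_additive.
HB.instance Definition _ := Measure_isSigmaFinite.Build _ _ _
  (sigma_finite_pack mu_sfm) sfm_sigma_finite.

End is_sigma_finite_measure.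

Section is_sigma_finite_measure_constructions.
Context d1 d2 (T1 : measurableType d1) (T2 : measurableType d2) (R : realType).
Local Open Scope ereal_scope.

(* Unification on [_ \x _] only finds the sigma-finite instance for
   subprobabilities, hence this restatement for arbitrary factors. *)
Lemma product_sfm (mu : {sigma_finite_measure set T1 -> \bar R})
    (nu : {sigma_finite_measure set T2 -> \bar R}) :
  is_sigma_finite_measure (mu \x nu).
Proof.
split=> //; first exact: measure_semi_sigma_additive.
have /sigma_finiteP[F [TF ndF Foo]] := sigma_finiteT mu.
have /sigma_finiteP[G [TG ndG Goo]] := sigma_finiteT nu.
exists (fun n => F n `*` G n).
  rewrite -setXTT TF TG predeqE => -[x y]; split.
    move=> [/= [n _ Fnx] [k _ Gky]]; exists (maxn n k) => //; split.
    - by move: x Fnx; exact/subsetPset/ndF/leq_maxl.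
    - by move: y Gky; exact/subsetPset/ndG/leq_maxr.
  by move=> [n _ []/= ? ?]; split; exists n.
move=> k; have [? ?] := Foo k; have [? ?] := Goo k.
split; first exact: measurableX.
by rewrite product_measure1E// lte_mul_pinfty// ge0_fin_numE.
Qed.

Lemma pushforward_sfm (mu : set T1 -> \bar R) (f : T1 -> T2) (g : T2 -> T1) :
    is_sigma_finite_measure mu ->
    measurable_fun setT f -> measurable_fun setT g -> cancel f g ->
  is_sigma_finite_measure (pushforward mu f).
Proof.
move=> mu_sfm mf mg fK; pose nu := sigma_finite_pack mu_sfm.
have mfK A : measurable A -> measurable (f @^-1` A).
  by move=> mA; rewrite -[X in measurable X]setTI; exact: mf.
split; first by rewrite /pushforward preimage_set0 (sfm_set0 mu_sfm).
- by move=> A; exact: (sfm_ge0 mu_sfm).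
- move=> F mF tF mUF; rewrite /pushforward preimage_bigcup.
  apply: (sfm_sigma_additive mu_sfm) => [n||]; first exact: mfK.
  + apply/trivIsetP => /= i j _ _ ij; rewrite -preimage_setI.
    by move/trivIsetP : tF => /(_ _ _ _ _ ij) ->//; rewrite preimage_set0.
  + by rewrite -preimage_bigcup; exact: mfK.
have [F FT Foo] := sfm_sigma_finite mu_sfm.
exists (fun k => g @^-1` F k); first by rewrite -preimage_bigcup -FT.
move=> k; have [mF Fk] := Foo k; split.
  by rewrite -[X in measurable X]setTI; exact: mg.
rewrite /pushforward (_ : f @^-1` _ = F k)//.
by apply/seteqP; split => x /=; rewrite fK.
Qed.

End is_sigma_finite_measure_constructions.

Section tuple_measure.
Context d (T : measurableType d) (R : realType).
Variable mu : {sigma_finite_measure set T -> \bar R}.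
Local Open Scope ereal_scope.

Fixpoint tuple_measure n : set (n.-tuple T) -> \bar R :=
  match n with
  | 0 => \d_ [tuple]
  | n'.+1 => pushforward (mu \x @tuple_measure n')
               (fun z => [tuple of z.1 :: z.2])
  end.

Lemma tuple_measure_sfm n : is_sigma_finite_measure (@tuple_measure n).
Proof.
elim: n => [|n IHn] /=.
  split=> //; first exact: measure_semi_sigma_additive.
  exact: sigma_finiteT.
pose g (t : n.+1.-tuple T) := (thead t, [tuple of behead t]).
apply: (@pushforward_sfm _ _ _ _ _ _ _ g).
- exact: (product_sfm mu (sigma_finite_pack IHn)).
- exact: measurable_cons.
- by apply: measurable_fun_pair;
    [exact: measurable_tnth|exact: measurable_behead].
- by case=> x t; rewrite /g theadE; congr pair; exact: val_inj.
Qed.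

HB.instance Definition _ n :=
  isMeasure.Build _ _ _ (@tuple_measure n) (sfm_set0 (tuple_measure_sfm n))
    (sfm_ge0 (tuple_measure_sfm n)) (sfm_sigma_additive (tuple_measure_sfm n)).
HB.instance Definition _ n := Measure_isSigmaFinite.Build _ _ _
  (@tuple_measure n) (sfm_sigma_finite (tuple_measure_sfm n)).

End tuple_measure.
Arguments tuple_measure {d T R} mu n.

Section mx_measure.
Context d (T : measurableType d) (R : realType) (m n : nat).

Definition mx_of_tuple (t : (m * n).-tuple T) : 'M[T]_(m, n) :=
  vec_mx (\row_k tnth t k).

Definition tuple_of_mx (A : 'M[T]_(m, n)) : (m * n).-tuple T :=
  [tuple mxvec A ord0 k | k < m * n].

Lemma mx_of_tupleK : cancel mx_of_tuple tuple_of_mx.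
Proof.
by move=> t; apply: eq_from_tnth => k; rewrite tnth_mktuple vec_mxK mxE.
Qed.

Lemma measurable_mx_of_tuple : measurable_fun setT mx_of_tuple.
Proof.
apply/measurable_fun_mxP => i j.
rewrite (_ : (fun u => _) = (fun t => tnth t (mxvec_index i j))).
  exact: measurable_tnth.
by apply/funext => t; rewrite !mxE.
Qed.

Lemma measurable_tuple_of_mx : measurable_fun setT tuple_of_mx.
Proof.
apply/measurable_fun_tnthP => k; case/mxvec_indexP: k => i j.
apply: (@eq_measurable_fun _ _ _ _ _ (fun A : 'M[T]_(m, n) => A i j)).
  by move=> A _; rewrite /= tnth_mktuple mxvecE.
exact: measurable_mx_entry.
Qed.

Variable mu : {sigma_finite_measure set T -> \bar R}.

Definition mx_measure : set 'M[T]_(m, n) -> \bar R :=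
  pushforward (tuple_measure mu (m * n)) mx_of_tuple.

Lemma mx_measure_sfm : is_sigma_finite_measure mx_measure.
Proof.
exact: pushforward_sfm (tuple_measure_sfm mu _) measurable_mx_of_tuple
  measurable_tuple_of_mx mx_of_tupleK.
Qed.

HB.instance Definition _ := isMeasure.Build _ _ _ mx_measure
  (sfm_set0 mx_measure_sfm) (sfm_ge0 mx_measure_sfm)
  (sfm_sigma_additive mx_measure_sfm).
HB.instance Definition _ := Measure_isSigmaFinite.Build _ _ _ mx_measure
  (sfm_sigma_finite mx_measure_sfm).

End mx_measure.
Arguments mx_measure {d T R} m n mu.

Section complex_lebesgue.
Context {R : realType}.

Definition complex_lebesgue : set R[i] -> \bar R :=
  pushforward (@lebesgue_measure R \x @lebesgue_measure R)%E
    (@complex_of_coords R).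

Lemma complex_lebesgue_sfm : is_sigma_finite_measure complex_lebesgue.
Proof.
apply: pushforward_sfm measurable_complex_of_coords measurable_complex_coords _.
  exact: (product_sfm (@lebesgue_measure R) (@lebesgue_measure R)).
by case.
Qed.

HB.instance Definition _ := isMeasure.Build _ _ _ complex_lebesgue
  (sfm_set0 complex_lebesgue_sfm) (sfm_ge0 complex_lebesgue_sfm)
  (sfm_sigma_additive complex_lebesgue_sfm).
HB.instance Definition _ := Measure_isSigmaFinite.Build _ _ _ complex_lebesgue
  (sfm_sigma_finite complex_lebesgue_sfm).

End complex_lebesgue.

Section hermitian_lebesgue.
Context {R : realType} {p : nat}.

(* A Hermitian V is encoded by p ^ 2 real coordinates stored in a square
   matrix: V_ii on the diagonal, and, for i < j, Re V_ij in position (i, j)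
   and Im V_ij in position (j, i). *)
Definition hermitian_of_coords (A : 'M[R]_p) : 'M[R[i]]_p :=
  \matrix_(i, j)
    if i == j then A i i +i* 0
    else if (i < j)%N then A i j +i* A j i
    else A j i -i* A i j.

Definition hermitian_coords (V : 'M[R[i]]_p) : 'M[R]_p :=
  \matrix_(i, j) if (i <= j)%N then complex.Re (V i j)
                 else complex.Im (V j i).

Lemma hermitian_of_coordsK : cancel hermitian_of_coords hermitian_coords.
Proof.
move=> A; apply/matrixP => i j; rewrite !mxE.
case: ltngtP => ij /=.
- by rewrite ifN// -val_eqE/= neq_ltn ij.
- by rewrite ifN// -val_eqE/= neq_ltn ij.
- by move/val_inj : ij => ->; rewrite eqxx.
Qed.

Lemma hermitian_of_coords_hermsym A : hermitian_of_coords A \is hermsymmx.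
Proof.
apply/is_hermitianmxP; rewrite expr0 scale1r.
apply/matrixP => i j; rewrite !mxE.
have [<-|ij] := eqVneq i j; first by rewrite conjCE/= oppr0.
rewrite conjCE; case: ltngtP => //= [_|ji]; first by rewrite opprK.
by move/val_inj : ji => ji; rewrite ji eqxx in ij.
Qed.

Definition hermitian_lebesgue : set 'M[R[i]]_p -> \bar R :=
  pushforward (mx_measure p p (@lebesgue_measure R)) hermitian_of_coords.

Lemma measurable_hermitian_of_coords : measurable_fun setT hermitian_of_coords.
Proof.
have mc (f g : 'M[R]_p -> R) : measurable_fun setT f -> measurable_fun setT g ->
    measurable_fun setT (fun A => f A +i* g A).
  move=> mf mg.
  exact: measurableT_comp measurable_complex_of_coords (measurable_fun_pair mf mg).
have me (i j : 'I_p) : measurable_fun setT (fun A : 'M[R]_p => A i j).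
  exact: measurable_mx_entry.
apply/measurable_fun_mxP => i j.
apply: (@eq_measurable_fun _ _ _ _ _ (fun A : 'M[R]_p =>
    if i == j then A i i +i* 0
    else if (i < j)%N then A i j +i* A j i else A j i -i* A i j)).
  by move=> A _; rewrite mxE.
case: (i == j); first exact: mc.
by case: (i < j)%N; apply: mc => //; exact: measurableT_comp.
Qed.

Lemma measurable_hermitian_coords : measurable_fun setT hermitian_coords.
Proof.
apply/measurable_fun_mxP => i j.
apply: (@eq_measurable_fun _ _ _ _ _ (fun V : 'M[R[i]]_p =>
    if (i <= j)%N then complex.Re (V i j) else complex.Im (V j i))).
  by move=> V _; rewrite mxE.
have mc (i0 j0 : 'I_p) : measurable_fun setT
    (fun V : 'M[R[i]]_p => complex_coords (V i0 j0)).
  exact: measurableT_comp measurable_complex_coords (measurable_mx_entry _ _).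
case: (i <= j)%N; first exact: (measurableT_comp measurable_fst (mc i j)).
exact: (measurableT_comp measurable_snd (mc j i)).
Qed.

Lemma hermitian_lebesgue_sfm : is_sigma_finite_measure hermitian_lebesgue.
Proof.
apply: pushforward_sfm measurable_hermitian_of_coords
  measurable_hermitian_coords hermitian_of_coordsK.
exact: (mx_measure_sfm p p (@lebesgue_measure R)).
Qed.

HB.instance Definition _ := isMeasure.Build _ _ _ hermitian_lebesgue
  (sfm_set0 hermitian_lebesgue_sfm) (sfm_ge0 hermitian_lebesgue_sfm)
  (sfm_sigma_additive hermitian_lebesgue_sfm).
HB.instance Definition _ := Measure_isSigmaFinite.Build _ _ _ hermitian_lebesgue
  (sfm_sigma_finite hermitian_lebesgue_sfm).

End hermitian_lebesgue.

Section has_density.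
Context d1 d2 (T : measurableType d1) (U : measurableType d2) (R : realType).
Local Open Scope ereal_scope.

Definition has_density (P : probability T R) (X : T -> U)
    (mu : set U -> \bar R) (f : U -> R) : Prop :=
  [/\ measurable_fun setT X, measurable_fun setT f, (forall u, (0 <= f u)%R)
    & forall B, measurable B -> P (X @^-1` B) = \int[mu]_(u in B) (f u)%:E].

End has_density.

Section complex_normal.
Context {R : realType}.
Local Open Scope ereal_scope.

(* CN(0, 1): independent real and imaginary parts of variance 1 / 2.
   The second argument of normal_prob is the standard deviation. *)
Definition complex_normal01 : set R[i] -> \bar R :=
  let N := normal_prob 0 (Num.sqrt (2^-1)%R : R) in
  pushforward (N \x N) (@complex_of_coords R).

Definition iid_complex_normal01 d (T : measurableType d)
    (P : probability T R) m n (X : T -> 'M[R[i]]_(m, n)) : Prop :=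
  [/\ measurable_fun setT X,
      (forall i j (B : set R[i]), measurable B ->
         P [set t | B (X t i j)] = complex_normal01 B)
    & (forall B : 'I_m -> 'I_n -> set R[i], (forall i j, measurable (B i j)) ->
         P [set t | forall i j, B i j (X t i j)] =
         \prod_(i < m) \prod_(j < n) P [set t | B i j (X t i j)])].

End complex_normal.

Section complex_beta.
Context {R : realType}.

Definition psdmx p (A : 'M[R[i]]_p) : Prop :=
  A \is hermsymmx /\ forall v : 'cV[R[i]]_p, 0 <= (v^t* *m A *m v) ord0 ord0.

Definition lemx p (A B : 'M[R[i]]_p) : Prop := psdmx (B - A).

Definition Gamma (a : R) : R :=
  \int[@lebesgue_measure R]_(t in `]0, +oo[) (t `^ (a - 1) * expR (- t)).

Definition complex_multigamma (p : nat) (a : R) : R :=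
  pi ^+ (p * p.-1)./2 * \prod_(1 <= i < p.+1) Gamma (a - i%:R + 1).

(* Density of CB_p^I(a, b) for integers p <= a and p <= b, so that the
   truncated subtractions in the exponents are genuine. For 0 <= V <= I both
   determinants are real, and complex.Re only casts them into R. *)
Definition complex_betaI_pdf (p a b : nat) (V : 'M[R[i]]_p) : R :=
  if `[< lemx 0 V /\ lemx V 1%:M >] then
    complex_multigamma p (a + b)%:R
      / (complex_multigamma p a%:R * complex_multigamma p b%:R)
    * complex.Re (\det V) ^+ (a - p) * complex.Re (\det (1%:M - V)) ^+ (b - p)
  else 0.

End complex_beta.

Section fisher.
Context {R : realType} {n m p : nat}.

(* Partial derivatives are taken along the canonical basis of R^p, separately
   for the real and the imaginary parts of each component of x. *)
Definition is_sensitivity_mx (x : 'cV[R]_p -> 'cV[R[i]]_n) (theta : 'cV[R]_p)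
    (G : 'M[R[i]]_(n, p)) : Prop :=
  forall i j,
    is_derive theta (delta_mx j 0) (fun t => complex.Re (x t i 0) : R^o)
      (complex.Re (G i j)) /\
    is_derive theta (delta_mx j 0) (fun t => complex.Im (x t i 0) : R^o)
      (complex.Im (G i j)).

(* The orthogonal projection P_{Phi^H}. If Phi *m Phi^t* is singular, which has
   probability 0 when Phi has a density, invmx returns its argument. *)
Definition proj_rowspace (Phi : 'M[R[i]]_(m, n)) : 'M[R[i]]_n :=
  Phi^t* *m invmx (Phi *m Phi^t*) *m Phi.

Definition fisher (sigma2 : R) (G : 'M[R[i]]_(n, p)) : 'M[R[i]]_p :=
  (sigma2^-1)%:C *: (G^t* *m G).

Definition compressed_fisher (sigma2 : R) (G : 'M[R[i]]_(n, p))
    (Phi : 'M[R[i]]_(m, n)) : 'M[R[i]]_p :=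
  (sigma2^-1)%:C *: (G^t* *m proj_rowspace Phi *m G).

(* S plays the role of J^(1/2). *)
Definition normalized_fisher (sigma2 : R) (G : 'M[R[i]]_(n, p))
    (S : 'M[R[i]]_p) (Phi : 'M[R[i]]_(m, n)) : 'M[R[i]]_p :=
  invmx S *m compressed_fisher sigma2 G Phi *m invmx (S^t*).

End fisher.

(* Main.v *)
Require Import Defs.
From HB Require Import structures.
From mathcomp Require Import all_boot all_order all_algebra.
From mathcomp Require Import fingroup perm complex.
From mathcomp Require Import all_classical all_reals all_analysis.
From mathcomp Require Import measurable_realfun ring lra.

Set Implicit Arguments.
Unset Strict Implicit.
Unset Printing Implicit Defensive.

Import Order.TTheory GRing.Theory Num.Theory.
Import numFieldNormedType.Exports.

Local Open Scope classical_set_scope.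
Local Open Scope sesquilinear_scope.
Local Open Scope ring_scope.

(* With Q = sigma^-1 G J^(-H/2), which is an isometry, W = Q^H P Q where P
   projects on the row space of Phi. As the density of Phi is invariant under
   right multiplication by unitary matrices, the law of W does not depend on
   the isometry Q, which may therefore be replaced by Z L^(-H) for an
   independent n x p Gaussian matrix Z with Cholesky factorization
   Z^H Z = L L^H. For fixed Phi, a unitary change of variables in Z turns P
   into the projection on the first m coordinates. If Y and Y' are the first m
   and the last n - m rows of Z, then W has the law of L^-1 Y^H Y L^(-H), where
   L L^H = Y^H Y + Y'^H Y'. Both Gram matrices have complex Wishart laws, from
   which this law is computed like a scalar Beta integral from two Gamma
   integrals. *)

(** * Integration over spaces of matrices *)

(** The argument is arranged so as to rest on Tonelli's theorem and on the uniqueness of measures.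
    Averaging over a Gaussian Z stands in for averaging over the unitary group. Jacobians of linear
    maps are assembled by Gaussian elimination from translations, dilations and permutations; the
    radial law of a complex vector comes from a scaling argument, and its constant from a Gaussian
    integral, which is where the Gamma function enters; the Jacobian of X |-> T X T^H on Hermitian
    matrices is read off the Wishart formula. All identities are stated for arbitrary nonnegative
    measurable test functions with values in the extended reals, so that Tonelli applies throughout;
    care is required only where a constant is cancelled. Inductions on the size of a Hermitian
    matrix go through Schur complements, which also give the measurability of definiteness and of
    Cholesky factors. Inverses and Cholesky factors have default values at singular matrices, hence
    the recurring null sets. The bound m <= n - p gives p <= n - m, so that both Gram matrices have
    densities. *)

Section iterated_integrals.
Context d1 d2 (T1 : measurableType d1) (T2 : measurableType d2) (R : realType).
Variables (m1 : {sigma_finite_measure set T1 -> \bar R})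
          (m2 : {sigma_finite_measure set T2 -> \bar R}).
Variable f : T1 -> T2 -> \bar R.
Local Open Scope ereal_scope.
Hypothesis mf : measurable_fun setT (fun z : T1 * T2 => f z.1 z.2).
Hypothesis f0 : forall x y, 0 <= f x y.

Lemma measurable_fun_integral : measurable_fun setT (fun x => \int[m2]_y f x y).
Proof.
exact: (measurable_fun_fubini_tonelli_F (fun z : T1 * T2 => f z.1 z.2)).
Qed.

Lemma exchange_integral :
  \int[m1]_x \int[m2]_y f x y = \int[m2]_y \int[m1]_x f x y.
Proof. exact: (fubini_tonelli (fun z : T1 * T2 => f z.1 z.2)). Qed.

Lemma product_integral :
  \int[m1 \x m2]_z f z.1 z.2 = \int[m1]_x \int[m2]_y f x y.
Proof. exact: (fubini_tonelli1 (fun z : T1 * T2 => f z.1 z.2)). Qed.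

End iterated_integrals.
Arguments measurable_fun_integral {d1 d2 T1 T2 R} m2 f.
Arguments exchange_integral {d1 d2 T1 T2 R} m1 m2 f.
Arguments product_integral {d1 d2 T1 T2 R} m1 m2 f.

Section ge0_integral_pushforwardT.
Context d1 d2 (T1 : measurableType d1) (T2 : measurableType d2) (R : realType).
Local Open Scope ereal_scope.

(** Agreement with the image measure is asked on measurable sets only, which is what uniqueness
    theorems for measures provide. *)
Lemma ge0_integral_image (mu : {measure set T1 -> \bar R})
    (nu : {measure set T2 -> \bar R}) (phi : T1 -> T2) (f : T2 -> \bar R) :
  measurable_fun setT phi ->
  (forall A, measurable A -> nu A = mu (phi @^-1` A)) ->
  measurable_fun setT f -> (forall y, 0 <= f y) ->
  \int[nu]_y f y = \int[mu]_x f (phi x).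
Proof.
move=> mphi nuE mf f0.
rewrite -[RHS](ge0_integral_pushforward mphi mu measurableT)//.
by apply: eq_measure_integral => A mA _; exact: nuE.
Qed.

Lemma ge0_integralZlT (mu : {measure set T1 -> \bar R}) (f : T1 -> \bar R)
    (k : R) :
  measurable_fun setT f -> (forall x, 0 <= f x) -> (0 <= k)%R ->
  \int[mu]_x (k%:E * f x) = k%:E * \int[mu]_x f x.
Proof. by move=> mf f0 k0; rewrite ge0_integralZl// lee_fin. Qed.

End ge0_integral_pushforwardT.

Section null_sets.
Context d (T : measurableType d) (R : realType).
Variable mu : {measure set T -> \bar R}.
Local Open Scope ereal_scope.

(** The null set is presented by a boolean test whose indicator has integral 0, so that nullity can
    be proved with the same Tonelli and change-of-variables formulas as the other identities. *)
Lemma ge0_eq_integral_off_null (N : T -> bool) (f g : T -> \bar R) :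
  measurable_fun setT N -> \int[mu]_x (if N x then 1 else 0)%:E = 0 ->
  measurable_fun setT f -> (forall x, 0 <= f x) ->
  measurable_fun setT g -> (forall x, 0 <= g x) ->
  (forall x, ~~ N x -> f x = g x) ->
  \int[mu]_x f x = \int[mu]_x g x.
Proof.
move=> mN N0 mf f0 mg g0 fg; apply: ge0_ae_eq_integral => //.
have mNs : measurable [set x | N x].
  by have := mN measurableT [set true] _; rewrite setTI; exact.
exists [set x | N x]; split=> //.
  transitivity (\int[mu]_x (\1_[set x | N x] x)%:E).
    by rewrite integral_indic// setIT.
  rewrite -[RHS]N0; apply: eq_integral => x _; rewrite indicE/=.
  by case: ifPn => Nx; [rewrite mem_set|rewrite memNset//; exact/negP].
move=> x /=; apply: contra_notP => /negP Nx _.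
exact: fg.
Qed.

Lemma integral_mul_indic (D : set T) (f : T -> \bar R) :
  \int[mu]_(x in D) f x = \int[mu]_x (f x * (\1_D x)%:E).
Proof. by rewrite integral_mkcond epatch_indic. Qed.

End null_sets.

(** * Uniqueness of the product measure on matrices *)

Section boxes.
Context d (T : measurableType d) (R : realType).
Variable mu : {sigma_finite_measure set T -> \bar R}.
Local Open Scope ereal_scope.

Lemma measurable_tuple_box n (B : 'I_n -> set T) :
  (forall k, measurable (B k)) ->
  measurable [set t : n.-tuple T | forall k, B k (tnth t k)].
Proof.
move=> mB.
rewrite (_ : mkset _ = \big[setI/setT]_(k < n) [set t | B k (tnth t k)]).
  apply: bigsetI_measurable => k _.
  by have := @measurable_tnth _ _ n k measurableT _ (mB k); rewrite setTI.
apply/seteqP; split => [t Bt|t].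
  by elim/big_ind: _ => // i _; exact: Bt.
by move=> + k; rewrite (bigD1 k)//= => -[].
Qed.

Lemma tuple_measure_box n (B : 'I_n -> set T) :
  (forall k, measurable (B k)) ->
  tuple_measure mu n [set t | forall k, B k (tnth t k)] =
  \prod_(k < n) mu (B k).
Proof.
elim: n B => [|n IHn] B mB.
  by rewrite big_ord0 /= diracE mem_set// => -[].
have mB' : measurable [set t : n.-tuple T | forall k, B (lift ord0 k) (tnth t k)].
  exact: (@measurable_tuple_box _ (fun k => B (lift ord0 k))).
rewrite big_ord_recl -IHn// -(product_measure1E mu (tuple_measure mu n))//.
congr ((mu \x tuple_measure mu n) _); apply/seteqP; split => -[x t] /=.
  move=> Bt; split; first by have := Bt ord0; rewrite tnth0.
  by move=> k; have := Bt (lift ord0 k); rewrite tnthS.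
move=> [Bx Bt] k; case: (unliftP ord0 k) => [j|] ->; last by rewrite tnth0.
by rewrite tnthS.
Qed.

Definition mx_box m n (B : 'I_m -> 'I_n -> set T) : set 'M[T]_(m, n) :=
  [set A | forall i j, B i j (A i j)].

Lemma measurable_mx_box m n (B : 'I_m -> 'I_n -> set T) :
  (forall i j, measurable (B i j)) -> measurable (mx_box B).
Proof.
move=> mB.
rewrite (_ : mx_box B = \big[setI/setT]_(i < m) \big[setI/setT]_(j < n)
    [set A : 'M[T]_(m, n) | B i j (A i j)]).
  apply: bigsetI_measurable => i _; apply: bigsetI_measurable => j _.
  have := @measurable_mx_entry _ T m n i j measurableT _ (mB i j).
  by rewrite setTI.
apply/seteqP; split => [A BA|A].
  by elim/big_ind: _ => // i _; elim/big_ind: _ => // j _; exact: BA.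
by move=> + i j; rewrite (bigD1 i)//= (bigD1 j)//= => -[[]].
Qed.

Lemma mx_measure_box m n (B : 'I_m -> 'I_n -> set T) :
  (forall i j, measurable (B i j)) ->
  mx_measure m n mu (mx_box B) = \prod_(i < m) \prod_(j < n) mu (B i j).
Proof.
move=> mB; rewrite /mx_measure /pushforward.
pose B' k : set T := mxvec (\matrix_(i, j) B i j) ord0 k.
have B'E i j : B' (mxvec_index i j) = B i j by rewrite /B' mxvecE mxE.
rewrite (_ : _ @^-1` _ = [set t | forall k, B' k (tnth t k)]); last first.
  apply/seteqP; split=> t /= Bt.
    by move=> k; case/mxvec_indexP: k => i j; have := Bt i j; rewrite B'E !mxE.
  by move=> i j; rewrite !mxE -B'E; exact: Bt.
rewrite tuple_measure_box; last first.
  by move=> k; case/mxvec_indexP: k => i j; rewrite B'E.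
rewrite (reindex _ (curry_mxvec_bij _ _)) /= pair_bigA/=.
by apply: eq_bigr => -[i j] _; rewrite /= B'E.
Qed.

Definition mx_boxes m n : set (set 'M[T]_(m, n)) :=
  [set mx_box B | B in [set B | forall i j, measurable (B i j)]].

Lemma measurable_mx_boxesE m n :
  @measurable _ 'M[T]_(m, n) = <<s @mx_boxes m n >>.
Proof.
apply/seteqP; split.
  apply: smallest_sub; first exact: smallest_sigma_algebra.
  move=> _ [i [j [B mB <-]]]; apply: sub_sigma_algebra.
  exists (fun i' j' => if (i' == i) && (j' == j) then B else setT).
    by move=> i' j'; case: ifP.
  rewrite setTI; apply/seteqP; split => A /=.
    by move=> /(_ i j); rewrite !eqxx.
  by move=> BA i' j'; case: ifP => // /andP[/eqP-> /eqP->].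
apply: smallest_sub; first exact: sigma_algebra_measurable.
by move=> _ [B mB <-]; exact: measurable_mx_box.
Qed.

(** Boxes are stable under intersection and generate the sigma-algebra. The boxes with all sides
    [F k], for an increasing exhaustion [F] of [T] by sets of finite measure, exhaust the matrices
    and have finite measure. *)
Lemma mx_measure_unique m n (nu : {measure set 'M[T]_(m, n) -> \bar R}) :
  (forall B, (forall i j, measurable (B i j)) ->
     nu (mx_box B) = \prod_(i < m) \prod_(j < n) mu (B i j)) ->
  forall A, measurable A -> mx_measure m n mu A = nu A.
Proof.
move=> nuE A mA.
have /sigma_finiteP[F [TF ndF Foo]] := sigma_finiteT mu.
apply: (measure_unique (@mx_boxes m n) (fun k => mx_box (fun _ _ => F k))) => //.
- exact: measurable_mx_boxesE.
- move=> _ _ [B mB <-] [C mC <-]; exists (fun i j => B i j `&` C i j).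
    by move=> i j; exact: measurableI.
  by apply/seteqP; split => [X BCX|X [BX CX] i j];
    [split => i j; have [] := BCX i j|split; [exact: BX|exact: CX]].
- by move=> k; exists (fun _ _ => F k) => // i j; have [] := Foo k.
- apply/seteqP; split => // X _ /=.
  have /choice[k Fk] : forall z : 'I_m * 'I_n, exists k, F k (X z.1 z.2).
    by move=> z; have : setT (X z.1 z.2) by []; rewrite TF => -[k _ ?]; exists k.
  (* A matrix has finitely many entries and [F] is increasing, so the largest of their indices
     serves them all. *)
  exists (\max_(z : 'I_m * 'I_n) k z)%N => // i j.
  have le_k : (k (i, j) <= \max_(z : 'I_m * 'I_n) k z)%N by exact: leq_bigmax.
  by have /subsetPset := ndF _ _ le_k; apply; exact: (Fk (i, j)).
- by move=> _ [B mB <-]; rewrite nuE//; exact: mx_measure_box.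
- move=> k; have mFk : forall (i : 'I_m) (j : 'I_n), measurable (F k).
    by move=> _ _; have [] := Foo k.
  rewrite [X in X < _](mx_measure_box mFk).
  have [_ Fkoo] := Foo k.
  have prod_ltoo p (G : 'I_p -> \bar R) : (forall i, 0 <= G i) ->
      (forall i, G i < +oo) -> \prod_(i < p) G i < +oo.
    move=> G0 Goo; rewrite -ge0_fin_numE; last by apply: prode_ge0.
    by apply: prode_fin_num => i _; rewrite ge0_fin_numE.
  apply: (prod_ltoo) => i; first exact: prode_ge0.
  by apply: (prod_ltoo) => // j; have [] := Foo k.
Qed.

(** The criterion to which structural changes of variables reduce: [nu] may live on pairs, on
    scalars or on matrices of another shape, and only preimages of boxes have to be measured. *)
Lemma mx_integral_image d' (U : measurableType d') (m n : nat)
    (nu : {measure set U -> \bar R}) (phi : U -> 'M[T]_(m, n)) :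
  measurable_fun setT phi ->
  (forall B, (forall i j, measurable (B i j)) ->
     nu (phi @^-1` mx_box B) = \prod_(i < m) \prod_(j < n) mu (B i j)) ->
  forall f, measurable_fun setT f -> (forall A, 0 <= f A) ->
  \int[mx_measure m n mu]_A f A = \int[nu]_u f (phi u).
Proof.
move=> mphi nuE f mf f0; apply: ge0_integral_image => // A mA.
pose phi_mix := isMeasurableFun.Build _ _ _ _ phi mphi.
pose phi_pack : {mfun U >-> 'M[T]_(m, n)} := HB.pack phi phi_mix.
exact: (mx_measure_unique (nu := pushforward nu phi_pack)).
Qed.

End boxes.

(** * Blocks, transposition, permutation and entrywise changes of variables *)

Section mx_integral_structure.
Context d (T : measurableType d) (R : realType).
Variable mu : {sigma_finite_measure set T -> \bar R}.
Local Open Scope ereal_scope.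

Lemma measurable_fun_mx_entry d' (U : measurableType d') m n
    (f : U -> 'M[T]_(m, n)) i j :
  measurable_fun setT f -> measurable_fun setT (fun u => f u i j).
Proof. by move=> mf; apply: (measurable_fun_mxP f).2. Qed.

Lemma measurable_fun_col_mx d' (U : measurableType d') m1 m2 n
    (f : U -> 'M[T]_(m1, n)) (g : U -> 'M[T]_(m2, n)) :
  measurable_fun setT f -> measurable_fun setT g ->
  measurable_fun setT (fun u => col_mx (f u) (g u)).
Proof.
move=> mf mg; apply/measurable_fun_mxP => i j.
rewrite (_ : (fun u => _) = (fun u => match fintype.split i with
  | inl i1 => f u i1 j | inr i2 => g u i2 j end)).
  by case: fintype.split => k; exact: measurable_fun_mx_entry.
by apply/funext => u; rewrite mxE.
Qed.

Lemma measurable_fun_trmx d' (U : measurableType d') m n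
    (f : U -> 'M[T]_(m, n)) :
  measurable_fun setT f -> measurable_fun setT (fun u => (f u)^T).
Proof.
move=> mf; apply/measurable_fun_mxP => i j.
rewrite (_ : (fun u => _) = (fun u => f u j i)).
  exact: measurable_fun_mx_entry.
by apply/funext => u; rewrite mxE.
Qed.

Lemma measurable_fun_row_mx d' (U : measurableType d') m n1 n2
    (f : U -> 'M[T]_(m, n1)) (g : U -> 'M[T]_(m, n2)) :
  measurable_fun setT f -> measurable_fun setT g ->
  measurable_fun setT (fun u => row_mx (f u) (g u)).
Proof.
move=> mf mg; apply/measurable_fun_mxP => i j.
rewrite (_ : (fun u => _) = (fun u => match fintype.split j with
  | inl i1 => f u i i1 | inr i2 => g u i i2 end)).
  by case: fintype.split => k; exact: measurable_fun_mx_entry.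
by apply/funext => u; rewrite mxE.
Qed.

Lemma measurable_fun_block_mx d' (U : measurableType d') m1 m2 n1 n2
    (a : U -> 'M[T]_(m1, n1))
    (b : U -> 'M[T]_(m1, n2)) (c : U -> 'M[T]_(m2, n1))
    (e : U -> 'M[T]_(m2, n2)) :
  measurable_fun setT a -> measurable_fun setT b -> measurable_fun setT c ->
  measurable_fun setT e ->
  measurable_fun setT (fun u => block_mx (a u) (b u) (c u) (e u)).
Proof.
by move=> ma mb mc me; apply: measurable_fun_col_mx;
  exact: measurable_fun_row_mx.
Qed.

Lemma mx_integral_col_mx m1 m2 n (f : 'M[T]_(m1 + m2, n) -> \bar R) :
  measurable_fun setT f -> (forall A, 0 <= f A) ->
  \int[mx_measure (m1 + m2) n mu]_A f A =
  \int[mx_measure m1 n mu]_A \int[mx_measure m2 n mu]_B f (col_mx A B).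
Proof.
move=> mf f0.
have mphi : measurable_fun setT
    (fun z : 'M[T]_(m1, n) * 'M[T]_(m2, n) => col_mx z.1 z.2).
  exact: measurable_fun_col_mx.
rewrite (mx_integral_image (nu := mx_measure m1 n mu \x mx_measure m2 n mu)
  (phi := fun z => col_mx z.1 z.2))//; last first.
  move=> B mB.
  rewrite big_split_ord/= -!mx_measure_box// -product_measure1E//;
    [|exact: measurable_mx_box|exact: measurable_mx_box].
  congr ((_ \x _) _); apply/seteqP; split => -[X Y] /= XYB.
    split=> i j; first by have := XYB (lshift _ i) j; rewrite col_mxEu.
    by have := XYB (rshift _ i) j; rewrite col_mxEd.
  move=> i j; case: (fintype.split_ordP i) => k ->.
    by rewrite col_mxEu; exact: XYB.1.
  by rewrite col_mxEd; exact: XYB.2.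
rewrite (product_integral (mx_measure m1 n mu) (mx_measure m2 n mu)
  (fun A B => f (col_mx A B)))//.
exact: measurableT_comp mf mphi.
Qed.

Lemma mx_integral_tr m n (f : 'M[T]_(m, n) -> \bar R) :
  measurable_fun setT f -> (forall A, 0 <= f A) ->
  \int[mx_measure m n mu]_A f A = \int[mx_measure n m mu]_A f A^T.
Proof.
move=> mf f0.
rewrite (mx_integral_image (nu := mx_measure n m mu)
  (phi := fun A => A^T))//; first exact: measurable_fun_trmx.
move=> B mB; rewrite exchange_big/= -mx_measure_box//.
congr mx_measure; apply/seteqP; split => A /= BA i j.
  by have := BA j i; rewrite mxE.
by rewrite mxE.
Qed.

Lemma mx_integral_row_mx m n1 n2 (f : 'M[T]_(m, n1 + n2) -> \bar R) :
  measurable_fun setT f -> (forall A, 0 <= f A) ->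
  \int[mx_measure m (n1 + n2) mu]_A f A =
  \int[mx_measure m n1 mu]_A \int[mx_measure m n2 mu]_B f (row_mx A B).
Proof.
move=> mf f0.
have mT k l : measurable_fun setT (@trmx T k l) by exact: measurable_fun_trmx.
rewrite mx_integral_tr// mx_integral_col_mx//;
  last exact: (measurableT_comp mf (mT _ _)).
rewrite [RHS]mx_integral_tr//; last 2 first.
- apply: (measurable_fun_integral _ (fun A B => f (row_mx A B))) => //.
  by apply: (measurableT_comp mf); exact: measurable_fun_row_mx.
- by move=> A; exact: integral_ge0.
apply: eq_integral => A _; rewrite [RHS]mx_integral_tr//.
  by apply: eq_integral => B _; rewrite tr_col_mx.
by apply: (measurableT_comp mf); exact: measurable_fun_row_mx.
Qed.

Lemma measurable_fun_row_perm d' (U : measurableType d') m n (s : 'S_m)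
    (f : U -> 'M[T]_(m, n)) :
  measurable_fun setT f -> measurable_fun setT (fun u => row_perm s (f u)).
Proof.
move=> mf; apply/measurable_fun_mxP => i j.
rewrite (_ : (fun u => _) = (fun u => f u (s i) j)).
  exact: measurable_fun_mx_entry.
by apply/funext => u; rewrite mxE.
Qed.

Lemma mx_integral_row_perm m n (s : 'S_m) (f : 'M[T]_(m, n) -> \bar R) :
  measurable_fun setT f -> (forall A, 0 <= f A) ->
  \int[mx_measure m n mu]_A f (row_perm s A) = \int[mx_measure m n mu]_A f A.
Proof.
move=> mf f0; symmetry.
rewrite (mx_integral_image (nu := mx_measure m n mu) (phi := row_perm s))//;
  first exact: measurable_fun_row_perm.
move=> B mB; rewrite (reindex_inj (perm_inj (s := s^-1)))/= -mx_measure_box//.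
congr mx_measure; apply/seteqP; split => A /= BA i j.
  by have := BA (s^-1 i)%g j; rewrite mxE permKV.
by rewrite mxE; have := BA (s i) j; rewrite permK.
Qed.

(* The weight k compensates for maps phi that rescale mu, and k = 1 covers
   the measure-preserving ones. *)
Lemma mx_integral_entrywise m n (phi : 'I_m -> 'I_n -> T -> T) (k : R)
    (f : 'M[T]_(m, n) -> \bar R) :
  (0 <= k)%R ->
  (forall i j, measurable_fun setT (phi i j)) ->
  (forall i j B, measurable B -> k%:E * mu (phi i j @^-1` B) = mu B) ->
  measurable_fun setT f -> (forall A, 0 <= f A) ->
  (k ^+ (m * n))%:E *
    \int[mx_measure m n mu]_A f (\matrix_(i, j) phi i j (A i j)) =
  \int[mx_measure m n mu]_A f A.
Proof.
move=> k0 mphi phiE mf f0; symmetry.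
have mPhi : measurable_fun setT
    (fun A : 'M[T]_(m, n) => \matrix_(i, j) phi i j (A i j)).
  apply/measurable_fun_mxP => i j.
  rewrite (_ : (fun u => _) = phi i j \o (fun A : 'M[T]_(m, n) => A i j)).
    exact: (measurableT_comp (mphi i j) (measurable_mx_entry i j)).
  by apply/funext => A; rewrite mxE.
have kmn0 : (0 <= k ^+ (m * n))%R by rewrite exprn_ge0.
rewrite (mx_integral_image (nu := mscale (NngNum kmn0) (mx_measure m n mu))
  (phi := fun A => \matrix_(i, j) phi i j (A i j)))//.
  rewrite ge0_integral_mscale//.
  exact: measurableT_comp mf mPhi.
move=> B mB.
rewrite [LHS](_ : _ = (k ^+ (m * n))%:E *
  mx_measure m n mu (mx_box (fun i j => phi i j @^-1` B i j))); last first.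
  rewrite /mscale/=; congr (_ * mx_measure _ _ _ _); apply/seteqP.
  by split => A /= BA i j; have := BA i j; rewrite mxE.
rewrite mx_measure_box; last first.
  by move=> i j; rewrite -[X in measurable X]setTI; exact: mphi.
have -> : (k ^+ (m * n))%:E = \prod_(i < m) \prod_(j < n) k%:E.
  under eq_bigr do rewrite -(big_morph EFin (@EFinM R) erefl).
  rewrite -(big_morph EFin (@EFinM R) erefl); congr EFin.
  by under eq_bigr do rewrite prodr_const card_ord;
    rewrite prodr_const card_ord -exprM mulnC.
rewrite -big_split/=; apply: eq_bigr => i _.
by rewrite -big_split/=; apply: eq_bigr => j _; rewrite phiE.
Qed.

Lemma mx_integral_row0 n (A0 : 'M[T]_(0, n)) (f : 'M[T]_(0, n) -> \bar R) :
  measurable_fun setT f -> (forall A, 0 <= f A) ->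
  \int[mx_measure 0 n mu]_A f A = f A0.
Proof.
move=> mf f0.
rewrite (mx_integral_image (nu := \d_A0) (phi := id))//=.
  by rewrite integral_dirac// diracT mul1e.
by move=> B mB; rewrite big_ord0 diracE mem_set// => -[].
Qed.

Lemma mx_integral_col0 m (A0 : 'M[T]_(m, 0)) (f : 'M[T]_(m, 0) -> \bar R) :
  measurable_fun setT f -> (forall A, 0 <= f A) ->
  \int[mx_measure m 0 mu]_A f A = f A0.
Proof.
move=> mf f0; rewrite mx_integral_tr// (mx_integral_row0 A0^T) ?trmxK//.
by apply: (measurableT_comp mf); exact: measurable_fun_trmx.
Qed.

Lemma mx_integral_scalar (f : 'M[T]_(1, 1) -> \bar R) :
  measurable_fun setT f -> (forall A, 0 <= f A) ->
  \int[mx_measure 1 1 mu]_A f A = \int[mu]_x f (const_mx x).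
Proof.
move=> mf f0.
rewrite (mx_integral_image (nu := mu) (phi := fun x => const_mx x))//.
  apply/measurable_fun_mxP => i j.
  rewrite (_ : (fun u => _) = id)//.
  by apply/funext => u; rewrite mxE.
move=> B mB; rewrite !big_ord1; congr (mu _).
apply/seteqP; split => x /= Bx; first by have := Bx ord0 ord0; rewrite mxE.
by move=> i j; rewrite mxE !ord1.
Qed.

End mx_integral_structure.

(** * Lebesgue measure on the complex plane *)

Section lebesgue_affine.
Context {R : realType}.
Local Notation mu := (@lebesgue_measure R).
Local Open Scope ereal_scope.

(** Lebesgue measure is determined by its values on half-open intervals, and the preimage of such an
    interval under a translation is another one of the same length. *)
Lemma lebesgue_measure_translate (c : R) (A : set R) : measurable A ->
  mu ((fun x => x + c)%R @^-1` A) = mu A.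
Proof.
move=> mA; have mc : measurable_fun setT (fun x : R => x + c)%R.
  exact: measurable_funD.
pose c_mix := isMeasurableFun.Build _ _ (measurableTypeR R) (measurableTypeR R)
  _ mc.
pose c_pack : {mfun measurableTypeR R >-> measurableTypeR R} :=
  HB.pack (fun x : R => x + c)%R c_mix.
apply/esym.
apply: (lebesgue_measure_unique (mu := pushforward mu c_pack)) => //.
move=> _ [[a b]] _ <-.
have E : (fun x => x + c)%R @^-1` `]a, b] = `](a - c)%R, (b - c)%R]%classic.
  by apply/seteqP; split => x /=; rewrite !in_itv/= ltrBlDr lerBrDr.
transitivity (mu `](a - c)%R, (b - c)%R]%classic); last by rewrite -E.
rewrite !lebesgue_measure_itv/= !lte_fin ltrD2r.
by case: ifP => // _; rewrite -!EFinB; congr EFin; ring.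
Qed.

Lemma lebesgue_measure_dilate (a : R) (A : set R) : a != 0%R -> measurable A ->
  (`|a|)%:E * mu (( *%R a) @^-1` A) = mu A.
Proof.
move=> a0 mA; have ma : measurable_fun setT ( *%R a : R -> R).
  exact: measurable_funM.
pose a_mix := isMeasurableFun.Build _ _ (measurableTypeR R) (measurableTypeR R)
  _ ma.
pose a_pack : {mfun measurableTypeR R >-> measurableTypeR R} :=
  HB.pack ( *%R a : R -> R) a_mix.
apply/esym.
apply: (lebesgue_measure_unique
  (mu := mscale (NngNum (normr_ge0 a)) (pushforward mu a_pack))) => //.
move=> _ [[x y]] _ <-.
case: (ltgtP a 0%R) a0 => // a0 _.
(* A negative factor reverses the interval and moves its closed end to the left, which leaves its
   length unchanged up to the factor. *)
- have E : *%R a @^-1` `]x, y] = `[(a^-1 * y)%R, (a^-1 * x)%R[%classic.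
    apply/seteqP; split => z /=; rewrite !in_itv/=;
      by rewrite ler_ndivrMl// ltr_ndivlMl// andbC.
  transitivity (`|a|%:E * mu `[(a^-1 * y)%R, (a^-1 * x)%R[%classic);
    last by rewrite -E.
  rewrite !lebesgue_measure_itv/= !lte_fin ltr_nM2l ?invr_lt0//.
  case: ifP => // _; last by rewrite mule0.
  by rewrite -!EFinB -EFinM ltr0_norm//; congr EFin; field; rewrite lt_eqF.
- have E : *%R a @^-1` `]x, y] = `](a^-1 * x)%R, (a^-1 * y)%R]%classic.
    by apply/seteqP; split => z /=; rewrite !in_itv/= ltr_pdivrMl// ler_pdivlMl.
  transitivity (`|a|%:E * mu `](a^-1 * x)%R, (a^-1 * y)%R]%classic);
    last by rewrite -E.
  rewrite !lebesgue_measure_itv/= !lte_fin ltr_pM2l ?invr_gt0//.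
  case: ifP => // _; last by rewrite mule0.
  by rewrite -!EFinB -EFinM gtr0_norm//; congr EFin; field; rewrite gt_eqF.
Qed.

Lemma integral_translate (c : R) (f : R -> \bar R) :
  measurable_fun setT f -> (forall x, 0 <= f x) ->
  \int[mu]_x f (x + c)%R = \int[mu]_x f x.
Proof.
move=> mf f0; symmetry.
apply: (@ge0_integral_image _ _ (measurableTypeR R) (measurableTypeR R) R mu mu
  (fun x => x + c)%R) => //.
  exact: measurable_funD.
by move=> A mA; apply/esym; exact: lebesgue_measure_translate.
Qed.

Lemma integral_dilate (a : R) (f : R -> \bar R) : a != 0%R ->
  measurable_fun setT f -> (forall x, 0 <= f x) ->
  (`|a|)%:E * \int[mu]_x f (a * x)%R = \int[mu]_x f x.
Proof.
move=> a0 mf f0; symmetry; have ma : measurable_fun setT ( *%R a : R -> R).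
  exact: measurable_funM.
rewrite (@ge0_integral_image _ _ (measurableTypeR R) (measurableTypeR R) R
  (mscale (NngNum (normr_ge0 a)) mu) mu ( *%R a))//.
  rewrite ge0_integral_mscale//.
  exact: (@measurableT_comp _ _ _ (measurableTypeR R) _ _ f setT ( *%R a)).
by move=> A mA; apply/esym; exact: (lebesgue_measure_dilate a0 mA).
Qed.

End lebesgue_affine.

Section complex_measurable_fun.
Context d (U : measurableType d) (R : realType).
Implicit Types f g : U -> R[i].

Lemma measurable_complexP f :
  measurable_fun setT f <->
  (measurable_fun setT (fun u => complex.Re (f u)) /\
   measurable_fun setT (fun u => complex.Im (f u))).
Proof.
split=> [mf|[mRe mIm]].
  have mc : measurable_fun setT (fun u => complex_coords (f u)).
    exact: (measurableT_comp measurable_complex_coords mf).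
  by split; [exact: (measurableT_comp measurable_fst mc)|
             exact: (measurableT_comp measurable_snd mc)].
rewrite (_ : f = (@complex_of_coords R) \o
    (fun u => (complex.Re (f u), complex.Im (f u)))).
  exact: (measurableT_comp measurable_complex_of_coords
    (measurable_fun_pair mRe mIm)).
by apply/funext => u /=; rewrite /complex_of_coords/=; case: (f u).
Qed.

Lemma measurable_fun_Re f :
  measurable_fun setT f -> measurable_fun setT (fun u => complex.Re (f u)).
Proof. by move=> /measurable_complexP[]. Qed.

Lemma measurable_fun_Im f :
  measurable_fun setT f -> measurable_fun setT (fun u => complex.Im (f u)).
Proof. by move=> /measurable_complexP[]. Qed.

Lemma measurable_fun_Complex (a b : U -> R) :
  measurable_fun setT a -> measurable_fun setT b ->
  measurable_fun setT (fun u => Complex (a u) (b u)).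
Proof. by move=> ma mb; apply/measurable_complexP. Qed.

Lemma measurable_fun_real_complex (a : U -> R) :
  measurable_fun setT a -> measurable_fun setT (fun u => (a u)%:C%C).
Proof. by move=> ma; exact: measurable_fun_Complex. Qed.

Lemma measurable_fun_addc f g : measurable_fun setT f ->
  measurable_fun setT g -> measurable_fun setT (fun u => f u + g u).
Proof.
move=> /measurable_complexP[m1 m2] /measurable_complexP[m3 m4].
apply/measurable_complexP; split.
  rewrite (_ : (fun u => _) =
    (fun u => complex.Re (f u) + complex.Re (g u))).
    exact: measurable_funD.
  by apply/funext => u; case: (f u); case: (g u).
rewrite (_ : (fun u => _) =
  (fun u => complex.Im (f u) + complex.Im (g u))).
  exact: measurable_funD.
by apply/funext => u; case: (f u); case: (g u).
Qed.

Lemma measurable_fun_mulc f g : measurable_fun setT f ->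
  measurable_fun setT g -> measurable_fun setT (fun u => f u * g u).
Proof.
move=> /measurable_complexP[m1 m2] /measurable_complexP[m3 m4].
apply/measurable_complexP; split.
  rewrite (_ : (fun u => _) = (fun u => complex.Re (f u) * complex.Re (g u) -
    complex.Im (f u) * complex.Im (g u))).
    by apply: measurable_funB; exact: measurable_funM.
  by apply/funext => u; case: (f u); case: (g u).
rewrite (_ : (fun u => _) = (fun u => complex.Re (f u) * complex.Im (g u) +
  complex.Im (f u) * complex.Re (g u))).
  by apply: measurable_funD; exact: measurable_funM.
by apply/funext => u; case: (f u); case: (g u).
Qed.

Lemma measurable_fun_oppc f :
  measurable_fun setT f -> measurable_fun setT (fun u => - f u).
Proof.
move=> mf; rewrite (_ : (fun u => _) = (fun u => (-1) * f u)).
  exact: measurable_fun_mulc.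
by apply/funext => u; rewrite mulN1r.
Qed.

Lemma measurable_fun_conjc f :
  measurable_fun setT f -> measurable_fun setT (fun u => (f u)^*).
Proof.
move=> /measurable_complexP[m1 m2]; apply/measurable_complexP; split.
  rewrite (_ : (fun u => _) = (fun u => complex.Re (f u)))//.
  by apply/funext => u; rewrite conjCE; case: (f u).
rewrite (_ : (fun u => _) = (fun u => - complex.Im (f u))).
  exact: measurable_funN.
by apply/funext => u; rewrite conjCE; case: (f u).
Qed.

Lemma measurable_fun_invc f :
  measurable_fun setT f -> measurable_fun setT (fun u => (f u)^-1).
Proof.
move=> /measurable_complexP[m1 m2].
pose q u := complex.Re (f u) ^+ 2 + complex.Im (f u) ^+ 2.
have mq : measurable_fun setT (fun u => (q u)^-1).
  rewrite (_ : (fun u => _) = (fun u => q u `^ (-1))); last first.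
    by apply/funext => u; rewrite powR_inv1// addr_ge0 ?sqr_ge0.
  apply: (measurableT_comp (measurable_powR _)).
  by apply: measurable_funD; exact: measurable_funX.
apply/measurable_complexP; split.
  rewrite (_ : (fun u => _) = (fun u => complex.Re (f u) * (q u)^-1)).
    exact: measurable_funM.
  by apply/funext => u; rewrite /q; case: (f u).
rewrite (_ : (fun u => _) = (fun u => - complex.Im (f u) * (q u)^-1)).
  by apply: measurable_funM => //; exact: measurable_funN.
by apply/funext => u; rewrite /q; case: (f u) => a b /=; rewrite mulNr.
Qed.

End complex_measurable_fun.

Lemma measurable_fun_invr d (U : measurableType d) (R : realType) (f : U -> R) :
  measurable_fun setT f -> measurable_fun setT (fun u => (f u)^-1).
Proof.
(* The real power of exponent -1 is the inverse on nonnegative reals, hence the detour through the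
   square; both sides are 0 where [f u] is 0. *)
move=> mf; rewrite (_ : (fun u => _) = (fun u => f u * (f u ^+ 2) `^ (-1))).
  apply: measurable_funM => //.
  by apply: (measurableT_comp (measurable_powR _)); exact: measurable_funX.
apply/funext => u; rewrite powR_inv1 ?sqr_ge0//.
have [->|fu0] := eqVneq (f u) 0; first by rewrite invr0 mul0r.
by field.
Qed.

Section complex_lebesgue_integral.
Context {R : realType}.
Local Notation mu := (@lebesgue_measure R).
Local Notation nu := (@complex_lebesgue R).
Local Open Scope ereal_scope.
Implicit Type f : R[i] -> \bar R.

Lemma complex_integral f : measurable_fun setT f -> (forall z, 0 <= f z) ->
  \int[nu]_z f z = \int[mu]_x \int[mu]_y f (Complex x y).
Proof.
move=> mf f0.
rewrite (ge0_integral_image (mu := mu \x mu) (phi := @complex_of_coords R))//;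
  last exact: measurable_complex_of_coords.
rewrite -(product_integral mu mu (fun x y => f (Complex x y)))//.
exact: (measurableT_comp mf measurable_complex_of_coords).
Qed.

Let mfC f : measurable_fun setT f -> forall d (U : measurableType d)
  (a b : U -> R), measurable_fun setT a -> measurable_fun setT b ->
  measurable_fun setT (fun u => f (Complex (a u) (b u))).
Proof.
by move=> mf d U a b ma mb; exact: (measurableT_comp mf (measurable_fun_Complex _ _)).
Qed.

Lemma complex_integral_conj f : measurable_fun setT f -> (forall z, 0 <= f z) ->
  \int[nu]_z f z^* = \int[nu]_z f z.
Proof.
move=> mf f0; rewrite [RHS](complex_integral mf f0) complex_integral; last 2 first.
- exact: (measurableT_comp mf (measurable_fun_conjc _)).
- by [].
apply: eq_integral => x _.
have N10 : (-1 : R)%R != 0%R by rewrite oppr_eq0 oner_eq0.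
have mfx : measurable_fun setT (fun y : R => f (Complex x y)) by exact: mfC.
rewrite -[RHS](integral_dilate N10 mfx); last by [].
by rewrite normrN1 mul1e; apply: eq_integral => y _; rewrite mulN1r.
Qed.

Lemma complex_integral_translate c f :
  measurable_fun setT f -> (forall z, 0 <= f z) ->
  \int[nu]_z f (z + c)%R = \int[nu]_z f z.
Proof.
move=> mf f0; rewrite [RHS](complex_integral mf f0) complex_integral; last 2 first.
- exact: (measurableT_comp mf (measurable_fun_addc _ _)).
- by [].
rewrite -[RHS](@integral_translate _ (complex.Re c)
  (fun x => \int[mu]_y f (Complex x y))).
- apply: eq_integral => x _.
  have mfx : measurable_fun setT (fun y : R => f (Complex (x + complex.Re c)%R y)).
    exact: mfC.
  rewrite -[RHS](integral_translate (complex.Im c) mfx); last by [].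
  by apply: eq_integral => y _; case: c mfx.
- apply: (measurable_fun_integral mu (fun x y => f (Complex x y))) => //.
  exact: mfC.
- by move=> x; exact: integral_ge0.
Qed.

Section real_plane.
Variable F : R -> R -> \bar R.
Hypothesis mF : forall d (U : measurableType d) (a b : U -> R),
  measurable_fun setT a -> measurable_fun setT b ->
  measurable_fun setT (fun u => F (a u) (b u)).
Hypothesis F0 : forall x y, 0 <= F x y.

(** For frozen x, the inner integral is taken along a translate by b x of a dilate by a, so the
    one-dimensional formulas apply to it. *)
Lemma integral_plane_shear (a b : R) : a != 0%R ->
  (`|a|)%:E * \int[mu]_x \int[mu]_y F x (a * y + b * x)%R =
  \int[mu]_x \int[mu]_y F x y.
Proof.
move=> a0; rewrite -(@ge0_integralZlT _ (measurableTypeR R)); last 3 first.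
- apply: (measurable_fun_integral mu (fun x y => F x (a * y + b * x)%R)) => //.
  by apply: mF => //; apply: measurable_funD; exact: measurable_funM.
- by move=> x; exact: integral_ge0.
- by [].
- apply: eq_integral => x _.
  have m1 : measurable_fun setT (F x) by exact: mF.
  have m2 : measurable_fun setT (fun y : R => F x (y + b * x)%R).
    by apply: mF => //; exact: measurable_funD.
  rewrite -[RHS](integral_translate (b * x)%R m1)//.
  by rewrite -[RHS](integral_dilate a0 m2).
Qed.

Lemma integral_plane_swap :
  \int[mu]_x \int[mu]_y F y x = \int[mu]_x \int[mu]_y F x y.
Proof.
rewrite (exchange_integral mu mu (fun x y => F y x) _ (fun x y => F0 y x))//.
exact: mF.
Qed.

End real_plane.

(** Multiplication by X + i Y acts on the plane by the matrix with rows (X, -Y) and (Y, X), whose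
    determinant is the squared modulus. It is factored into shears and exchanges of the axes. *)
Lemma complex_integral_dilate c f : c != 0%R ->
  measurable_fun setT f -> (forall z, 0 <= f z) ->
  (complex.Re c ^+ 2 + complex.Im c ^+ 2)%:E * \int[nu]_z f (c * z)%R =
  \int[nu]_z f z.
Proof.
case: c => X Y c0 mf f0 /=.
rewrite [RHS](complex_integral mf f0) complex_integral; last 2 first.
- exact: (measurableT_comp mf (measurable_fun_mulc _ _)).
- by [].
have mD d (U : measurableType d) := @measurable_funD _ U R setT.
have mM d (U : measurableType d) := @measurable_funM _ U R setT.
have m1 d (U : measurableType d) := @mfC f mf d U.
have F01 x y : 0 <= f (Complex x y) by [].
pose J := \int[mu]_x \int[mu]_y
  f (Complex (X * x - Y * y) (X * y + Y * x))%R.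
rewrite [X in _ * X](_ : _ = J) /J {J}; last by [].
(* A zero X leaves no pivot: z |-> i Y z is then an exchange of the axes with dilations by Y and
   -Y. *)
have [X0|X0] := eqVneq X 0%R.
  have Y0 : Y != 0%R by apply: contraNN c0 => /eqP ->; rewrite X0; apply/eqP.
  have NY0 : (- Y != 0)%R by rewrite oppr_eq0.
  rewrite -(integral_plane_shear m1 F01 0%R Y0).
  pose G x y := f (Complex x (Y * y + 0 * x))%R.
  have mG d (U : measurableType d) (a b : U -> R) : measurable_fun setT a ->
      measurable_fun setT b -> measurable_fun setT (fun u => G (a u) (b u)).
    by move=> ma mb; apply: mfC => //; apply: mD => //; exact: mM.
  have G0 x y : 0 <= G x y by exact: f0.
  rewrite -[X in _ = _ * X](integral_plane_swap mG G0).
  have mG' d (U : measurableType d) (a b : U -> R) : measurable_fun setT a ->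
      measurable_fun setT b -> measurable_fun setT (fun u => G (b u) (a u)).
    by move=> ma mb; exact: mG.
  rewrite -[X in _ = _ * X](integral_plane_shear mG' (fun x y => G0 y x) 0%R NY0).
  rewrite muleA -EFinM normrN -normrM ger0_norm; last first.
    by rewrite -expr2 sqr_ge0.
  rewrite X0 expr0n/= add0r -expr2; apply: (congr1 (mule _)).
  apply: eq_integral => x _; apply: eq_integral => y _.
  by rewrite /G !mul0r !addr0 sub0r add0r mulNr.
have D0 : (X ^+ 2 + Y ^+ 2)%R != 0%R.
  by rewrite paddr_eq0 ?sqr_ge0// !sqrf_eq0 (negPf X0).
(* With u = X x - Y y, the second coordinate X y + Y x equals D y + (Y / X) u. The two shears have
   factors X and D, and X D = X ^ 2 + Y ^ 2. *)
pose D := (X + Y ^+ 2 / X)%R.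
have D0' : D != 0%R.
  rewrite (_ : D = (X ^+ 2 + Y ^+ 2) / X)%R; last by rewrite /D; field.
  by rewrite mulf_neq0// invr_eq0.
pose G x y := f (Complex x (D * y + Y / X * x))%R.
have mG d (U : measurableType d) (a b : U -> R) : measurable_fun setT a ->
    measurable_fun setT b -> measurable_fun setT (fun u => G (a u) (b u)).
  by move=> ma mb; apply: mfC => //; apply: mD => //; exact: mM.
have G0 x y : 0 <= G x y by exact: f0.
have mG' d (U : measurableType d) (a b : U -> R) : measurable_fun setT a ->
    measurable_fun setT b -> measurable_fun setT (fun u => G (b u) (a u)).
  by move=> ma mb; exact: mG.
pose K x y := G (X * x + - Y * y)%R y.
have mK d (U : measurableType d) (a b : U -> R) : measurable_fun setT a ->
    measurable_fun setT b -> measurable_fun setT (fun u => K (a u) (b u)).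
  move=> ma mb; rewrite /K.
  by apply: (mG _ _ (fun u => X * a u + - Y * b u)%R b) => //;
    apply: mD; exact: mM.
have K0 x y : 0 <= K x y by exact: f0.
rewrite -(integral_plane_shear m1 F01 (Y / X)%R D0').
rewrite -[X in _ = _ * X](integral_plane_swap mG G0).
rewrite -[X in _ = _ * X](integral_plane_shear mG' (fun x y => G0 y x) (- Y)%R X0).
rewrite [X in _ = _ * (_ * X)](integral_plane_swap mK K0).
rewrite muleA -EFinM -normrM (_ : D * X = X ^+ 2 + Y ^+ 2)%R; last first.
  by rewrite /D; field.
rewrite ger0_norm; last by rewrite addr_ge0 ?sqr_ge0.
apply: (congr1 (mule _)).
apply: eq_integral => x _; apply: eq_integral => y _; rewrite /K /G.
by congr (f (Complex _ _)); rewrite /D; field.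
Qed.

End complex_lebesgue_integral.

(** * Measurability of matrix operations *)

Lemma measurable_fun_app d1 d2 d3 (T1 : measurableType d1)
    (T2 : measurableType d2) (T3 : measurableType d3) (f : T2 -> T3)
    (g : T1 -> T2) :
  measurable_fun setT f -> measurable_fun setT g ->
  measurable_fun setT (fun u => f (g u)).
Proof. exact: measurableT_comp. Qed.

Lemma measurable_fun_pair_fst d1 d2 d3 (T1 : measurableType d1)
    (T2 : measurableType d2) (T3 : measurableType d3) (f : T1 -> T2 * T3) :
  measurable_fun setT f -> measurable_fun setT (fun u => (f u).1).
Proof. exact: measurableT_comp. Qed.

Lemma measurable_fun_pair_snd d1 d2 d3 (T1 : measurableType d1)
    (T2 : measurableType d2) (T3 : measurableType d3) (f : T1 -> T2 * T3) :
  measurable_fun setT f -> measurable_fun setT (fun u => (f u).2).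
Proof. exact: measurableT_comp. Qed.

Section mx_measurable_fun.
Context d (U : measurableType d) (R : realType).

Lemma measurable_fun_csum I (s : seq I) (P : pred I) (F : I -> U -> R[i]) :
  (forall i, measurable_fun setT (F i)) ->
  measurable_fun setT (fun u => \sum_(i <- s | P i) F i u).
Proof.
move=> mF; elim: s => [|i s IHs].
  rewrite (_ : (fun u => _) = cst 0); first exact: measurable_cst.
  by apply/funext => u; rewrite big_nil.
rewrite (_ : (fun u => _) = (fun u => (if P i then F i u else 0) +
    \sum_(i <- s | P i) F i u)).
  by apply: measurable_fun_addc => //; case: (P i) => //; exact: measurable_cst.
by apply/funext => u; rewrite big_cons; case: (P i); rewrite ?add0r.
Qed.

Lemma measurable_fun_cprod I (s : seq I) (P : pred I) (F : I -> U -> R[i]) :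
  (forall i, measurable_fun setT (F i)) ->
  measurable_fun setT (fun u => \prod_(i <- s | P i) F i u).
Proof.
move=> mF; elim: s => [|i s IHs].
  rewrite (_ : (fun u => _) = cst 1); first exact: measurable_cst.
  by apply/funext => u; rewrite big_nil.
rewrite (_ : (fun u => _) = (fun u => (if P i then F i u else 1) *
    \prod_(i <- s | P i) F i u)).
  by apply: measurable_fun_mulc => //; case: (P i) => //; exact: measurable_cst.
by apply/funext => u; rewrite big_cons; case: (P i); rewrite ?mul1r.
Qed.

Lemma measurable_fun_mulmx m n p (f : U -> 'M[R[i]]_(m, n))
    (g : U -> 'M[R[i]]_(n, p)) :
  measurable_fun setT f -> measurable_fun setT g ->
  measurable_fun setT (fun u => f u *m g u).
Proof.
move=> mf mg; apply/measurable_fun_mxP => i j.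
rewrite (_ : (fun u => _) = (fun u => \sum_k f u i k * g u k j)).
  apply: measurable_fun_csum => k.
  by apply: measurable_fun_mulc; exact: measurable_fun_mx_entry.
by apply/funext => u; rewrite mxE.
Qed.

Lemma measurable_fun_addmx m n (f g : U -> 'M[R[i]]_(m, n)) :
  measurable_fun setT f -> measurable_fun setT g ->
  measurable_fun setT (fun u => f u + g u).
Proof.
move=> mf mg; apply/measurable_fun_mxP => i j.
rewrite (_ : (fun u => _) = (fun u => f u i j + g u i j)).
  by apply: measurable_fun_addc; exact: measurable_fun_mx_entry.
by apply/funext => u; rewrite mxE.
Qed.

Lemma measurable_fun_oppmx m n (f : U -> 'M[R[i]]_(m, n)) :
  measurable_fun setT f -> measurable_fun setT (fun u => - f u).
Proof.
move=> mf; apply/measurable_fun_mxP => i j.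
rewrite (_ : (fun u => _) = (fun u => - f u i j)).
  by apply: measurable_fun_oppc; exact: measurable_fun_mx_entry.
by apply/funext => u; rewrite mxE.
Qed.

Lemma measurable_fun_scalemx m n (a : U -> R[i]) (f : U -> 'M[R[i]]_(m, n)) :
  measurable_fun setT a -> measurable_fun setT f ->
  measurable_fun setT (fun u => a u *: f u).
Proof.
move=> ma mf; apply/measurable_fun_mxP => i j.
rewrite (_ : (fun u => _) = (fun u => a u * f u i j)).
  by apply: measurable_fun_mulc => //; exact: measurable_fun_mx_entry.
by apply/funext => u; rewrite mxE.
Qed.

Lemma measurable_fun_scalar_mx m (a : U -> R[i]) :
  measurable_fun setT a -> measurable_fun setT (fun u => (a u)%:M : 'M[R[i]]_m).
Proof.
move=> ma; rewrite (_ : (fun u => _) = (fun u => a u *: (1%:M : 'M[R[i]]_m))).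
  by apply: measurable_fun_scalemx => //; exact: measurable_cst.
by apply/funext => u; rewrite scalemx1.
Qed.

Lemma measurable_fun_adjmx m n (f : U -> 'M[R[i]]_(m, n)) :
  measurable_fun setT f -> measurable_fun setT (fun u => (f u)^t*).
Proof.
move=> mf; apply/measurable_fun_mxP => i j.
rewrite (_ : (fun u => _) = (fun u => (f u j i)^*)).
  by apply: measurable_fun_conjc; exact: measurable_fun_mx_entry.
by apply/funext => u; rewrite !mxE.
Qed.

Lemma measurable_fun_ursubmx m1 m2 n1 n2 (f : U -> 'M[R[i]]_(m1 + m2, n1 + n2)) :
  measurable_fun setT f -> measurable_fun setT (fun u => ursubmx (f u)).
Proof.
move=> mf; apply/measurable_fun_mxP => i j.
rewrite (_ : (fun u => _) = (fun u => f u (lshift _ i) (rshift _ j))).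
  exact: measurable_fun_mx_entry.
by apply/funext => u; rewrite !mxE.
Qed.

Lemma measurable_fun_dlsubmx m1 m2 n1 n2 (f : U -> 'M[R[i]]_(m1 + m2, n1 + n2)) :
  measurable_fun setT f -> measurable_fun setT (fun u => dlsubmx (f u)).
Proof.
move=> mf; apply/measurable_fun_mxP => i j.
rewrite (_ : (fun u => _) = (fun u => f u (rshift _ i) (lshift _ j))).
  exact: measurable_fun_mx_entry.
by apply/funext => u; rewrite !mxE.
Qed.

Lemma measurable_fun_drsubmx m1 m2 n1 n2 (f : U -> 'M[R[i]]_(m1 + m2, n1 + n2)) :
  measurable_fun setT f -> measurable_fun setT (fun u => drsubmx (f u)).
Proof.
move=> mf; apply/measurable_fun_mxP => i j.
rewrite (_ : (fun u => _) = (fun u => f u (rshift _ i) (rshift _ j))).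
  exact: measurable_fun_mx_entry.
by apply/funext => u; rewrite !mxE.
Qed.

Lemma measurable_fun_det m (f : U -> 'M[R[i]]_m) :
  measurable_fun setT f -> measurable_fun setT (fun u => \det (f u)).
Proof.
move=> mf; apply: measurable_fun_csum => s; apply: measurable_fun_mulc.
  exact: measurable_cst.
by apply: measurable_fun_cprod => i; exact: measurable_fun_mx_entry.
Qed.

Lemma measurable_fun_eq0c (f : U -> R[i]) :
  measurable_fun setT f -> measurable_fun setT (fun u => f u == 0).
Proof.
move=> /measurable_complexP[m1 m2].
rewrite (_ : (fun u => _) =
    (fun u => (complex.Re (f u) == 0) && (complex.Im (f u) == 0))).
  by apply: measurable_and; apply: measurable_fun_eqr => //; exact: measurable_cst.
by apply/funext => u; rewrite eq_complex.
Qed.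

(** [invmx] is the adjugate divided by the determinant where the latter is nonzero, and returns its
    argument elsewhere; the two branches are separated by a measurable test. *)
Lemma measurable_fun_invmx m (f : U -> 'M[R[i]]_m) :
  measurable_fun setT f -> measurable_fun setT (fun u => invmx (f u)).
Proof.
move=> mf; rewrite (_ : (fun u => _) = (fun u =>
    if \det (f u) == 0 then f u else (\det (f u))^-1 *: \adj (f u))); last first.
  by apply/funext => u; rewrite /invmx unitmxE unitfE; case: eqP.
apply: measurable_fun_ifT => //.
  by apply: measurable_fun_eq0c; exact: measurable_fun_det.
apply: measurable_fun_scalemx.
  by apply: measurable_fun_invc; exact: measurable_fun_det.
apply/measurable_fun_mxP => i j.
rewrite (_ : (fun u => _) = (fun u => (-1) ^+ (j + i) *
    \det (row' j (col' i (f u))))); last by apply/funext => u; rewrite mxE.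
apply: measurable_fun_mulc; first exact: measurable_cst.
apply: measurable_fun_det; apply/measurable_fun_mxP => k l.
rewrite (_ : (fun u => _) = (fun u => f u (lift j k) (lift i l))).
  exact: measurable_fun_mx_entry.
by apply/funext => u; rewrite !mxE.
Qed.

End mx_measurable_fun.

Ltac nonneg := cbv beta; intros;
  lazymatch goal with
  | |- is_true (_ <= integral _ _ _)%E => apply: integral_ge0; nonneg
  | H : forall A, is_true (_ <= ?f A)%E |- is_true (_ <= ?f _)%E => apply: H
  | |- _ => by []
  end.

(* [mxmeas] proves measurability by following the structure of the function;
   [mxmeas_extra] is a hook redefined whenever a new operation appears. *)
Ltac mxmeas_extra := fail.

Ltac mxmeas_step :=
  lazymatch goal with
  | |- measurable_fun _ (fun u => u) => apply: measurable_id
  | |- measurable_fun _ (fun _ => ?c) => apply: measurable_cst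
  | |- measurable_fun _ (fun u => @mulmx _ _ _ _ _ _) =>
    apply: measurable_fun_mulmx
  | |- measurable_fun _ (fun u => @block_mx _ _ _ _ _ _ _ _ _) =>
    apply: measurable_fun_block_mx
  | |- measurable_fun _ (fun u => @col_mx _ _ _ _ _ _) =>
    apply: measurable_fun_col_mx
  | |- measurable_fun _ (fun u => @row_mx _ _ _ _ _ _) =>
    apply: measurable_fun_row_mx
  | |- measurable_fun _ (fun u => @ursubmx _ _ _ _ _ _) =>
    apply: measurable_fun_ursubmx
  | |- measurable_fun _ (fun u => @dlsubmx _ _ _ _ _ _) =>
    apply: measurable_fun_dlsubmx
  | |- measurable_fun _ (fun u => @drsubmx _ _ _ _ _ _) =>
    apply: measurable_fun_drsubmx
  | |- measurable_fun _ (fun u => @scalar_mx _ _ _) =>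
    apply: measurable_fun_scalar_mx
  | |- measurable_fun _ (fun u => @invmx _ _ _) => apply: measurable_fun_invmx
  | |- measurable_fun _ (fun u => @determinant _ _ _) =>
    apply: measurable_fun_det
  | |- measurable_fun _ (fun u => @map_mx _ _ _ _ _ (@trmx _ _ _ _)) =>
    apply: measurable_fun_adjmx
  | |- measurable_fun _ (fun u => @trmx _ _ _ _) => apply: measurable_fun_trmx
  | |- measurable_fun _ (fun u => @fun_of_matrix _ _ _ _ _ _) =>
    apply: measurable_fun_mx_entry
  | |- measurable_fun _ (fun u => complex.Re _) => apply: measurable_fun_Re
  | |- measurable_fun _ (fun u => complex.Im _) => apply: measurable_fun_Im
  | |- measurable_fun _ (fun u => Complex _ _) => apply: measurable_fun_Complex
  | |- measurable_fun _ (fun u => (_ + _)%R) =>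
    first [apply: measurable_fun_addmx | apply: measurable_fun_addc
          | apply: measurable_funD]
  | |- measurable_fun _ (fun u => (- _)%R) =>
    first [apply: measurable_fun_oppmx | apply: measurable_fun_oppc
          | apply: measurable_funN]
  | |- measurable_fun _ (fun u => (_ *: _)%R) =>
    apply: measurable_fun_scalemx
  | |- measurable_fun _ (fun u => (_ * _)%R) =>
    first [apply: measurable_fun_mulc | apply: measurable_funM]
  | |- measurable_fun _ (fun u => (_^-1)%R) =>
    first [apply: measurable_fun_invc | apply: measurable_fun_invr]
  | |- measurable_fun _ (fun u => (_ ^*)%R) => apply: measurable_fun_conjc
  | |- measurable_fun _ (fun u => (_ ^+ _)%R) => apply: measurable_funX
  | |- measurable_fun _ (fun u => fst _) => apply: measurable_fun_pair_fst
  | |- measurable_fun _ (fun u => snd _) => apply: measurable_fun_pair_snd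
  | |- measurable_fun _ (fun u => integral _ _ _) =>
    apply: measurable_fun_integral; [cbv beta | nonneg]
  | H : measurable_fun _ ?f |- measurable_fun _ (fun u => ?f _) =>
    apply: (measurable_fun_app H)
  | |- measurable_fun _ (fun u => real_complex_def _ _) =>
    apply: measurable_fun_real_complex
  | |- measurable_fun _ (fun _ => _) => first [mxmeas_extra | assumption]
  | |- @measurable_fun ?d1 ?d2 ?T1 ?T2 ?D ?f =>
    first [assumption | change (@measurable_fun d1 d2 T1 T2 D (fun u => f u))]
  end.

Ltac mxmeas := cbv beta; repeat mxmeas_step.

(** This is the Jacobian of z |-> c z for the plane measure, kept in [R] so that Jacobians are real
    weights. *)
Definition sqnormc (R : realType) (c : R[i]) : R :=
  complex.Re c ^+ 2 + complex.Im c ^+ 2.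

Section sqnormc.
Context {R : realType}.
Implicit Types c e : R[i].

Lemma sqnormcE c : (sqnormc c)%:C%C = c * c^*.
Proof.
case: c => a b; rewrite conjCE /sqnormc; simpc.
by rewrite -!expr2; congr (Complex _ _); ring.
Qed.

Lemma sqnormcM c e : sqnormc (c * e) = sqnormc c * sqnormc e.
Proof. by case: c => a b; case: e => x y; rewrite /sqnormc/=; ring. Qed.

Lemma sqnormc1 : sqnormc (1 : R[i]) = 1.
Proof. by rewrite /sqnormc/= expr1n expr0n addr0. Qed.

Lemma sqnormc_ge0 c : 0 <= sqnormc c.
Proof. by rewrite addr_ge0 ?sqr_ge0. Qed.

Lemma sqnormc_eq0 c : (sqnormc c == 0) = (c == 0).
Proof. by rewrite paddr_eq0 ?sqr_ge0// !sqrf_eq0 eq_complex. Qed.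

Lemma sqnormc_gt0 c : c != 0 -> 0 < sqnormc c.
Proof. by move=> c0; rewrite lt_neqAle sqnormc_ge0 andbT eq_sym sqnormc_eq0. Qed.

Lemma sqnormc_conj c : sqnormc c^* = sqnormc c.
Proof. by case: c => a b; rewrite conjCE /sqnormc/= sqrrN. Qed.

Lemma sqnormc_real (a : R) : sqnormc a%:C%C = a ^+ 2.
Proof. by rewrite /sqnormc/= expr0n addr0. Qed.

Lemma sqnormc_sign n : sqnormc ((-1) ^+ n : R[i]) = 1.
Proof.
have N1 : sqnormc (-1 : R[i]) = 1.
  by rewrite /sqnormc/= oppr0 sqrrN expr1n expr0n addr0.
elim: n => [|n IHn]; first by rewrite expr0 sqnormc1.
by rewrite exprS sqnormcM IHn mulr1.
Qed.

End sqnormc.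

(** * Jacobians of linear changes of variables *)

Section mx_linear_change.
Context {R : realType}.
Local Open Scope ereal_scope.
Local Notation L m n := (mx_measure m n (@complex_lebesgue R)).

(** Testing on indicators turns an integral identity into the measure identity that
    [mx_integral_entrywise] asks of each entry. *)
Lemma measure_preimage_of_integral d (T : measurableType d)
    (mu : {measure set T -> \bar R}) (phi : T -> T) (k : R) :
  measurable_fun setT phi ->
  (forall f : T -> \bar R, measurable_fun setT f -> (forall x, 0 <= f x) ->
     k%:E * \int[mu]_x f (phi x) = \int[mu]_x f x) ->
  forall A, measurable A -> k%:E * mu (phi @^-1` A) = mu A.
Proof.
move=> mphi muE A mA.
have mphiA : measurable (phi @^-1` A).
  by rewrite -[X in measurable X]setTI; exact: mphi.
have muB B : measurable B -> \int[mu]_x (\1_B x)%:E = mu B.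
  by move=> mB; rewrite integral_indic// setIT.
rewrite -!muB// -[RHS]muE//.
exact/measurable_EFinP/measurable_indic.
Qed.

Lemma mx_integral_translate m n (B : 'M[R[i]]_(m, n))
    (f : 'M[R[i]]_(m, n) -> \bar R) :
  measurable_fun setT f -> (forall A, 0 <= f A) ->
  \int[L m n]_A f (A + B)%R = \int[L m n]_A f A.
Proof.
move=> mf f0.
rewrite -[RHS](@mx_integral_entrywise _ _ _ _ m n
  (fun i j (z : R[i]) => z + B i j)%R 1)//.
- rewrite expr1n mul1e; apply: eq_integral => A _; congr f.
  by apply/matrixP => i j; rewrite !mxE.
- by move=> i j; mxmeas.
- move=> i j; apply: measure_preimage_of_integral; first by mxmeas.
  by move=> g mg g0; rewrite mul1e complex_integral_translate.
Qed.

Lemma mx_integral_adj m n (f : 'M[R[i]]_(m, n) -> \bar R) :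
  measurable_fun setT f -> (forall A, 0 <= f A) ->
  \int[L m n]_A f A = \int[L n m]_A f ((A : 'M[R[i]]_(n, m))^t*).
Proof.
move=> mf f0.
rewrite -[LHS](@mx_integral_entrywise _ _ _ _ m n (fun i j (z : R[i]) => z^*)%R 1)//.
- rewrite expr1n mul1e mx_integral_tr//.
    by apply: eq_integral => A _; congr f; apply/matrixP => i j; rewrite !mxE.
  rewrite (_ : (fun A => _) = (fun A : 'M[R[i]]_(m, n) => f (A^T^t*))).
    by mxmeas.
  by apply/funext => A; congr f; apply/matrixP => i j; rewrite !mxE.
- by move=> i j; mxmeas.
- move=> i j; apply: measure_preimage_of_integral; first by mxmeas.
  by move=> g mg g0; rewrite mul1e complex_integral_conj.
Qed.

Lemma mx_integral_dilate m n (c : R[i]) (f : 'M[R[i]]_(m, n) -> \bar R) :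
  c != 0%R -> measurable_fun setT f -> (forall A, 0 <= f A) ->
  (sqnormc c ^+ (m * n))%:E * \int[L m n]_A f (c *: A)%R = \int[L m n]_A f A.
Proof.
move=> c0 mf f0.
rewrite -[RHS](@mx_integral_entrywise _ _ _ _ m n (fun i j (z : R[i]) => c * z)%R
  (sqnormc c))//.
- congr (_ * _); apply: eq_integral => A _; congr f.
  by apply/matrixP => i j; rewrite !mxE.
- exact: sqnormc_ge0.
- by move=> i j; mxmeas.
- move=> i j; apply: measure_preimage_of_integral; first by mxmeas.
  by move=> g mg g0; exact: complex_integral_dilate.
Qed.

(** T acts on each of the n columns separately, hence the exponent n. Quantifying over n and over
    the test function makes the property stable under products of matrices. *)
Definition lmul_jacobian m (T : 'M[R[i]]_m) :=
  forall n (f : 'M[R[i]]_(m, n) -> \bar R),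
    measurable_fun setT f -> (forall A, 0 <= f A) ->
    (sqnormc (\det T) ^+ n)%:E * \int[L m n]_A f (T *m A) = \int[L m n]_A f A.

Lemma lmul_jacobianM m (T1 T2 : 'M[R[i]]_m) :
  lmul_jacobian T1 -> lmul_jacobian T2 -> lmul_jacobian (T1 *m T2).
Proof.
move=> J1 J2 n f mf f0; rewrite -(J1 n f)// -(J2 n (fun A => f (T1 *m A)))//.
  rewrite det_mulmx sqnormcM exprMn EFinM muleA; congr (_ * _).
  by apply: eq_integral => A _; rewrite mulmxA.
by mxmeas.
Qed.

Lemma lmul_jacobian_perm m (s : 'S_m) : lmul_jacobian (perm_mx s).
Proof.
move=> n f mf f0; rewrite det_perm sqnormc_sign expr1n mul1e.
rewrite -[RHS](mx_integral_row_perm _ s)//.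
by apply: eq_integral => A _; rewrite row_permE.
Qed.

Lemma lmul_jacobian_lower k l (v : 'M[R[i]]_(l, k)) :
  lmul_jacobian (block_mx 1%:M 0 v 1%:M).
Proof.
move=> n f mf f0; rewrite det_lblock !det1 mulr1 sqnormc1 expr1n mul1e.
rewrite [LHS]mx_integral_col_mx//; last by mxmeas.
rewrite [RHS](mx_integral_col_mx _ mf f0).
apply: eq_integral => A _.
rewrite -[RHS](mx_integral_translate (v *m A))//; last by mxmeas.
by apply: eq_integral => B _; rewrite mul_block_col !mul1mx mul0mx addr0 addrC.
Qed.

(** The shear moves the upper block by a function of the lower one, so the lower block is first made
    the outer variable. *)
Lemma lmul_jacobian_upper k l (w : 'M[R[i]]_(k, l)) :
  lmul_jacobian (block_mx 1%:M w 0 1%:M).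
Proof.
move=> n f mf f0; rewrite det_ublock !det1 mulr1 sqnormc1 expr1n mul1e.
rewrite [LHS]mx_integral_col_mx//; last by mxmeas.
rewrite [RHS](mx_integral_col_mx _ mf f0).
rewrite [LHS](exchange_integral (L k n) (L l n)
  (fun A B => f (block_mx 1%:M w 0 1%:M *m col_mx A B)))//; last by mxmeas.
rewrite [RHS](exchange_integral (L k n) (L l n) (fun A B => f (col_mx A B))
  _ (fun _ _ => f0 _)); last by mxmeas.
apply: eq_integral => B _.
rewrite -[RHS](mx_integral_translate (w *m B))//; last by mxmeas.
by apply: eq_integral => A _; rewrite mul_block_col !mul1mx mul0mx add0r.
Qed.

Lemma lmul_jacobian_diag k (c : R[i]) (T : 'M[R[i]]_k) : c != 0%R ->
  lmul_jacobian T -> lmul_jacobian (block_mx (c%:M : 'M[R[i]]_1) 0 0 T).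
Proof.
move=> c0 JT n f mf f0; rewrite det_ublock det_scalar1 sqnormcM exprMn EFinM.
rewrite [in LHS]mx_integral_col_mx//; last by mxmeas.
rewrite [RHS](mx_integral_col_mx _ mf f0).
have mfc : measurable_fun setT (fun A => \int[L k n]_B f (col_mx A B)).
  apply: (measurable_fun_integral _ (fun A B => f (col_mx A B))) => //.
  by mxmeas.
rewrite -[RHS](mx_integral_dilate c0 mfc); last first.
  by move=> A; exact: integral_ge0.
rewrite mul1n -muleA; congr (_ * _); rewrite -ge0_integralZl//; last 3 first.
- apply: (measurable_fun_integral _
    (fun A B => f (block_mx c%:M 0 0 T *m col_mx A B))) => //.
  by mxmeas.
- by move=> A _; exact: integral_ge0.
- by rewrite lee_fin exprn_ge0// sqnormc_ge0.
apply: eq_integral => A _.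
rewrite -[RHS](JT n (fun B => f (col_mx (c *: A) B)))//; last by mxmeas.
congr (_ * _); apply: eq_integral => B _.
by rewrite mul_block_col !mul0mx addr0 add0r mul_scalar_mx.
Qed.

(** Induction on the size by Gaussian elimination: a nonzero pivot splits T into a lower shear, a
    block diagonal matrix and an upper shear, and a row exchange brings a pivot to the corner. *)
Lemma lmul_jacobian_unit m (T : 'M[R[i]]_m) : T \in unitmx -> lmul_jacobian T.
Proof.
elim: m T => [T _ n f mf f0|m IHm].
  by rewrite det_mx00 sqnormc1 expr1n mul1e; apply: eq_integral => A _;
    congr f; apply/matrixP => -[].
have pivot (T : 'M[R[i]]_(1 + m)) : T \in unitmx -> T 0%R 0%R != 0%R ->
    lmul_jacobian T.
  move=> Tu a0; pose a := T 0%R 0%R.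
  have ulE : ulsubmx T = a%:M.
    by apply/matrixP => i j; rewrite !mxE !ord1 eqxx mulr1n; congr (T _ _);
      apply/val_inj.
  pose v : 'M[R[i]]_(m, 1) := a^-1 *: dlsubmx T.
  pose w : 'M[R[i]]_(1, m) := a^-1 *: ursubmx T.
  pose T' := (drsubmx T - v *m ursubmx T)%R.
  have TE : T = block_mx 1%:M 0 v 1%:M *m
      (block_mx a%:M 0 0 T' *m block_mx 1%:M w 0 1%:M).
    rewrite !mulmx_block !mulmx0 !mul0mx !mulmx1 !mul1mx !addr0 !add0r.
    rewrite mul_scalar_mx mul_mx_scalar scalerA mulfV// scale1r.
    rewrite /T' /w scalerA mulfV// scale1r -ulE addrC subrK.
    by rewrite -[LHS]submxK.
  have T'u : T' \in unitmx.
    move: Tu; rewrite TE !unitmx_mul => /andP[_ /andP[+ _]].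
    by rewrite !unitmxE det_ublock unitrM => /andP[].
  rewrite TE; apply: lmul_jacobianM; first exact: lmul_jacobian_lower.
  apply: lmul_jacobianM; last exact: lmul_jacobian_upper.
  by apply: lmul_jacobian_diag => //; exact: IHm.
move=> T Tu.
have [i Ti0] : exists i, T i 0%R != 0%R.
  apply/existsP; rewrite -negb_forall; apply: contraTN Tu => /forallP T0.
  rewrite unitmxE (expand_det_col _ 0%R) big1 ?unitr0// => i _.
  by rewrite (eqP (T0 i)) mul0r.
rewrite (_ : T = perm_mx (tperm 0%R i) *m xrow 0%R i T); last first.
  by rewrite xrowE mulmxA -perm_mxM tperm2 perm_mx1 mul1mx.
apply: lmul_jacobianM; first exact: lmul_jacobian_perm.
apply: pivot; last by rewrite mxE tpermL.
by rewrite xrowE unitmx_mul unitmx_perm.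
Qed.

Lemma mx_integral_lmul m n (T : 'M[R[i]]_m) (f : 'M[R[i]]_(m, n) -> \bar R) :
  T \in unitmx -> measurable_fun setT f -> (forall A, 0 <= f A) ->
  (sqnormc (\det T) ^+ n)%:E * \int[L m n]_A f (T *m A) = \int[L m n]_A f A.
Proof. by move=> Tu mf f0; exact: lmul_jacobian_unit. Qed.

Lemma mx_integral_rmul m n (T : 'M[R[i]]_n) (f : 'M[R[i]]_(m, n) -> \bar R) :
  T \in unitmx -> measurable_fun setT f -> (forall A, 0 <= f A) ->
  (sqnormc (\det T) ^+ m)%:E * \int[L m n]_A f (A *m T) = \int[L m n]_A f A.
Proof.
move=> Tu mf f0.
have Ttu : T^T \in unitmx by rewrite unitmx_tr.
have mfT : measurable_fun setT (fun A : 'M[R[i]]_(m, n) => f (A *m T)).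
  by mxmeas.
have mft : measurable_fun setT (fun A : 'M[R[i]]_(n, m) => f A^T) by mxmeas.
rewrite [in LHS](mx_integral_tr _ mfT)// [RHS](mx_integral_tr _ mf f0).
rewrite -[RHS](mx_integral_lmul Ttu mft)// det_tr; congr (_ * _).
by apply: eq_integral => A _; rewrite trmx_mul trmxK.
Qed.

End mx_linear_change.

(** * Integration over Hermitian matrices *)

Section mx_integral_map2.
Context d (T : measurableType d) d' (U : measurableType d') (R : realType).
Variables (mu : {sigma_finite_measure set T -> \bar R})
  (nu : {sigma_finite_measure set U -> \bar R}) (op : T -> T -> U).
Local Open Scope ereal_scope.
Hypothesis mop : measurable_fun setT (fun z : T * T => op z.1 z.2).
Hypothesis opE : forall f : U -> \bar R,
  measurable_fun setT f -> (forall u, 0 <= f u) ->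
  \int[nu]_u f u = \int[mu]_x \int[mu]_y f (op x y).

Lemma measurable_fun_const_mx d1 (V : measurableType d1) d2
    (W : measurableType d2) m n (f : V -> W) :
  measurable_fun setT f ->
  measurable_fun setT (fun u => const_mx (f u) : 'M[W]_(m, n)).
Proof.
move=> mf; apply/measurable_fun_mxP => i j.
by rewrite (_ : (fun u => _) = f) //; apply/funext => u; rewrite mxE.
Qed.

Lemma measurable_fun_map2_mx d1 (V : measurableType d1) m n
    (f g : V -> 'M[T]_(m, n)) :
  measurable_fun setT f -> measurable_fun setT g ->
  measurable_fun setT (fun u => map2_mx op (f u) (g u)).
Proof.
move=> mf mg; apply/measurable_fun_mxP => i j.
rewrite (_ : (fun u => _) = (fun u => op (f u i j) (g u i j))).
  apply: (measurable_fun_app mop (g := fun u => (f u i j, g u i j))).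
  by apply: measurable_fun_pair; exact: measurable_fun_mx_entry.
by apply/funext => u; rewrite mxE.
Qed.

Let measurable_fun_op d1 (V : measurableType d1) (f g : V -> T) :
  measurable_fun setT f -> measurable_fun setT g ->
  measurable_fun setT (fun u => op (f u) (g u)).
Proof.
move=> mf mg; apply: (measurable_fun_app mop (g := fun u => (f u, g u))).
exact: measurable_fun_pair.
Qed.

Ltac mxmeas_extra ::= first
  [ apply: measurable_fun_map2_mx
  | apply: measurable_fun_const_mx
  | apply: measurable_fun_op ].

(** Meant for [op] pairing real and imaginary parts: two real rows merge into one complex row. The
    induction splits off the first entry of each row, and Tonelli brings these two entries
    together. *)
Lemma mx_integral_map2_row n (f : 'rV[U]_n -> \bar R) :
  measurable_fun setT f -> (forall A, 0 <= f A) ->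
  \int[mx_measure 1 n mu]_X \int[mx_measure 1 n mu]_Y f (map2_mx op X Y) =
  \int[mx_measure 1 n nu]_Z f Z.
Proof.
elim: n f => [f mf f0|n IHn]; last rewrite -[n.+1]add1n => f mf f0.
  pose X0 : 'M[T]_(1, 0) := const_mx point.
  rewrite [RHS](mx_integral_col0 _ (map2_mx op X0 X0) mf f0).
  rewrite [LHS](mx_integral_col0 _ X0); [|by mxmeas|by nonneg].
  by rewrite [LHS](mx_integral_col0 _ X0); [|by mxmeas|by nonneg].
transitivity (\int[mu]_x \int[mu]_y \int[mx_measure 1 n mu]_X
    \int[mx_measure 1 n mu]_Y f (row_mx (const_mx (op x y)) (map2_mx op X Y))).
  rewrite [LHS]mx_integral_row_mx; [|by mxmeas|by nonneg].
  rewrite [LHS]mx_integral_scalar; [|by mxmeas|by nonneg].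
  apply: eq_integral => x _.
  rewrite [RHS](exchange_integral mu (mx_measure 1 n mu) (fun y X =>
    \int[mx_measure 1 n mu]_Y f (row_mx (const_mx (op x y)) (map2_mx op X Y))));
    [|by mxmeas|by nonneg].
  apply: eq_integral => X _.
  rewrite [LHS]mx_integral_row_mx; [|by mxmeas|by nonneg].
  rewrite [LHS]mx_integral_scalar; [|by mxmeas|by nonneg].
  apply: eq_integral => y _; apply: eq_integral => Y _; congr f.
  apply/matrixP => i j; rewrite !mxE.
  by case: fintype.splitP => k _; rewrite !mxE.
have m1 : measurable_fun setT (fun Z : 'M[U]_(1, 1) =>
    \int[mx_measure 1 n nu]_B f (row_mx Z B)).
  by mxmeas.
rewrite [RHS](@mx_integral_row_mx _ _ _ _ 1 1 n _ mf f0).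
rewrite [RHS](mx_integral_scalar _ m1); last by nonneg.
rewrite [RHS]opE; [|by mxmeas|by nonneg].
apply: eq_integral => x _; apply: eq_integral => y _.
by rewrite -[RHS]IHn; [|by mxmeas|by nonneg].
Qed.

(** The column enters as a transposed row, so that it can be paired entry by entry with r. *)
Lemma mx_integral_corner q (f : 'M[T]_(1 + q) -> \bar R) :
  measurable_fun setT f -> (forall A, 0 <= f A) ->
  \int[mx_measure (1 + q) (1 + q) mu]_A f A =
  \int[mu]_a \int[mx_measure 1 q mu]_r \int[mx_measure 1 q mu]_c
    \int[mx_measure q q mu]_E f (block_mx (const_mx a) r c^T E).
Proof.
move=> mf f0.
rewrite [LHS](mx_integral_col_mx _ mf f0).
rewrite [LHS]mx_integral_row_mx; [|by mxmeas|by nonneg].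
rewrite [LHS]mx_integral_scalar; [|by mxmeas|by nonneg].
apply: eq_integral => a _; apply: eq_integral => r _.
rewrite [LHS]mx_integral_row_mx; [|by mxmeas|by nonneg].
by rewrite [LHS]mx_integral_tr; [|by mxmeas|by nonneg].
Qed.

End mx_integral_map2.

Lemma hermsymmxP (R : realType) p (A : 'M[R[i]]_p) :
  reflect (A^t* = A) (A \is hermsymmx).
Proof.
apply: (iffP (is_hermitianmxP _ _ _)); rewrite expr0 scale1r; exact: esym.
Qed.

Section hermitian_lebesgue_integral.
Context {R : realType}.
Local Notation mu := (@lebesgue_measure R).
Local Notation L m n := (mx_measure m n (@complex_lebesgue R)).
Local Notation LR m n := (mx_measure m n (@lebesgue_measure R)).
Local Notation H p := (@hermitian_lebesgue R p).
Local Open Scope ereal_scope.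

Lemma measurable_fun_hermitian_of_coords d (U : measurableType d) p
    (f : U -> 'M[R]_p) :
  measurable_fun setT f ->
  measurable_fun setT (fun u => hermitian_of_coords (f u)).
Proof. exact: measurableT_comp measurable_hermitian_of_coords. Qed.

Lemma hermitian_integral p (f : 'M[R[i]]_p -> \bar R) :
  measurable_fun setT f -> (forall A, 0 <= f A) ->
  \int[H p]_V f V = \int[LR p p]_A f (hermitian_of_coords A).
Proof.
move=> mf f0; apply: ge0_integral_image => //.
exact: measurable_hermitian_of_coords.
Qed.

Lemma hermitian_coordsK p (V : 'M[R[i]]_p) : V^t* = V ->
  hermitian_of_coords (hermitian_coords V) = V.
Proof.
move=> Vh; have VhE i j : V i j = (V j i)^* by rewrite -[in LHS]Vh !mxE.
apply/matrixP => i j; rewrite !mxE.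
have [<-|ij] := eqVneq i j.
  rewrite leqnn; have := VhE i i; rewrite conjCE; case: (V i i) => a b [].
  move=> /eqP; rewrite -subr_eq0 opprK -mulr2n mulrn_eq0/= => /eqP ->.
  by [].
have ijN : (i : nat) != j by [].
case: ltngtP => // ij'.
  by case: (V i j).
  by rewrite (VhE i j) conjCE; case: (V j i).
by rewrite ij' eqxx in ijN.
Qed.

(** The coordinates are additive, so translating by a Hermitian matrix translates each real
    coordinate by a constant. *)
Lemma hermitian_integral_translate p (B : 'M[R[i]]_p)
    (f : 'M[R[i]]_p -> \bar R) : B^t* = B ->
  measurable_fun setT f -> (forall A, 0 <= f A) ->
  \int[H p]_V f (V + B)%R = \int[H p]_V f V.
Proof.
move=> Bh mf f0; rewrite !hermitian_integral//; last by mxmeas.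
pose b := hermitian_coords B.
transitivity (\int[LR p p]_A
    f (hermitian_of_coords (\matrix_(i, j) (A i j + b i j)%R))).
  apply: eq_integral => A _; congr f; rewrite -{1}(hermitian_coordsK Bh) -/b.
  apply/matrixP => i j; rewrite !mxE; case: ifP => _.
    by rewrite /GRing.add/=; congr Complex; rewrite addr0.
  case: ifP => _; first by [].
  by congr Complex; rewrite /= opprD.
have mh : measurable_fun setT (fun A : 'M[R]_p => f (hermitian_of_coords A)).
  exact: (measurable_fun_app mf (measurable_fun_hermitian_of_coords _)).
have := @mx_integral_entrywise _ (measurableTypeR R) R mu p p
  (fun i j (z : R) => (z + b i j)%R) 1%R _ ler01 _ _ mh (fun _ => f0 _).
rewrite expr1n mul1e; apply.
- by move=> i j; exact: measurable_funD.
- by move=> i j A mA; rewrite mul1e; exact: lebesgue_measure_translate.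
Qed.

Definition hermitian_block q (a : R) (r : 'rV[R[i]]_q) (C : 'M[R[i]]_q) :
    'M[R[i]]_(1 + q) :=
  block_mx (a%:C%C)%:M r (r^t*) C.

Lemma hermitian_of_coords_block q (a : 'M[R]_1) (r : 'rV[R]_q) (c : 'cV[R]_q)
    (E : 'M[R]_q) :
  hermitian_of_coords (block_mx a r c E) =
  hermitian_block (a ord0 ord0) (map2_mx (@Complex R) r c^T) (hermitian_of_coords E).
Proof.
apply/matrixP => i j; rewrite /hermitian_block.
have lt_lr (k : 'I_1) (l : 'I_q) : (lshift q k < rshift 1 l)%N by rewrite ord1.
case: (fintype.split_ordP i) => k ->; case: (fintype.split_ordP j) => l ->.
- rewrite [RHS]block_mxEul [LHS]mxE !ord1 eqxx block_mxEul [RHS]mxE eqxx.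
  by rewrite mulr1n.
- rewrite [RHS]block_mxEur [LHS]mxE eq_lrshift lt_lr.
  by rewrite block_mxEur block_mxEdl !mxE ord1.
- rewrite [RHS]block_mxEdl [LHS]mxE eq_rlshift ltnNge (ltnW (lt_lr _ _)).
  by rewrite block_mxEur block_mxEdl !mxE conjCE ord1.
- rewrite [RHS]block_mxEdr [LHS]mxE [RHS]mxE (inj_eq (@rshift_inj _ _)).
  by rewrite ltn_add2l !block_mxEdr.
Qed.

Lemma measurable_fun_hermitian_block d (U : measurableType d) q (a : U -> R)
    (r : U -> 'rV[R[i]]_q) (C : U -> 'M[R[i]]_q) :
  measurable_fun setT a -> measurable_fun setT r -> measurable_fun setT C ->
  measurable_fun setT (fun u => hermitian_block (a u) (r u) (C u)).
Proof. by move=> ma mr mC; rewrite /hermitian_block; mxmeas. Qed.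

Ltac mxmeas_extra ::= first
  [ apply: measurable_fun_const_mx
  | apply: measurable_fun_hermitian_block
  | apply: measurable_fun_hermitian_of_coords ].

(** The recursion behind the inductions on the size: real corner, complex first row, Hermitian
    remainder. In the encoding, the real and imaginary parts of the first row are the first row and
    the first column. *)
Lemma hermitian_integral_block q (f : 'M[R[i]]_(1 + q) -> \bar R) :
  measurable_fun setT f -> (forall A, 0 <= f A) ->
  \int[H (1 + q)]_V f V =
  \int[mu]_a \int[L 1 q]_r \int[H q]_C f (hermitian_block a r C).
Proof.
move=> mf f0; rewrite hermitian_integral//.
pose F (A : 'M[measurableTypeR R]_(1 + q)) := f (hermitian_of_coords A).
have mF : measurable_fun setT F by rewrite /F; mxmeas.
rewrite [LHS](mx_integral_corner mu mF); last by move=> A; exact: f0.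
apply: eq_integral => a _.
pose G (Z : 'rV[R[i]]_q) := \int[H q]_C f (hermitian_block a Z C).
have mG : measurable_fun setT G by rewrite /G; mxmeas.
have G0 Z : 0 <= G Z by rewrite /G; nonneg.
have mC : measurable_fun setT
    (fun z : measurableTypeR R * measurableTypeR R => Complex z.1 z.2).
  exact: measurable_complex_of_coords.
rewrite -[RHS](mx_integral_map2_row (mu := mu) mC (@complex_integral R) mG G0).
apply: eq_integral => r _; apply: eq_integral => c _.
rewrite /G hermitian_integral; [|by mxmeas|by nonneg].
apply: eq_integral => E _; rewrite /F hermitian_of_coords_block mxE.
by rewrite trmxK.
Qed.

Lemma hermitian_integral0 (f : 'M[R[i]]_0 -> \bar R) (A0 : 'M[R[i]]_0) :
  measurable_fun setT f -> (forall A, 0 <= f A) ->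
  \int[H 0]_V f V = f A0.
Proof.
move=> mf f0; rewrite hermitian_integral//.
rewrite [LHS](mx_integral_row0 _ (@const_mx (measurableTypeR R) 0 0 (0 : R)%R));
  [|by mxmeas|by nonneg].
by congr f; apply/matrixP => -[].
Qed.

End hermitian_lebesgue_integral.

(** * Completion of isometries to unitary matrices *)

Section unitary_completion.
Context {C : numClosedFieldType}.

Lemma adjmxM m n p (A : 'M[C]_(m, n)) (B : 'M[C]_(n, p)) :
  (A *m B)^t* = B^t* *m A^t*.
Proof. by rewrite trmx_mul map_mxM. Qed.

Lemma adjmx1 n : (1%:M : 'M[C]_n)^t* = 1%:M.
Proof. by rewrite trmx1 map_mx1. Qed.

Lemma adjmx_unit p (T : 'M[C]_p) : (T^t* \in unitmx) = (T \in unitmx).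
Proof. by rewrite map_unitmx unitmx_tr. Qed.

Lemma adjmx_inv p (T : 'M[C]_p) : (invmx T)^t* = invmx (T^t*).
Proof. by rewrite trmx_inv map_invmx. Qed.

Lemma det_adjmx p (T : 'M[C]_p) : \det (T^t*) = (\det T)^*.
Proof. by rewrite (det_map_mx (Num.conj : {rmorphism _ -> _})) det_tr. Qed.

(** The missing rows are an orthonormal basis, obtained by Gram-Schmidt, of the space of rows
    orthogonal to those of V. *)
Lemma unitary_completion k l (V : 'M[C]_(k, k + l)) : V *m V^t* = 1%:M ->
  exists V2 : 'M[C]_(l, k + l), col_mx V V2 *m (col_mx V V2)^t* = 1%:M.
Proof.
move=> VV; have Vu : V \is unitarymx by apply/unitarymxP.
pose K := kermx (V^t*).
have rk : \rank K = l.
  by rewrite mxrank_ker mxrank_map mxrank_tr mxrank_unitary// addKn.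
(* [row_base K] has [\rank K] rows; the dimension l is substituted once [K] occurs in the statement
   only through its rank. *)
have : exists V2 : 'M[C]_(\rank K, k + l),
    V2 *m V2^t* = 1%:M /\ V2 *m V^t* = 0.
  exists (schmidt (row_base K)); split.
    exact/unitarymxP/schmidt_unitarymx/rank_leq_col.
  apply/sub_kermxP; rewrite eqmx_schmidt_free ?row_base_free//.
  by rewrite eq_row_base.
rewrite rk => -[V2 [VV2 V20]]; exists V2.
have V0 : V *m V2^t* = 0.
  by rewrite -[LHS]trmxCK adjmxM trmxCK V20 trmx0 map_mx0.
by rewrite tr_col_mx map_row_mx mul_col_row VV VV2 V0 V20 -scalar_mx_block.
Qed.

(** Each isometry is completed to a unitary matrix that sends it to the first p axes; the matrix for
    Q1 is followed by the inverse of the one for Q2. *)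
Lemma isometry_transitive n p (Q1 Q2 : 'M[C]_(n, p)) :
  Q1^t* *m Q1 = 1%:M -> Q2^t* *m Q2 = 1%:M ->
  exists2 U : 'M[C]_n, U^t* *m U = 1%:M & U *m Q1 = Q2.
Proof.
move=> QQ1 QQ2; have le_pn : (p <= n)%N.
  rewrite -(mxrank1 C p) -QQ1; apply: leq_trans (mxrankM_maxl _ _) _.
  exact: rank_leq_col.
have [l nE] : exists l, n = (p + l)%N by exists (n - p)%N; rewrite subnKC.
subst n.
have complete (Q : 'M[C]_(p + l, p)) : Q^t* *m Q = 1%:M ->
    exists2 U : 'M[C]_(p + l), U *m U^t* = 1%:M & U *m Q = col_mx 1%:M 0.
  move=> QQ; have [|V2 VV2] := @unitary_completion p l (Q^t*).
    by rewrite trmxCK.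
  exists (col_mx (Q^t*) V2) => //; rewrite mul_col_mx QQ; congr col_mx.
  move: VV2; rewrite tr_col_mx map_row_mx mul_col_row trmxCK.
  by rewrite [RHS]scalar_mx_block => /eq_block_mx[].
have [U1 UU1 UQ1] := complete _ QQ1; have [U2 UU2 UQ2] := complete _ QQ2.
have UU2' : U2^t* *m U2 = 1%:M by exact: mulmx1C.
have UU1' : U1^t* *m U1 = 1%:M by exact: mulmx1C.
exists (U2^t* *m U1).
  by rewrite adjmxM trmxCK mulmxA -(mulmxA _ U2) UU2 mulmx1.
by rewrite -mulmxA UQ1 -UQ2 mulmxA UU2' mul1mx.
Qed.

End unitary_completion.

(** * Positive definite matrices *)

Section positive_definite.
Context {R : realType}.

Lemma adjmxZr m n (a : R) (A : 'M[R[i]]_(m, n)) :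
  (a%:C%C *: A)^t* = a%:C%C *: A^t*.
Proof.
apply/matrixP => i j; rewrite !mxE rmorphM/=; congr (_ * _).
by rewrite conjCE conjc_real.
Qed.

(** For Hermitian A the value is already real ([hermitian_Im0]), and [complex.Re] only places it in
    [R]. *)
Definition qform p (A : 'M[R[i]]_p) (v : 'cV[R[i]]_p) : R :=
  complex.Re ((v^t* *m A *m v) ord0 ord0).

Definition pdmx p (A : 'M[R[i]]_p) : Prop :=
  A^t* = A /\ forall v : 'cV[R[i]]_p, v != 0 -> 0 < qform A v.

Lemma hermitian_Im0 p (A : 'M[R[i]]_p) (v : 'cV[R[i]]_p) : A^t* = A ->
  complex.Im ((v^t* *m A *m v) ord0 ord0) = 0.
Proof.
move=> Ah; set M := v^t* *m A *m v.
have Mh : M^t* = M by rewrite /M !adjmxM trmxCK Ah mulmxA.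
have : (M ord0 ord0)^* = M ord0 ord0 by rewrite -[in RHS]Mh !mxE.
rewrite conjCE; case: (M ord0 ord0) => a b [] h /=; lra.
Qed.

Lemma psdmxE p (A : 'M[R[i]]_p) :
  psdmx A <-> A^t* = A /\ forall v, 0 <= qform A v.
Proof.
split=> -[Ah A0]; split.
- exact/hermsymmxP.
- by move=> v; have := A0 v; rewrite lecE => /andP[].
- exact/hermsymmxP.
- by move=> v; rewrite lecE hermitian_Im0// eqxx; exact: A0.
Qed.

Lemma pdmx_psdmx p (A : 'M[R[i]]_p) : pdmx A -> psdmx A.
Proof.
move=> [Ah A0]; apply/psdmxE; split=> // v.
have [->|v0] := eqVneq v 0; last exact/ltW/A0.
by rewrite /qform mulmx0 mxE.
Qed.

Lemma qform_congr p (T A : 'M[R[i]]_p) v :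
  qform (T^t* *m A *m T) v = qform A (T *m v).
Proof. by rewrite /qform adjmxM !mulmxA. Qed.

Lemma qformD p (A B : 'M[R[i]]_p) v : qform (A + B) v = qform A v + qform B v.
Proof.
rewrite /qform mulmxDr mulmxDl mxE.
by case: (_ ord0 ord0) => ? ?; case: (_ ord0 ord0).
Qed.

Lemma qformv0 p (A : 'M[R[i]]_p) : qform A 0 = 0.
Proof. by rewrite /qform mulmx0 mxE. Qed.

Lemma ReM_real (a : R) (z : R[i]) : complex.Re (a%:C%C * z) = a * complex.Re z.
Proof. by case: z => x y; rewrite /= mul0r subr0. Qed.

Lemma qformZ p (a : R) (A : 'M[R[i]]_p) v :
  qform (a%:C%C *: A) v = a * qform A v.
Proof. by rewrite /qform -scalemxAr -scalemxAl mxE ReM_real. Qed.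

Lemma qform1 p (v : 'cV[R[i]]_p) : qform 1%:M v = \sum_i sqnormc (v i ord0).
Proof.
rewrite /qform mulmx1 mxE.
rewrite (eq_bigr (fun i => (sqnormc (v i ord0))%:C%C)); last first.
  by move=> i _; rewrite !mxE sqnormcE mulrC.
by rewrite -rmorph_sum.
Qed.

Lemma qform1_gt0 p (v : 'cV[R[i]]_p) : v != 0 -> 0 < qform 1%:M v.
Proof.
move=> v0; rewrite qform1 lt_neqAle sumr_ge0 ?andbT => [|i _];
  last exact: sqnormc_ge0.
apply: contraNneq v0 => /esym/eqP; rewrite psumr_eq0 => [/allP h|i _];
  last exact: sqnormc_ge0.
apply/eqP/matrixP => i j; rewrite ord1 mxE; apply/eqP.
by rewrite -sqnormc_eq0; apply: h; rewrite mem_index_enum.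
Qed.

Lemma pdmx1 p : pdmx (1%:M : 'M[R[i]]_p).
Proof. by split; [exact: adjmx1|exact: qform1_gt0]. Qed.

Lemma pdmx_add p (A B : 'M[R[i]]_p) : psdmx A -> pdmx B -> pdmx (A + B).
Proof.
move=> /psdmxE[Ah A0] [Bh B0]; split; first by rewrite linearD map_mxD Ah Bh.
by move=> v v0; rewrite qformD ltr_wpDl// B0.
Qed.

Lemma pdmxZ p (a : R) (A : 'M[R[i]]_p) : 0 < a -> pdmx A -> pdmx (a%:C%C *: A).
Proof.
move=> a0 [Ah A0]; split.
  by rewrite adjmxZr Ah.
by move=> v v0; rewrite qformZ mulr_gt0// A0.
Qed.

Lemma pdmx_congr p (T A : 'M[R[i]]_p) : T \in unitmx ->
  pdmx (T^t* *m A *m T) <-> pdmx A.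
Proof.
have pd_congr (U B : 'M[R[i]]_p) : U \in unitmx -> pdmx B ->
    pdmx (U^t* *m B *m U).
  move=> Uu [Bh B0]; split; first by rewrite !adjmxM trmxCK Bh mulmxA.
  move=> v v0; rewrite qform_congr; apply: B0.
  by apply: contraNneq v0 => Uv0; rewrite -[v](mulKmx Uu) Uv0 mulmx0.
move=> Tu; split=> [pdA|]; last exact: pd_congr.
have Tu' : invmx T \in unitmx by rewrite unitmx_inv.
have := pd_congr _ _ Tu' pdA; rewrite (_ : (_ *m _ *m _)%R = A)//.
by rewrite !mulmxA -adjmxM mulmxV// adjmx1 mul1mx mulmxK.
Qed.

Lemma psdmx_congr p (T A : 'M[R[i]]_p) : T \in unitmx ->
  psdmx (T^t* *m A *m T) <-> psdmx A.
Proof.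
have psd_congr (U B : 'M[R[i]]_p) : psdmx B -> psdmx (U^t* *m B *m U).
  move=> /psdmxE[Bh B0]; apply/psdmxE.
  by split; [rewrite !adjmxM trmxCK Bh mulmxA|move=> v; rewrite qform_congr].
move=> Tu; split=> [pdA|]; last exact: psd_congr.
have := psd_congr (invmx T) _ pdA; rewrite (_ : (_ *m _ *m _)%R = A)//.
by rewrite !mulmxA -adjmxM mulmxV// adjmx1 mul1mx mulmxK.
Qed.

Definition schur q (a : R) (r : 'rV[R[i]]_q) (C : 'M[R[i]]_q) : 'M[R[i]]_q :=
  C - (a^-1)%:C%C *: (r^t* *m r).

Definition diag_block q (a : R) (S : 'M[R[i]]_q) : 'M[R[i]]_(1 + q) :=
  hermitian_block a 0 S.

(** One step of block elimination, as a congruence by a unit upper triangular matrix. Definiteness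
    and determinant thereby pass to the Schur complement. *)
Lemma hermitian_block_schur q (a : R) (r : 'rV[R[i]]_q) (C : 'M[R[i]]_q) :
  a != 0 -> let L := block_mx 1%:M ((a^-1)%:C%C *: r) 0 1%:M in
  hermitian_block a r C = L^t* *m diag_block a (schur a r C) *m L.
Proof.
move=> a0 L; rewrite /L /diag_block /hermitian_block.
have aV : (a%:C * (a^-1)%:C = 1 :> R[i])%C.
  by rewrite -rmorphM/= divff.
rewrite tr_block_mx map_block_mx !trmx0 !map_mx0 !adjmx1 !mulmx_block.
rewrite !mulmx0 !mul0mx !mulmx1 !mul1mx !addr0 !add0r.
have aV' : ((a^-1)%:C * a%:C = 1 :> R[i])%C by rewrite mulrC.
rewrite adjmxZr -!scalemxAl mul_scalar_mx mul_mx_scalar !scalerA aV aV' !scale1r.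
by rewrite -scalemxAr -scalemxAl !scalerA aV' mulr1 /schur addrC subrK.
Qed.

Lemma hermitian_block_adj q (a : R) (r : 'rV[R[i]]_q) (C : 'M[R[i]]_q) :
  (hermitian_block a r C)^t* = hermitian_block a r (C^t*).
Proof.
rewrite /hermitian_block tr_block_mx map_block_mx trmxCK; congr block_mx.
by rewrite tr_scalar_mx map_scalar_mx; congr scalar_mx; exact: conjc_real.
Qed.

Lemma qform_diag_block q (a : R) (S : 'M[R[i]]_q) (x : 'cV[R[i]]_1)
    (w : 'cV[R[i]]_q) :
  qform (diag_block a S) (col_mx x w) = a * sqnormc (x ord0 ord0) + qform S w.
Proof.
rewrite /qform /diag_block /hermitian_block -mulmxA mul_block_col.
rewrite trmx0 map_mx0 !mul0mx addr0 add0r tr_col_mx map_row_mx mul_row_col.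
rewrite mul_scalar_mx -scalemxAr mulmxA [in LHS]mxE.
set u := (_ *m _) ord0 ord0; rewrite [X in complex.Re (X + _)]mxE.
rewrite mxE big_ord1 !mxE [_^* * _]mulrC -sqnormcE.
by case: u => u1 u2; rewrite /= mulr0 subr0.
Qed.

Lemma diag_block_pdmx q (a : R) (S : 'M[R[i]]_q) :
  pdmx (diag_block a S) <-> 0 < a /\ pdmx S.
Proof.
split=> [[Dh D0]|[a0 [Sh S0]]].
  split.
    have := D0 (col_mx (const_mx 1) 0); rewrite qform_diag_block mxE sqnormc1.
    rewrite qformv0 addr0 mulr1; apply.
    apply/eqP => /matrixP /(_ (lshift q ord0) ord0); rewrite col_mxEu !mxE.
    by move/eqP; rewrite oner_eq0.
  split; first by move: Dh; rewrite hermitian_block_adj => /eq_block_mx[].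
  move=> w w0; have := D0 (col_mx 0 w); rewrite qform_diag_block mxE.
  have -> : sqnormc (0 : R[i]) = 0 by apply/eqP; rewrite sqnormc_eq0.
  rewrite mulr0 add0r; apply.
  by apply: contraNneq w0 => /(congr1 dsubmx); rewrite col_mxKd linear0 => ->.
split; first by rewrite hermitian_block_adj Sh.
move=> v; rewrite -[v]vsubmxK qform_diag_block => v0.
have [d0|d0] := eqVneq (dsubmx v) 0.
  rewrite d0 qformv0 addr0 mulr_gt0// sqnormc_gt0//.
  apply: contraNneq v0 => u0; rewrite d0; apply/eqP/matrixP => i j.
  rewrite !mxE; case: fintype.splitP => k _; rewrite mxE// !ord1.
  by move: u0; rewrite mxE.
by rewrite ltr_wpDl ?S0// mulr_ge0 ?sqnormc_ge0 ?ltW.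
Qed.

Lemma diag_block_psdmx q (a : R) (S : 'M[R[i]]_q) :
  psdmx (diag_block a S) <-> 0 <= a /\ psdmx S.
Proof.
split=> [/psdmxE[Dh D0]|[a0 /psdmxE[Sh S0]]].
  split.
    have := D0 (col_mx (const_mx 1) 0); rewrite qform_diag_block mxE sqnormc1.
    by rewrite qformv0 addr0 mulr1; apply.
  apply/psdmxE; split.
    by move: Dh; rewrite hermitian_block_adj => /eq_block_mx[].
  move=> w; have := D0 (col_mx 0 w); rewrite qform_diag_block mxE.
  have -> : sqnormc (0 : R[i]) = 0 by apply/eqP; rewrite sqnormc_eq0.
  by rewrite mulr0 add0r.
apply/psdmxE; split; first by rewrite hermitian_block_adj Sh.
move=> v; rewrite -[v]vsubmxK qform_diag_block.
by rewrite addr_ge0// mulr_ge0 ?sqnormc_ge0.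
Qed.

Lemma unit_upper_unitmx q (w : 'rV[R[i]]_q) :
  block_mx 1%:M w 0 1%:M \in unitmx.
Proof. by rewrite unitmxE det_ublock !det1 mulr1 unitr1. Qed.

Lemma hermitian_block_pdmx q (a : R) (r : 'rV[R[i]]_q) (C : 'M[R[i]]_q) :
  a != 0 ->
  pdmx (hermitian_block a r C) <-> 0 < a /\ pdmx (schur a r C).
Proof.
move=> a0; rewrite (hermitian_block_schur _ _ a0).
by rewrite pdmx_congr ?unit_upper_unitmx//; exact: diag_block_pdmx.
Qed.

Lemma hermitian_block_psdmx q (a : R) (r : 'rV[R[i]]_q) (C : 'M[R[i]]_q) :
  a != 0 ->
  psdmx (hermitian_block a r C) <-> 0 <= a /\ psdmx (schur a r C).
Proof.
move=> a0; rewrite (hermitian_block_schur _ _ a0).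
by rewrite psdmx_congr ?unit_upper_unitmx//; exact: diag_block_psdmx.
Qed.

Lemma det_hermitian_block q (a : R) (r : 'rV[R[i]]_q) (C : 'M[R[i]]_q) :
  a != 0 ->
  \det (hermitian_block a r C) = a%:C%C * \det (schur a r C).
Proof.
move=> a0; rewrite (hermitian_block_schur _ _ a0) !det_mulmx.
rewrite tr_block_mx map_block_mx trmx0 map_mx0 !adjmx1.
rewrite /diag_block /hermitian_block !det_lblock det_ublock det_scalar1.
by rewrite det_scalar1 !det1 !mul1r !mulr1.
Qed.

Lemma lshift0_ord0 q : lshift q (@ord0 0) = @ord0 q :> 'I_(1 + q).
Proof. exact/val_inj. Qed.

Lemma hermitian_blockE q (A : 'M[R[i]]_(1 + q)) : A^t* = A ->
  A = hermitian_block (complex.Re (A ord0 ord0)) (ursubmx A) (drsubmx A).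
Proof.
move=> Ah; rewrite -[LHS]submxK /hermitian_block; congr block_mx.
  apply/matrixP => i j; rewrite !mxE !ord1 eqxx mulr1n lshift0_ord0.
  have : (A ord0 ord0)^* = A ord0 ord0 by rewrite -[in RHS]Ah !mxE.
  rewrite conjCE; case: (A ord0 ord0) => a b [] h /=; congr Complex; lra.
by rewrite -{1}Ah; apply/matrixP => i j; rewrite !mxE.
Qed.

Lemma corner_hermitian_block q (a : R) (r : 'rV[R[i]]_q) (C : 'M[R[i]]_q) :
  complex.Re (hermitian_block a r C ord0 ord0) = a.
Proof.
by rewrite -lshift0_ord0 block_mxEul mxE eqxx mulr1n.
Qed.

Lemma psdmx_corner_ge0 q (A : 'M[R[i]]_(1 + q)) :
  psdmx A -> 0 <= complex.Re (A ord0 ord0).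
Proof.
move=> /psdmxE[_ /(_ (delta_mx ord0 ord0))]; rewrite /qform -mulmxA -colE.
rewrite mxE (bigD1 ord0)//= big1 => [|i i0]; last first.
  by rewrite !mxE (negPf i0) conjCE/= oppr0 mul0r.
by rewrite !mxE conjCE /= oppr0 addr0 mul1r.
Qed.

Lemma pdmx_corner_gt0 q (A : 'M[R[i]]_(1 + q)) :
  pdmx A -> 0 < complex.Re (A ord0 ord0).
Proof.
move=> [_ /(_ (delta_mx ord0 ord0))]; rewrite /qform -mulmxA -colE.
rewrite mxE (bigD1 ord0)//= big1 => [|i i0]; last first.
  by rewrite !mxE (negPf i0) conjCE/= oppr0 mul0r.
rewrite !mxE conjCE /= oppr0 addr0 mul1r; apply.
apply/eqP => /matrixP/(_ ord0 ord0); rewrite !mxE/= => /eqP.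
by rewrite oner_eq0.
Qed.

(** The test on which the recursions for determinants, Cholesky factors and measurability rest. *)
Lemma pdmx_block q (A : 'M[R[i]]_(1 + q)) :
  pdmx A <-> [/\ A^t* = A, 0 < complex.Re (A ord0 ord0) &
    pdmx (schur (complex.Re (A ord0 ord0)) (ursubmx A) (drsubmx A))].
Proof.
split=> [pA|[Ah a0 pS]].
  have a0 := pdmx_corner_gt0 pA; have [Ah _] := pA; split=> //.
  move: pA; rewrite {1}(hermitian_blockE Ah).
  by move=> /hermitian_block_pdmx; rewrite gt_eqF// => /(_ isT)[].
rewrite (hermitian_blockE Ah); apply/hermitian_block_pdmx => //.
by rewrite gt_eqF.
Qed.

Lemma pdmx_det p (A : 'M[R[i]]_p) : pdmx A -> 0 < \det A.
Proof.
elim: p A => [A _|p IHp A]; first by rewrite det_mx00 ltr01.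
rewrite -[p.+1]add1n in A *; move=> pA.
have /pdmx_block[Ah a0 pS] := pA.
rewrite (hermitian_blockE Ah) det_hermitian_block ?gt_eqF//.
by rewrite mulr_gt0 ?IHp// ltcR.
Qed.

Lemma pdmx_unit p (A : 'M[R[i]]_p) : pdmx A -> A \in unitmx.
Proof. by move=> /pdmx_det A0; rewrite unitmxE unitfE gt_eqF. Qed.

(** The lower triangular factor is given by an explicit recursion, and not chosen among the square
    roots, so that it depends measurably on A. It is meaningful for positive definite A. *)
Fixpoint cholesky p : 'M[R[i]]_p -> 'M[R[i]]_p :=
  match p with
  | 0 => fun A => A
  | q.+1 => fun A : 'M[R[i]]_(1 + q) =>
    let a := complex.Re (A ord0 ord0) in
    let r := ursubmx A in
    block_mx ((Num.sqrt a)%:C%C)%:M 0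
      (((Num.sqrt a)^-1)%:C%C *: r^t*) (cholesky (schur a r (drsubmx A)))
  end.

Lemma choleskyK p (A : 'M[R[i]]_p) : pdmx A ->
  cholesky A *m (cholesky A)^t* = A.
Proof.
elim: p A => [A _|p IHp]; first by apply/matrixP => -[].
rewrite -[p.+1]add1n => A pA; have /pdmx_block[Ah a0 pS] := pA.
rewrite [RHS](hermitian_blockE Ah) /hermitian_block /=.
set a := complex.Re _ in a0 pS *; set r := ursubmx A in pS *.
have s0 : Num.sqrt a != 0 by rewrite gt_eqF// sqrtr_gt0.
have saM : ((Num.sqrt a)%:C * (Num.sqrt a)%:C = a%:C :> R[i])%C.
  by rewrite -rmorphM/= -expr2 sqr_sqrtr// ltW.
have sV : ((Num.sqrt a)%:C * ((Num.sqrt a)^-1)%:C = 1 :> R[i])%C.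
  by rewrite -rmorphM/= divff.
have VV : (((Num.sqrt a)^-1)%:C * ((Num.sqrt a)^-1)%:C = (a^-1)%:C :> R[i])%C.
  by rewrite -rmorphM/= -invfM -expr2 sqr_sqrtr// ltW.
have scC (b : R) : ((b%:C%C)%:M : 'M[R[i]]_1)^t* = (b%:C%C)%:M.
  by rewrite tr_scalar_mx map_scalar_mx; congr scalar_mx; exact: conjc_real.
rewrite tr_block_mx map_block_mx trmx0 map_mx0 adjmxZr trmxCK scC.
rewrite mulmx_block !mulmx0 !mul0mx !addr0.
rewrite mul_scalar_mx scale_scalar_mx saM mul_scalar_mx scalerA sV scale1r.
rewrite mul_mx_scalar scalerA sV scale1r IHp//.
by rewrite -scalemxAl -scalemxAr scalerA VV /schur addrC subrK.
Qed.

Lemma cholesky_unit p (A : 'M[R[i]]_p) : pdmx A -> cholesky A \in unitmx.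
Proof.
move=> pA; have := pdmx_unit pA; rewrite -[in X in X -> _](choleskyK pA).
by rewrite unitmx_mul => /andP[].
Qed.

Lemma sqnormc_det_cholesky p (A : 'M[R[i]]_p) : pdmx A ->
  (sqnormc (\det (cholesky A)))%:C%C = \det A.
Proof.
move=> pA; rewrite sqnormcE -[in RHS](choleskyK pA) det_mulmx; congr (_ * _).
by rewrite det_adjmx.
Qed.

End positive_definite.

(** * Measurability of Cholesky factors and of the positive cones *)

Section positive_definite_measurable.
Context {R : realType}.

Lemma measurable_fun_sqrt d (U : measurableType d) (f : U -> R) :
  measurable_fun setT f -> measurable_fun setT (fun u => Num.sqrt (f u)).
Proof.
apply: measurableT_comp.
by apply: continuous_measurable_fun; exact: sqrt_continuous.
Qed.

Lemma measurable_fun_rsum d (U : measurableType d) I (s : seq I)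
    (F : I -> U -> R) :
  (forall i, measurable_fun setT (F i)) ->
  measurable_fun setT (fun u => \sum_(i <- s) F i u).
Proof.
move=> mF; elim: s => [|i s IHs].
  rewrite (_ : (fun u => _) = cst 0); first exact: measurable_cst.
  by apply/funext => u; rewrite big_nil.
rewrite (_ : (fun u => _) = (fun u => F i u + \sum_(i <- s) F i u)).
  exact: measurable_funD.
by apply/funext => u; rewrite big_cons.
Qed.

Ltac mxmeas_extra ::= first
  [ apply: measurable_fun_const_mx
  | apply: measurable_fun_hermitian_block
  | apply: measurable_fun_hermitian_of_coords
  | apply: measurable_fun_sqrt ].

Lemma measurable_fun_sqnormc d (U : measurableType d) (f : U -> R[i]) :
  measurable_fun setT f -> measurable_fun setT (fun u => sqnormc (f u)).
Proof. by move=> mf; rewrite /sqnormc; mxmeas. Qed.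

Lemma measurable_fun_mx_eq0 d (U : measurableType d) m n
    (f : U -> 'M[R[i]]_(m, n)) :
  measurable_fun setT f -> measurable_fun setT (fun u => f u == 0).
Proof.
move=> mf.
rewrite (_ : (fun u => _) = (fun u => \sum_i \sum_j sqnormc (f u i j) == 0)).
  apply: measurable_fun_eqr; last exact: measurable_cst.
  apply: measurable_fun_rsum => i; apply: measurable_fun_rsum => j.
  by apply: measurable_fun_sqnormc; mxmeas.
apply/funext => u.
have sum0 i : 0 <= \sum_j sqnormc (f u i j).
  by apply: sumr_ge0 => j _; exact: sqnormc_ge0.
apply/eqP/eqP => [->|/eqP].
  rewrite big1// => i _; rewrite big1// => j _.
  by rewrite mxE; apply/eqP; rewrite sqnormc_eq0.
rewrite psumr_eq0// => /allP f0; apply/matrixP => i j; rewrite mxE.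
have := f0 i (mem_index_enum i); rewrite /= psumr_eq0 => [|k _];
  last exact: sqnormc_ge0.
by move=> /allP/(_ j (mem_index_enum j)); rewrite /= sqnormc_eq0 => /eqP.
Qed.

Lemma measurable_fun_schur d (U : measurableType d) q (a : U -> R)
    (r : U -> 'rV[R[i]]_q) (C : U -> 'M[R[i]]_q) :
  measurable_fun setT a -> measurable_fun setT r -> measurable_fun setT C ->
  measurable_fun setT (fun u => schur (a u) (r u) (C u)).
Proof. by move=> ma mr mC; rewrite /schur; mxmeas. Qed.

Lemma measurable_fun_cholesky d (U : measurableType d) p (f : U -> 'M[R[i]]_p) :
  measurable_fun setT f -> measurable_fun setT (fun u => cholesky (f u)).
Proof.
elim: p f => [//|p IHp] f mf /=.
have mS : measurable_fun setT (fun u => cholesky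
    (schur (complex.Re ((f u : 'M[R[i]]_(1 + p)) ord0 ord0))
      (ursubmx (f u : 'M[R[i]]_(1 + p))) (drsubmx (f u : 'M[R[i]]_(1 + p))))).
  by apply: IHp; apply: measurable_fun_schur; mxmeas.
apply: (@measurable_fun_block_mx _ _ _ _ 1 p 1 p); mxmeas.
Qed.

Definition pd p (A : 'M[R[i]]_p) : bool := `[< pdmx A >].
Definition psd p (A : 'M[R[i]]_p) : bool := `[< psdmx A >].

Lemma pdP p (A : 'M[R[i]]_p) : reflect (pdmx A) (pd A).
Proof. exact: asboolP. Qed.

Lemma psdP p (A : 'M[R[i]]_p) : reflect (psdmx A) (psd A).
Proof. exact: asboolP. Qed.

(** The definition quantifies over uncountably many vectors; the Schur recursion replaces it by
    finitely many measurable tests. *)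
Lemma measurable_fun_pd d (U : measurableType d) p (f : U -> 'M[R[i]]_p) :
  measurable_fun setT f -> measurable_fun setT (fun u => pd (f u)).
Proof.
elim: p f => [|p IHp] f mf.
  rewrite (_ : (fun u => _) = cst true); first exact: measurable_cst.
  apply/funext => u; apply/pdP; split; first by apply/matrixP => -[].
  by move=> v /eqP[]; apply/matrixP => -[].
pose g u := f u : 'M[R[i]]_(1 + p).
rewrite (_ : (fun u => _) = (fun u => [&& (g u)^t* - g u == 0,
    0 < complex.Re (g u ord0 ord0) &
    pd (schur (complex.Re (g u ord0 ord0)) (ursubmx (g u)) (drsubmx (g u)))])).
  have mg : measurable_fun setT g by [].
  apply: measurable_and; first by apply: measurable_fun_mx_eq0; mxmeas.
  apply: measurable_and.
    by apply: measurable_fun_ltr; [exact: measurable_cst|mxmeas].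
  by apply: IHp; apply: measurable_fun_schur; mxmeas.
apply/funext => u; rewrite subr_eq0.
apply/pdP/and3P => [/pdmx_block[Ah a0 pS]|[/eqP Ah a0 /pdP pS]].
  by split=> //; [exact/eqP|exact/pdP].
exact/pdmx_block.
Qed.

(** The Schur recursion breaks down at a zero corner, so the closed cone is reached as a countable
    intersection of translates of the open one. *)
Lemma psdmx_approx p (A : 'M[R[i]]_p) :
  psdmx A <-> forall k : nat, pdmx (A + ((k.+1%:R : R)^-1)%:C%C *: 1%:M).
Proof.
have k0 k : 0 < (k.+1%:R : R)^-1 by rewrite invr_gt0 ltr0n.
split=> [pA k|pA]; first exact/pdmx_add/pdmxZ/pdmx1.
apply/psdmxE; split.
  have [+ _] := pA 0%N; rewrite linearD map_mxD adjmxZr adjmx1.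
  by move=> /addIr.
move=> v; have [->|v0] := eqVneq v 0; first by rewrite qformv0.
rewrite leNgt; apply/negP => Av0.
(* Adding to A a multiple of the identity smaller than this threshold leaves the form negative at
   v. *)
pose e := - qform A v / qform 1%:M v.
have e0 : 0 < e by rewrite divr_gt0 ?oppr_gt0 ?qform1_gt0.
have [k _ /(_ k (leqnn k)) /= ke] := near_infty_natSinv_lt (PosNum e0).
have := (pA k).2 v v0; rewrite qformD qformZ.
move: ke; rewrite ltr_pdivlMr ?qform1_gt0// => ke.
by rewrite -ltrBlDl sub0r ltNge ltW.
Qed.

Lemma measurable_fun_psd d (U : measurableType d) p (f : U -> 'M[R[i]]_p) :
  measurable_fun setT f -> measurable_fun setT (fun u => psd (f u)).
Proof.
move=> mf; apply: (measurable_fun_bool true); rewrite setTI.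
rewrite (_ : _ @^-1` _ = \bigcap_k
    [set u | pd (f u + ((k.+1%:R : R)^-1)%:C%C *: 1%:M)]).
  apply: bigcapT_measurable => k; rewrite -[X in measurable X]setTI.
  have : measurable_fun setT (fun u => pd (f u + ((k.+1%:R : R)^-1)%:C%C *: 1%:M)).
    by apply: measurable_fun_pd; mxmeas.
  by move=> /(_ measurableT [set true]); exact.
apply/seteqP; split => [u /= /psdP/psdmx_approx uA k _|u uA] /=; first exact/pdP.
by apply/psdP/psdmx_approx => k; apply/pdP; exact: uA.
Qed.

End positive_definite_measurable.

(** * Gaussian and radial integrals *)

Section mx_integral_prod.
Context d (T : measurableType d) (R : realType).
Variable mu : {sigma_finite_measure set T -> \bar R}.
Local Open Scope ereal_scope.

Lemma measurable_fun_eprod d' (U : measurableType d') I (s : seq I)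
    (F : I -> U -> \bar R) :
  (forall i, measurable_fun setT (F i)) ->
  measurable_fun setT (fun u => \prod_(i <- s) F i u).
Proof.
move=> mF; elim: s => [|i s IHs].
  rewrite (_ : (fun u => _) = cst 1); first exact: measurable_cst.
  by apply/funext => u; rewrite big_nil.
rewrite (_ : (fun u => _) = (fun u => F i u * \prod_(i <- s) F i u)).
  exact: emeasurable_funM.
by apply/funext => u; rewrite big_cons.
Qed.

Lemma mx_integral_prod_row n (g : 'I_n -> T -> \bar R) :
  (forall j, measurable_fun setT (g j)) -> (forall j x, 0 <= g j x) ->
  \int[mx_measure 1 n mu]_A \prod_(j < n) g j (A ord0 j) =
  \prod_(j < n) \int[mu]_x g j x.
Proof.
elim: n g => [g mg g0|n IHn]; last rewrite -[n.+1]add1n => g mg g0.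
  rewrite (mx_integral_col0 mu (@const_mx T 1 0 point)) ?big_ord0//.
  - by apply: measurable_fun_eprod => -[].
  - by move=> A; rewrite big_ord0.
have mP n' (h : 'I_n' -> T -> \bar R) : (forall j, measurable_fun setT (h j)) ->
    measurable_fun setT (fun A : 'M[T]_(1, n') => \prod_(j < n') h j (A ord0 j)).
  move=> mh; apply: measurable_fun_eprod => j.
  by apply: (measurable_fun_app (mh j)); mxmeas.
have P0 n' (h : 'I_n' -> T -> \bar R) (A : 'M[T]_(1, n')) :
    (forall j x, 0 <= h j x) -> 0 <= \prod_(j < n') h j (A ord0 j).
  by move=> h0; exact: prode_ge0.
rewrite [LHS](mx_integral_row_mx mu (mP _ g mg)) => [|A]; last exact: P0.
pose c := \prod_(j < n) \int[mu]_x g (rshift 1 j) x.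
transitivity (\int[mx_measure 1 1 mu]_A (c * g (lshift n ord0) (A ord0 ord0))).
  apply: eq_integral => A _.
  transitivity (\int[mx_measure 1 n mu]_B (g (lshift n ord0) (A ord0 ord0) *
      \prod_(j < n) g (rshift 1 j) (B ord0 j))).
    apply: eq_integral => B _; rewrite big_split_ord/= big_ord1 row_mxEl.
    by congr (_ * _); apply: eq_bigr => j _; rewrite row_mxEr.
  rewrite ge0_integralZl//.
  - by rewrite (IHn (fun j => g (rshift 1 j)))// muleC.
  - exact: (mP _ (fun j => g (rshift 1 j))).
  - by move=> B _; exact: (P0 _ (fun j => g (rshift 1 j))).
have mg0 : measurable_fun setT
    (fun A : 'M[T]_(1, 1) => g (lshift n ord0) (A ord0 ord0)).
  by apply: (measurable_fun_app (mg _)); mxmeas.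
rewrite ge0_integralZl//; last by apply: prode_ge0 => j _; exact: integral_ge0.
rewrite mx_integral_scalar// big_split_ord/= big_ord1 muleC; congr (_ * _).
by apply: eq_integral => x _; rewrite mxE.
Qed.

Lemma mx_integral_prod m n (g : 'I_m -> 'I_n -> T -> \bar R) :
  (forall i j, measurable_fun setT (g i j)) -> (forall i j x, 0 <= g i j x) ->
  \int[mx_measure m n mu]_A \prod_(i < m) \prod_(j < n) g i j (A i j) =
  \prod_(i < m) \prod_(j < n) \int[mu]_x g i j x.
Proof.
elim: m g => [g mg g0|m IHm]; last rewrite -[m.+1]add1n => g mg g0.
  rewrite (mx_integral_row0 mu (@const_mx T 0 n point)) ?big_ord0//.
  - by apply: measurable_fun_eprod => -[].
  - by move=> A; rewrite big_ord0.
have mP m' (h : 'I_m' -> 'I_n -> T -> \bar R) :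
    (forall i j, measurable_fun setT (h i j)) -> measurable_fun setT
    (fun A : 'M[T]_(m', n) => \prod_(i < m') \prod_(j < n) h i j (A i j)).
  move=> mh; apply: measurable_fun_eprod => i; apply: measurable_fun_eprod => j.
  by apply: (measurable_fun_app (mh i j)); mxmeas.
have P0 m' (h : 'I_m' -> 'I_n -> T -> \bar R) (A : 'M[T]_(m', n)) :
    (forall i j x, 0 <= h i j x) ->
    0 <= \prod_(i < m') \prod_(j < n) h i j (A i j).
  by move=> h0; apply: prode_ge0 => i _; exact: prode_ge0.
rewrite [LHS](mx_integral_col_mx mu (mP _ g mg)) => [|A]; last exact: P0.
pose c := \prod_(i < m) \prod_(j < n) \int[mu]_x g (rshift 1 i) j x.
transitivity (\int[mx_measure 1 n mu]_A
    (c * \prod_(j < n) g (lshift m ord0) j (A ord0 j))).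
  apply: eq_integral => A _.
  transitivity (\int[mx_measure m n mu]_B (
      (\prod_(j < n) g (lshift m ord0) j (A ord0 j)) *
      \prod_(i < m) \prod_(j < n) g (rshift 1 i) j (B i j))).
    apply: eq_integral => B _; rewrite big_split_ord/= big_ord1.
    congr (_ * _); first by apply: eq_bigr => j _; rewrite col_mxEu.
    by apply: eq_bigr => i _; apply: eq_bigr => j _; rewrite col_mxEd.
  rewrite ge0_integralZl//.
  - by rewrite (IHm (fun i => g (rshift 1 i)))// muleC.
  - exact: (mP _ (fun i => g (rshift 1 i))).
  - by move=> B _; exact: (P0 _ (fun i => g (rshift 1 i))).
  - exact: prode_ge0.
rewrite ge0_integralZl//.
- rewrite (mx_integral_prod_row (g := g (lshift m ord0)))//.
  by rewrite big_split_ord/= big_ord1 muleC.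
- apply: measurable_fun_eprod => j.
  by apply: (measurable_fun_app (mg _ j)); mxmeas.
- by move=> A _; exact: prode_ge0.
- by apply: prode_ge0 => i _; apply: prode_ge0 => j _; exact: integral_ge0.
Qed.

End mx_integral_prod.

Section gaussian_integral.
Context {R : realType}.
Local Notation mu := (@lebesgue_measure R).
Local Notation nu := (@complex_lebesgue R).
Local Open Scope ereal_scope.

Lemma complex_gaussian_integral :
  \int[nu]_z (expR (- sqnormc z))%:E = pi%:E.
Proof.
have me : measurable_fun setT (fun z : R[i] => (expR (- sqnormc z))%:E).
  apply/measurable_EFinP; apply: (measurableT_comp (@measurable_expR R)).
  by apply: measurable_funN; exact: measurable_fun_sqnormc.
rewrite (complex_integral me); last by move=> z; rewrite lee_fin expR_ge0.
have mg : measurable_fun setT (fun x : R => (gauss_fun x)%:E).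
  by apply/measurable_EFinP; exact: measurable_gauss_fun.
have g0 (x : R) : 0 <= (gauss_fun x)%:E by rewrite lee_fin gauss_fun_ge0.
transitivity (\int[mu]_x ((Num.sqrt pi)%:E * (gauss_fun x)%:E)).
  apply: eq_integral => x _; rewrite muleC -integralT_gauss.
  rewrite -ge0_integralZl//.
  apply: eq_integral => y _.
  by rewrite -EFinM /gauss_fun -expRD -opprD.
rewrite ge0_integralZlT//.
by rewrite integralT_gauss -EFinM -expr2 sqr_sqrtr// pi_ge0.
Qed.

End gaussian_integral.

Ltac mxmeas_gram := fail.

Ltac mxmeas_extra ::=
  lazymatch goal with
  | |- measurable_fun _ (fun u => const_mx _) => apply: measurable_fun_const_mx
  | |- measurable_fun _ (fun u => hermitian_block _ _ _) =>
    apply: measurable_fun_hermitian_block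
  | |- measurable_fun _ (fun u => Num.sqrt _) => apply: measurable_fun_sqrt
  | |- measurable_fun _ (fun u => sqnormc _) => apply: measurable_fun_sqnormc
  | |- measurable_fun _ (fun u => schur _ _ _) => apply: measurable_fun_schur
  | |- measurable_fun _ (fun u => cholesky _) => apply: measurable_fun_cholesky
  | |- measurable_fun _ (fun u => pd _) => apply: measurable_fun_pd
  | |- measurable_fun _ (fun u => psd _) => apply: measurable_fun_psd
  | |- measurable_fun _ (fun u => (_ && _)) => apply: measurable_and
  | |- measurable_fun _ (fun u => (_ < _)%R) => apply: measurable_fun_ltr
  | |- measurable_fun _ (fun u => (_ <= _)%R) => apply: measurable_fun_ler
  | |- measurable_fun _ (fun u => (_ * _)%E) => apply: emeasurable_funM
  | |- measurable_fun _ (fun u => EFin _) => apply/measurable_EFinP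
  | |- measurable_fun _ (fun u => expR _) =>
    apply: (measurable_fun_app (@measurable_expR _))
  | |- measurable_fun _ (fun u => if _ then _ else _) =>
    apply: measurable_fun_ifT
  | |- _ => mxmeas_gram
  end.

(** * Radial integrals *)

Section radial.
Context {R : realType}.
Local Notation mu := (@lebesgue_measure R).
Local Notation L m n := (mx_measure m n (@complex_lebesgue R)).
Local Open Scope ereal_scope.

Definition normsq m (y : 'cV[R[i]]_m) : R :=
  complex.Re ((y^t* *m y) ord0 ord0).

Lemma normsqE m (y : 'cV[R[i]]_m) : normsq y = (\sum_i sqnormc (y i ord0))%R.
Proof. by rewrite -qform1 /qform mulmx1. Qed.

Lemma normsq_ge0 m (y : 'cV[R[i]]_m) : (0 <= normsq y)%R.
Proof. by rewrite normsqE sumr_ge0// => i _; exact: sqnormc_ge0. Qed.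

Lemma normsqZ m (a : R) (y : 'cV[R[i]]_m) :
  normsq (a%:C%C *: y)%R = (a ^+ 2 * normsq y)%R.
Proof.
rewrite !normsqE big_distrr/=; apply: eq_bigr => i _.
by rewrite mxE sqnormcM sqnormc_real.
Qed.

Lemma mx_gaussian_integral m n :
  \int[L m n]_A (expR (- \sum_i \sum_j sqnormc (A i j)))%:E =
  (pi ^+ (m * n))%:E.
Proof.
transitivity (\int[L m n]_A \prod_(i < m) \prod_(j < n)
    (expR (- sqnormc (A i j)))%:E).
  apply: eq_integral => A _; rewrite -sumrN.
  rewrite (big_morph expR (@expRD R) (@expR0 R)).
  rewrite (big_morph EFin (@EFinM R) erefl); apply: eq_bigr => i _.
  rewrite -sumrN (big_morph expR (@expRD R) (@expR0 R)).
  by rewrite (big_morph EFin (@EFinM R) erefl).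
rewrite (mx_integral_prod _ (g := fun _ _ z => (expR (- sqnormc z))%:E)).
- under eq_bigr do under eq_bigr do rewrite complex_gaussian_integral.
  under eq_bigr do rewrite -(big_morph EFin (@EFinM R) erefl) prodr_const card_ord.
  rewrite -(big_morph EFin (@EFinM R) erefl) prodr_const card_ord.
  by rewrite -exprM mulnC.
- by move=> i j; mxmeas.
- by move=> i j z; rewrite lee_fin expR_ge0.
Qed.

Lemma measurable_fun_normsq d (U : measurableType d) m (f : U -> 'cV[R[i]]_m) :
  measurable_fun setT f -> measurable_fun setT (fun u => normsq (f u)).
Proof. by move=> mf; rewrite /normsq; mxmeas. Qed.

Lemma normsq_gaussian_integral m :
  \int[L m 1]_y (expR (- normsq y))%:E = (pi ^+ m)%:E.
Proof.
rewrite -[in RHS](muln1 m) -mx_gaussian_integral; apply: eq_integral => y _.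
rewrite normsqE; congr (expR (- _))%:E; apply: eq_bigr => i _.
by rewrite big_ord1.
Qed.

(** The set is invariant under y |-> 2 y, which multiplies measures by 4 ^ m > 1; its measure is
    finite by comparison with the Gaussian integral, hence 0. *)
Lemma normsq0_null m : (0 < m)%N ->
  \int[L m 1]_y (if (normsq y <= 0)%R then 1 else 0)%:E = 0.
Proof.
move=> m0; set I := LHS.
pose f (y : 'cV[R[i]]_m) : \bar R := (if (normsq y <= 0)%R then 1 else 0)%:E.
have mf : measurable_fun setT f.
  rewrite /f; mxmeas; exact: measurable_fun_normsq.
have f0 y : 0 <= f y by rewrite /f lee_fin; case: ifP.
have I0 : 0 <= I by apply: integral_ge0 => y _; exact: f0.
have Ioo : I \is a fin_num.
  rewrite ge0_fin_numE//; apply: le_lt_trans (ltry (pi ^+ m)).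
  rewrite -normsq_gaussian_integral; apply: ge0_le_integral => //.
  - by move=> y _; exact: f0.
  - by mxmeas; exact: measurable_fun_normsq.
  - move=> y _; rewrite lee_fin; case: ifPn => [y0|_]; last exact: expR_ge0.
    by rewrite -expR0 ler_expR oppr_ge0.
have c0 : ((2 : R)%:C%C : R[i]) != 0%R.
  by apply/eqP => -[] /eqP; rewrite pnatr_eq0.
have := mx_integral_dilate c0 mf f0; rewrite sqnormc_real muln1.
under eq_integral => y _ do rewrite /f normsqZ pmulr_rle0 ?exprn_gt0//.
rewrite -/I -(fineK Ioo) -EFinM => -[] /eqP.
rewrite -subr_eq0 -[X in (_ - X)%R]mul1r -mulrBl mulf_eq0 subr_eq0.
move=> /orP[|/eqP-> //].
by rewrite -exprM gt_eqF// exprn_egt1 ?ltr1n// -lt0n muln_gt0.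
Qed.

Lemma eq_normsq_integral m (g1 g2 : 'cV[R[i]]_m -> \bar R) : (0 < m)%N ->
  measurable_fun setT g1 -> (forall y, 0 <= g1 y) ->
  measurable_fun setT g2 -> (forall y, 0 <= g2 y) ->
  (forall y, (0 < normsq y)%R -> g1 y = g2 y) ->
  \int[L m 1]_y g1 y = \int[L m 1]_y g2 y.
Proof.
move=> m0 mg1 g10 mg2 g20 g12.
have mN : measurable_fun setT (fun y : 'cV[R[i]]_m => (normsq y <= 0)%R).
  by mxmeas; exact: measurable_fun_normsq.
apply: (ge0_eq_integral_off_null mN (normsq0_null m0) mg1 g10 mg2 g20) => y.
by rewrite -ltNge; exact: g12.
Qed.

Lemma integral_rate_exponential (b : R) : (0 < b)%R ->
  \int[mu]_t (if (0 < t)%R then b^-1 * expR (- (t / b)) else 0)%:E = 1.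
Proof.
move=> b0; have b0' : (0 < b^-1)%R by rewrite invr_gt0.
rewrite -(integral_exponential_pdf b0').
pose f (t : R) : \bar R := (b^-1 * expR (- (t / b)))%:E.
have mf : measurable_fun setT f by rewrite /f; mxmeas.
transitivity (\int[mu]_(t in `]0%R, +oo[) f t).
  rewrite [RHS]integral_mkcond; apply: eq_integral => t _.
  rewrite patchE mem_setE in_itv/= andbT.
  by case: ifP.
rewrite integral_itv_obnd_cbnd; last exact: measurable_funTS.
rewrite [LHS]integral_mkcond; apply: eq_integral => t _.
rewrite /exponential_pdf !patchE; case: ifP => // _.
by rewrite /f/= mulNr [(_^-1 * t)%R]mulrC.
Qed.

(* Evaluating [\int_y \int_t t ^ (m - 1) phi (t |y|^2) h (|y|^2)] in both
   orders, with h x = exp (- 1 / x) / x chosen so that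
   \int_t h (b / t) / t = 1 for every b > 0, shows that the image of the
   Lebesgue measure under y |-> |y|^2 is proportional to s ^ (m - 1) ds. *)
Lemma normsq_integral_proportional m : (0 < m)%N ->
  exists2 K : \bar R, 0 <= K & forall phi : R -> \bar R,
    measurable_fun setT phi -> (forall s, 0 <= phi s) ->
    \int[L m 1]_y phi (normsq y) =
    K * \int[mu]_s ((if (0 < s)%R then s ^+ m.-1 else 0)%:E * phi s).
Proof.
move=> m0.
pose h (x : R) : R := if (0 < x)%R then (x^-1 * expR (- x^-1))%R else 0%R.
have h0 x : (0 <= h x)%R.
  by rewrite /h; case: ifPn => // x0; rewrite mulr_ge0 ?expR_ge0// invr_ge0 ltW.
have mh : measurable_fun setT h by rewrite /h; mxmeas.
have mn : measurable_fun setT (@normsq m) by exact: measurable_fun_normsq.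
pose w (t : R) : R := if (0 < t)%R then (t ^+ m.-1)%R else 0%R.
have w0 t : (0 <= w t)%R by rewrite /w; case: ifPn => // t0; rewrite exprn_ge0 ?ltW.
have mw : measurable_fun setT w by rewrite /w; mxmeas.
(* This constant may still be infinite here; a Gaussian test function settles that in
   [normsq_integral]. *)
exists (\int[L m 1]_y (h (normsq y) / normsq y ^+ m)%:E).
  by apply: integral_ge0 => y _; rewrite lee_fin divr_ge0// exprn_ge0// normsq_ge0.
move=> phi mphi phi0; set I := \int[mu]_s _.
have I0 : 0 <= I.
  by apply: integral_ge0 => s _; rewrite mule_ge0// lee_fin w0.
pose G (y : 'cV[R[i]]_m) (t : R) : \bar R :=
  (w t * h (normsq y))%:E * phi (t * normsq y)%R.
have mG : measurable_fun setT
    (fun z : 'cV[R[i]]_m * measurableTypeR R => G z.1 z.2).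
  rewrite /G; apply: emeasurable_funM.
    apply/measurable_EFinP; apply: measurable_funM.
      exact: (measurableT_comp mw measurable_snd).
    by apply: (measurableT_comp mh); apply: measurable_fun_normsq; mxmeas.
  apply: (measurableT_comp mphi); apply: measurable_funM.
    exact: measurable_snd.
  by apply: measurable_fun_normsq; mxmeas.
have G0 y t : 0 <= G y t by rewrite mule_ge0// lee_fin mulr_ge0.
have mF (b : R) : measurable_fun setT (fun s : R => (w s)%:E * phi s).
  by apply: emeasurable_funM => //; apply/measurable_EFinP.
(* Substitution s = t b: t ^ (m - 1) dt becomes b ^ (- m) s ^ (m - 1) ds. *)
have inner y : \int[mu]_t G y t = (h (normsq y) / normsq y ^+ m)%:E * I.
  rewrite /G; set b := normsq y; have [b0|b0] := ltP 0%R b; last first.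
    rewrite (_ : h b = 0%R) ?mul0r ?mul0e; last by rewrite /h ltNge b0.
    by rewrite integral0_eq// => t _; rewrite mulr0 mul0e.
  pose F (s : R) : \bar R := (w s)%:E * phi s.
  have mF' : measurable_fun setT F by exact: mF.
  have F0 s : 0 <= F s by rewrite /F mule_ge0// lee_fin.
  have mFb : measurable_fun setT (fun t : R => F (b * t)%R).
    by apply: (measurableT_comp mF'); exact: measurable_funM.
  transitivity (\int[mu]_t ((h b / b ^+ m.-1)%:E * F (b * t)%R)).
    apply: eq_integral => t _; rewrite /F muleA [(b * t)%R]mulrC -EFinM.
    congr ((_)%:E * _); rewrite /w pmulr_lgt0//; case: ifP => _.
      by rewrite exprMn; field; rewrite expf_neq0// gt_eqF.
    by rewrite mul0r mulr0.
  rewrite ge0_integralZlT//; last by rewrite divr_ge0// exprn_ge0// ltW.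
  have b0' : b != 0%R by rewrite gt_eqF.
  rewrite (_ : I = `|b|%:E * \int[mu]_t F (b * t)%R); last first.
    by rewrite integral_dilate.
  rewrite muleA -EFinM gtr0_norm//; congr (_%:E * _).
  by rewrite -[in RHS](prednK m0) exprS; field; rewrite b0' expf_neq0.
pose E (y : 'cV[R[i]]_m) (t : R) : \bar R :=
  (if (0 < t)%R then t^-1 * h (normsq y / t) else 0)%:E.
have E0 y t : 0 <= E y t.
  by rewrite lee_fin; case: ifPn => // t0; rewrite mulr_ge0// invr_ge0 ltW.
(* For b = |y| ^ 2 > 0, h (b / t) / t = b ^ (-1) exp (- t / b) is the exponential density of mean
   b. *)
have outer y : \int[mu]_t E y t = (if (0 < normsq y)%R then 1 else 0)%:E.
  rewrite /E; set b := normsq y; case: ifPn => [b0|b0]; last first.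
    apply: integral0_eq => t _; case: ifPn => // t0.
    by rewrite /h pmulr_lgt0 ?invr_gt0// (negPf b0) mulr0.
  rewrite -(integral_rate_exponential b0); apply: eq_integral => t _.
  case: ifPn => // t0; rewrite /h divr_gt0// invf_div mulrA; congr (_ * _)%:E.
  by field; rewrite !gt_eqF.
have mE : measurable_fun setT
    (fun z : 'cV[R[i]]_m * measurableTypeR R => E z.1 z.2).
  have mt : measurable_fun setT (fun z : 'cV[R[i]]_m * measurableTypeR R => z.2 : R).
    exact: measurable_snd.
  rewrite /E; apply/measurable_EFinP; apply: measurable_fun_ifT.
  - by apply: measurable_fun_ltr => //; exact: measurable_cst.
  - apply: measurable_funM; first exact: measurable_fun_invr.
    apply: (measurableT_comp mh); apply: measurable_funM.
      by apply: measurable_fun_normsq; mxmeas.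
    exact: measurable_fun_invr.
  - exact: measurable_cst.
have mphin : measurable_fun setT (fun y : 'cV[R[i]]_m => phi (normsq y)).
  exact: (measurableT_comp mphi mn).
(* Replacing y by sqrt t y costs a factor t ^ m, of which the division by t leaves t ^ (m - 1). *)
have main t : \int[L m 1]_y (phi (normsq y) * E y t) = \int[L m 1]_y G y t.
  rewrite /G /E /w; case: ifPn => t0; last first.
    by apply: eq_integral => y _; rewrite mul0r mule0 mul0e.
  pose g (y : 'cV[R[i]]_m) := phi (normsq y) * (t^-1 * h (normsq y / t))%:E.
  have mg : measurable_fun setT g.
    apply: emeasurable_funM => //; apply/measurable_EFinP.
    apply: measurable_funM => //; apply: (measurableT_comp mh).
    exact: measurable_funM.
  have g0 y : 0 <= g y.
    by rewrite /g mule_ge0// lee_fin mulr_ge0// invr_ge0 ltW.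
  have c0 : ((Num.sqrt t)%:C%C : R[i]) != 0%R.
    by apply/eqP => -[] /eqP; rewrite gt_eqF// sqrtr_gt0.
  have mgc : measurable_fun setT
      (fun y : 'cV[R[i]]_m => g ((Num.sqrt t)%:C%C *: y)%R) by mxmeas.
  rewrite -[LHS](mx_integral_dilate c0 mg g0) sqnormc_real muln1.
  rewrite sqr_sqrtr ?ltW// -ge0_integralZlT//; last by rewrite exprn_ge0// ltW.
  apply: eq_integral => y _; rewrite /g normsqZ sqr_sqrtr ?ltW//.
  rewrite muleCA muleC -EFinM; congr (_%:E * _).
  have -> : (t * normsq y / t)%R = normsq y by field; rewrite gt_eqF.
  have -> : (t ^+ m = t * t ^+ m.-1)%R by rewrite -exprS prednK.
  by field; rewrite gt_eqF.
transitivity (\int[L m 1]_y \int[mu]_t (phi (normsq y) * E y t)).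
  transitivity (\int[L m 1]_y
      ((if (0 < normsq y)%R then 1 else 0)%:E * phi (normsq y))).
    apply: eq_normsq_integral => //.
    - by apply: emeasurable_funM => //; mxmeas.
    - by move=> y; rewrite mule_ge0// lee_fin; case: ifP.
    - by move=> y y0; rewrite y0 mul1e.
  apply: eq_integral => y _; rewrite -outer ge0_integralZl//.
  - by rewrite muleC.
  - exact: (measurableT_comp mE (measurable_pair1 y)).
rewrite (exchange_integral (L m 1) mu (fun y t => phi (normsq y) * E y t)); last 2 first.
- apply: emeasurable_funM => //.
  by apply: (measurableT_comp mphi); apply: measurable_fun_normsq; mxmeas.
- by move=> y t; rewrite mule_ge0.
under eq_integral do rewrite main.
rewrite -(exchange_integral (L m 1) mu G mG G0).
under eq_integral do rewrite inner.
rewrite ge0_integralZr//.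
- apply/measurable_EFinP; apply: measurable_funM.
    exact: (measurableT_comp mh mn).
  by apply: measurable_fun_invr; apply: measurable_funX.
- by move=> y _; rewrite lee_fin divr_ge0// exprn_ge0// normsq_ge0.
Qed.

End radial.

(** * Gamma functions and Wishart constants *)

Section gamma_constants.
Context {R : realType}.
Local Notation mu := (@lebesgue_measure R).
Local Notation L m n := (mx_measure m n (@complex_lebesgue R)).
Local Open Scope ereal_scope.

Lemma gamma_integral_nat m : (0 < m)%N ->
  Gamma (m%:R : R) = fine (\int[mu]_s
    ((if (0 < s)%R then s ^+ m.-1 else 0)%:E * (expR (- s))%:E)).
Proof.
move=> m0; rewrite /Gamma /Rintegral integral_mkcond; congr fine.
apply: eq_integral => s _; rewrite patchE mem_setE in_itv/= andbT.
case: ifPn => [s0|_]; last by rewrite mul0e.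
rewrite -EFinM (_ : m%:R - 1 = m.-1%:R)%R ?powR_mulrn ?ltW//.
by rewrite -[in LHS](prednK m0) -natr1 addrK.
Qed.

(** The test function exp (- s) gives pi ^ m = K Gamma (m), where K is the constant of
    proportionality. The left side being finite and positive, so are K and the Gamma integral. *)
Lemma normsq_integral m : (0 < m)%N ->
  (0 < Gamma (m%:R : R))%R /\ forall phi : R -> \bar R,
    measurable_fun setT phi -> (forall s, 0 <= phi s) ->
    \int[L m 1]_y phi (normsq y) = (pi ^+ m / Gamma m%:R)%:E *
      \int[mu]_s ((if (0 < s)%R then s ^+ m.-1 else 0)%:E * phi s).
Proof.
move=> m0; have [K K0 KE] := normsq_integral_proportional (R := R) m0.
have me : measurable_fun setT (fun s : R => (expR (- s))%:E).
  by apply/measurable_EFinP; apply: measurableT_comp => //; exact: measurable_funN.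
have e0 (s : R) : 0 <= (expR (- s))%:E by rewrite lee_fin expR_ge0.
have := KE _ me e0; rewrite normsq_gaussian_integral (gamma_integral_nat m0).
set G := \int[mu]_s _.
have G0 : 0 <= G.
  apply: integral_ge0 => s _; rewrite mule_ge0// lee_fin; case: ifPn => // s0.
  by rewrite exprn_ge0// ltW.
have pim : (0 < pi ^+ m :> R)%R by rewrite exprn_gt0// pi_gt0.
case: G G0 K K0 KE => [g| |]// g0 [k| |]// k0 KE.
- rewrite -EFinM => -[kg]; rewrite lee_fin in g0; rewrite lee_fin in k0.
  have gp : (0 < g)%R.
    rewrite lt_neqAle g0 andbT; apply/eqP => g00; move: pim.
    by rewrite kg -g00 mulr0 ltxx.
  split=> // phi mphi phi0; rewrite KE//; congr (_%:E * _).
  by rewrite /= kg mulfK// gt_eqF.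
- have [->|gp] := eqVneq g 0%R; first by rewrite mule0 => -[] /eqP; rewrite gt_eqF.
  by rewrite gt0_mulye// lte_fin lt_neqAle eq_sym gp.
- have [->|kp] := eqVneq k 0%R; first by rewrite mul0e => -[] /eqP; rewrite gt_eqF.
  by rewrite gt0_muley// lte_fin lt_neqAle eq_sym kp.
Qed.

Lemma Gamma_nat_gt0 m : (0 < m)%N -> (0 < Gamma (m%:R : R))%R.
Proof. by move=> /normsq_integral[]. Qed.

Lemma complex_multigamma_gt0 p m : (p <= m)%N ->
  (0 < complex_multigamma p (m%:R : R))%R.
Proof.
move=> le_pm; rewrite /complex_multigamma mulr_gt0 ?exprn_gt0 ?pi_gt0//.
rewrite big_nat; apply: prodr_gt0 => i /andP[i0 ip].
have im : (i <= m)%N by apply: leq_trans le_pm.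
by rewrite -natrB// natr1 Gamma_nat_gt0.
Qed.

Lemma complex_multigamma_rec q m :
  (complex_multigamma q.+1 (m.+1%:R : R) =
   pi ^+ q * Gamma m.+1%:R * complex_multigamma q m%:R)%R.
Proof.
rewrite /complex_multigamma big_ltn; [|by []].
rewrite big_add1 [q.+2.-1]/= [q.+1.-1]/= subrK.
rewrite (eq_bigr (fun i => Gamma (m%:R - i%:R + 1 : R)%R)) => [|i _]; last first.
  by rewrite -!natr1 opprD addrACA subrr addr0.
have -> : ((q.+1 * q)./2 = q + (q * q.-1)./2)%N.
  by rewrite -(bin2 q.+1) -(bin2 q) binS bin1 addnC.
by rewrite exprD mulrACA mulrA.
Qed.

(** The complex Wishart density is |X| ^ (m - p) exp (- tr X) divided by the multivariate Gamma
    function; passing from the Gaussian law of Y to Lebesgue measure contributes pi ^ (m p). *)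
Definition wishart_const m p : R := (pi ^+ (m * p) / complex_multigamma p m%:R)%R.

Lemma wishart_const_gt0 m p : (p <= m)%N -> (0 < wishart_const m p)%R.
Proof.
by move=> pm; rewrite divr_gt0 ?exprn_gt0 ?pi_gt0 ?complex_multigamma_gt0.
Qed.

Lemma wishart_const0 m : wishart_const m 0 = 1%R.
Proof.
by rewrite /wishart_const /complex_multigamma muln0 big_geq// expr0 mulr1 divr1.
Qed.

(** Mirrors the removal of a first column: pi ^ (m + 1) / Gamma (m + 1) is the radial constant of a
    vector of length m + 1. *)
Lemma wishart_const_rec m q : (q <= m)%N ->
  wishart_const m.+1 q.+1 =
  (pi ^+ m.+1 / Gamma m.+1%:R * wishart_const m q)%R.
Proof.
move=> qm; rewrite /wishart_const complex_multigamma_rec.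
rewrite (_ : m.+1 * q.+1 = m.+1 + q + m * q)%N; last first.
  by rewrite mulSn mulnS addnA addSnnS (addnC q).
rewrite !exprD; field.
by rewrite !gt_eqF ?exprn_gt0 ?pi_gt0 ?Gamma_nat_gt0 ?complex_multigamma_gt0.
Qed.

End gamma_constants.

(** * Wishart integrals *)

Section gram.
Context {R : realType}.
Local Notation mu := (@lebesgue_measure R).
Local Notation L m n := (mx_measure m n (@complex_lebesgue R)).
Local Notation H p := (@hermitian_lebesgue R p).
Local Open Scope ereal_scope.

Definition pd_det_pow p (k : nat) (X : 'M[R[i]]_p) : R :=
  (if pd X then complex.Re (\det X) ^+ k else 0)%R.

Lemma pd_det_pow_ge0 p k (X : 'M[R[i]]_p) : (0 <= pd_det_pow k X)%R.
Proof.
rewrite /pd_det_pow; case: ifPn => // /pdP/pdmx_det.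
by rewrite ltcE => /andP[_ d0]; rewrite exprn_ge0// ltW.
Qed.

Lemma measurable_fun_pd_det_pow d (U : measurableType d) p k
    (f : U -> 'M[R[i]]_p) :
  measurable_fun setT f -> measurable_fun setT (fun u => pd_det_pow k (f u)).
Proof. by move=> mf; rewrite /pd_det_pow; mxmeas. Qed.

Lemma pd_det_pow_hermitian_block q k (a : R) (r : 'rV[R[i]]_q)
    (C : 'M[R[i]]_q) :
  pd_det_pow k (hermitian_block a r C) =
  (if (0 < a)%R then a ^+ k * pd_det_pow k (schur a r C) else 0)%R.
Proof.
rewrite /pd_det_pow; have [a0|a0] := boolP (0 < a)%R.
  have a0' : a != 0%R by rewrite gt_eqF.
  rewrite (_ : pd (hermitian_block a r C) = pd (schur a r C)); last first.
    apply/pdP/pdP => [/(hermitian_block_pdmx _ _ a0')[]//|pS].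
    by apply/hermitian_block_pdmx.
  case: ifP => _; last by rewrite mulr0.
  by rewrite det_hermitian_block// ReM_real exprMn.
rewrite ifF//; apply/negP => /pdP/pdmx_corner_gt0.
by rewrite corner_hermitian_block (negPf a0).
Qed.

(** The unit row y^H / |y| is completed to a unitary matrix, whose other rows are then orthogonal to
    y. *)
Lemma unitary_to_first_axis m (y : 'cV[R[i]]_(1 + m)) : (0 < normsq y)%R ->
  exists2 U : 'M[R[i]]_(1 + m), U *m U^t* = 1%:M &
    U *m y = col_mx ((Num.sqrt (normsq y))%:C%C)%:M 0.
Proof.
move=> y0; set s := Num.sqrt _.
have s0 : s != 0%R by rewrite gt_eqF// sqrtr_gt0.
pose V := ((s^-1)%:C%C *: y^t* : 'M[R[i]]_(1, 1 + m))%R.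
have yy : y^t* *m y = ((s ^+ 2)%:C%C)%:M.
  apply/matrixP => i j; rewrite !ord1 [RHS]mxE eqxx mulr1n.
  rewrite sqr_sqrtr ?normsq_ge0// /normsq.
  have := @hermitian_Im0 R _ 1%:M y (@adjmx1 _ _); rewrite mulmx1.
  by case: (_ ord0 ord0) => a b /= ->.
have sV : ((s^-1)%:C%C * s%:C%C = 1 :> R[i])%R by rewrite -rmorphM/= mulVf.
have yE : y = (s%:C%C *: V^t*)%R.
  by rewrite /V adjmxZr trmxCK scalerA mulrC sV scale1r.
have Vy : V *m y = (s%:C%C)%:M.
  rewrite /V -scalemxAl yy scale_scalar_mx; congr scalar_mx.
  by rewrite -rmorphM/= expr2 mulrA mulVf// mul1r.
have VV : V *m V^t* = 1%:M.
  rewrite /V adjmxZr trmxCK -scalemxAr -/V Vy scale_scalar_mx.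
  by rewrite sV.
have [V2 UU] := unitary_completion VV; exists (col_mx V V2) => //.
rewrite mul_col_mx Vy; congr col_mx; rewrite yE -scalemxAr.
have : V2 *m V^t* = 0%R.
  move: UU; rewrite tr_col_mx map_row_mx mul_col_row [RHS]scalar_mx_block.
  by move=> /eq_block_mx[].
by move=> ->; rewrite scaler0.
Qed.

Lemma unitary_det_sqnormc m (U : 'M[R[i]]_m) : U *m U^t* = 1%:M ->
  sqnormc (\det U) = 1%R.
Proof.
move=> UU; apply: (@complexI R); rewrite sqnormcE.
transitivity (\det (1%:M : 'M[R[i]]_m)); last by rewrite det1.
rewrite -UU det_mulmx; congr (_ * _)%R.
by rewrite det_adjmx.
Qed.

Lemma mx_integral_lmul_unitary m n (U : 'M[R[i]]_m)
    (f : 'M[R[i]]_(m, n) -> \bar R) : U *m U^t* = 1%:M ->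
  measurable_fun setT f -> (forall A, 0 <= f A) ->
  \int[L m n]_A f (U *m A) = \int[L m n]_A f A.
Proof.
move=> UU mf f0; have Uu : U \in unitmx by have [] := mulmx1_unit UU.
rewrite -[RHS](mx_integral_lmul Uu mf f0).
by rewrite unitary_det_sqnormc// expr1n mul1e.
Qed.

Lemma mx_integral_rmul_unitary m n (U : 'M[R[i]]_n)
    (f : 'M[R[i]]_(m, n) -> \bar R) : U *m U^t* = 1%:M ->
  measurable_fun setT f -> (forall A, 0 <= f A) ->
  \int[L m n]_A f (A *m U) = \int[L m n]_A f A.
Proof.
move=> UU mf f0; have Uu : U \in unitmx by have [] := mulmx1_unit UU.
rewrite -[RHS](mx_integral_rmul Uu mf f0).
by rewrite unitary_det_sqnormc// expr1n mul1e.
Qed.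

Definition gram m p (Y : 'M[R[i]]_(m, p)) : 'M[R[i]]_p := Y^t* *m Y.

Lemma gram_adj m p (Y : 'M[R[i]]_(m, p)) : (gram Y)^t* = gram Y.
Proof. by rewrite /gram adjmxM trmxCK. Qed.

Lemma gram_unitary m p (U : 'M[R[i]]_m) (Y : 'M[R[i]]_(m, p)) :
  U *m U^t* = 1%:M -> gram (U *m Y) = gram Y.
Proof.
by move=> /mulmx1C UU; rewrite /gram adjmxM mulmxA -(mulmxA _ _ U) UU mulmx1.
Qed.

Lemma gram_col_mx m1 m2 p (Y : 'M[R[i]]_(m1, p)) (Z : 'M[R[i]]_(m2, p)) :
  gram (col_mx Y Z) = (gram Y + gram Z)%R.
Proof. by rewrite /gram tr_col_mx map_row_mx mul_row_col. Qed.

(** For nonzero a, the Schur complement of the resulting block matrix is [gram Z], whatever r is. *)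
Lemma gram_first_axis m q (a : R) (r : 'rV[R[i]]_q) (Z : 'M[R[i]]_(m, q)) :
  gram (row_mx (col_mx (a%:C%C)%:M 0) (col_mx r Z)) =
  hermitian_block (a ^+ 2) (a%:C%C *: r) (gram r + gram Z).
Proof.
rewrite -block_mxEh /gram tr_block_mx map_block_mx trmx0 map_mx0 mulmx_block.
rewrite !mul0mx mulmx0 !addr0 /hermitian_block.
have aa : ((a%:C%C)%:M : 'M[R[i]]_1)^t* = (a%:C%C)%:M.
  by rewrite tr_scalar_mx map_scalar_mx; congr scalar_mx; exact: conjc_real.
rewrite aa; congr block_mx.
- by rewrite mul_scalar_mx scale_scalar_mx -rmorphM.
- by rewrite mul_scalar_mx.
- by rewrite mul_mx_scalar adjmxZr.
Qed.

Lemma measurable_fun_gram d (U : measurableType d) m p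
    (f : U -> 'M[R[i]]_(m, p)) :
  measurable_fun setT f -> measurable_fun setT (fun u => gram (f u)).
Proof. by move=> mf; rewrite /gram; mxmeas. Qed.

End gram.

Ltac mxmeas_law := fail.

Ltac mxmeas_gram ::=
  lazymatch goal with
  | |- measurable_fun _ (fun u => normsq _) => apply: measurable_fun_normsq
  | |- measurable_fun _ (fun u => gram _) => apply: measurable_fun_gram
  | |- measurable_fun _ (fun u => pd _) => apply: measurable_fun_pd
  | |- measurable_fun _ (fun u => pd_det_pow _ _) =>
    apply: measurable_fun_pd_det_pow
  | |- _ => mxmeas_law
  end.

Section wishart.
Context {R : realType}.
Local Notation mu := (@lebesgue_measure R).
Local Notation L m n := (mx_measure m n (@complex_lebesgue R)).
Local Notation H p := (@hermitian_lebesgue R p).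
Local Open Scope ereal_scope.

(** Stated for Lebesgue measure in Y, so that a Gaussian weight, or any other weight depending on
    the Gram matrix, is absorbed in f. *)
Definition wishart_formula m p := forall f : 'M[R[i]]_p -> \bar R,
  measurable_fun setT f -> (forall X, 0 <= f X) ->
  \int[L m p]_Y f (gram Y) =
  (wishart_const m p)%:E * \int[H p]_X ((pd_det_pow (m - p) X)%:E * f X).

(** Once y lies on the first axis, the first row r of the other columns enters the block matrix as
    sqrt b r; taking sqrt b r as the new variable costs b ^ q, the denominator. *)
Lemma wishart_first_column m q (b : R) (y : 'cV[R[i]]_(1 + m))
    (f : 'M[R[i]]_(1 + q) -> \bar R) :
  (q <= m)%N -> wishart_formula m q -> (0 < b)%R -> normsq y = b ->
  measurable_fun setT f -> (forall X, 0 <= f X) ->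
  \int[L (1 + m) q]_Z f (gram (row_mx y Z)) =
  (wishart_const m q / b ^+ q)%:E * \int[L 1 q]_r \int[H q]_C
    ((pd_det_pow (m - q) (schur b r C))%:E * f (hermitian_block b r C)).
Proof.
move=> qm IH b0 yb mf f0; rewrite -yb in b0.
have [U UU Uy] := unitary_to_first_axis b0.
rewrite yb in b0 Uy; set s := Num.sqrt b in Uy.
have s0 : s != 0%R by rewrite gt_eqF// sqrtr_gt0.
have ss : (s ^+ 2 = b)%R by rewrite sqr_sqrtr// ltW.
have UU' : U^t* *m U = 1%:M by exact: mulmx1C.
have mfy : measurable_fun setT
    (fun Z : 'M[R[i]]_(1 + m, q) => f (gram (row_mx y Z))) by mxmeas.
(* Z becomes U^H Z: the Gram matrix of (y, U^H Z) is that of (U y, Z). *)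
rewrite -[LHS](@mx_integral_lmul_unitary _ _ _ (U^t*) _ _ mfy); last 2 first.
- by rewrite trmxCK.
- by move=> Z; exact: f0.
pose g (r : 'rV[R[i]]_q) := \int[H q]_C
  ((pd_det_pow (m - q) (schur b r C))%:E * f (hermitian_block b r C)).
have g0 r : 0 <= g r.
  by apply: integral_ge0 => C _; rewrite mule_ge0// lee_fin pd_det_pow_ge0.
have mg : measurable_fun setT g.
  apply: (measurable_fun_integral _ (fun (r : 'rV[R[i]]_q) (C : 'M[R[i]]_q) =>
    (pd_det_pow (m - q) (schur b r C))%:E * f (hermitian_block b r C))).
    by mxmeas.
  by move=> r C; rewrite mule_ge0// lee_fin pd_det_pow_ge0.
transitivity (\int[L 1 q]_r ((wishart_const m q)%:E * g (s%:C%C *: r)%R)).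
  transitivity (\int[L 1 q]_r \int[L m q]_Z
      f (hermitian_block b (s%:C%C *: r)%R (gram r + gram Z)%R)).
    rewrite [LHS]mx_integral_col_mx; [|by mxmeas|by nonneg].
    apply: eq_integral => r _; apply: eq_integral => Z _; congr f.
    rewrite -(gram_unitary _ UU) mul_mx_row mulmxA UU mul1mx Uy gram_first_axis.
    by rewrite ss.
  apply: eq_integral => r _.
  have mfr : measurable_fun setT (fun X : 'M[R[i]]_q =>
      f (hermitian_block b (s%:C%C *: r)%R (gram r + X)%R)) by mxmeas.
  rewrite [LHS](IH _ mfr); last by move=> X; exact: f0.
  congr (_ * _); rewrite /g.
  have mF : measurable_fun setT (fun C : 'M[R[i]]_q =>
      (pd_det_pow (m - q) (schur b (s%:C%C *: r)%R C))%:E *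
      f (hermitian_block b (s%:C%C *: r)%R C)) by mxmeas.
  (* When [gram r] is added to C, the Schur complement relative to s r and b is C itself, because s
     ^ 2 = b. *)
  rewrite -[RHS](hermitian_integral_translate (gram_adj r) mF); last first.
    by move=> C; rewrite mule_ge0// lee_fin pd_det_pow_ge0.
  apply: eq_integral => C _; rewrite [(C + _)%R]addrC; congr (_%:E * _).
  congr pd_det_pow; rewrite /schur adjmxZr -scalemxAl -scalemxAr !scalerA.
  rewrite -!rmorphM/= -mulrA -expr2 ss mulVf ?gt_eqF// scale1r.
  by rewrite /gram addrAC subrr add0r.
have sc0 : (s%:C%C : R[i]) != 0%R by apply: contraNneq s0 => -[->].
have mgs : measurable_fun setT (fun r : 'rV[R[i]]_q => g (s%:C%C *: r)%R).
  by mxmeas.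
rewrite [LHS](ge0_integralZlT _ mgs); last 2 first.
- by move=> r; exact: g0.
- exact/ltW/wishart_const_gt0.
rewrite [in RHS]EFinM -[RHS]muleA; congr (_ * _).
rewrite -[X in _ = _ * X](mx_integral_dilate sc0 mg g0) sqnormc_real ss mul1n.
by rewrite muleA -EFinM mulVf ?mul1e// expf_neq0// gt_eqF.
Qed.

(* Induction on p: a unitary change of variables aligns the first column y
   of Y with the first axis, so that gram Y splits into |y| ^ 2, the first row
   of the remaining columns, and a Schur complement which is the Gram matrix
   of an (m - 1) x (p - 1) matrix. *)
Lemma wishart m p : (p <= m)%N -> wishart_formula m p.
Proof.
elim: p m => [|q IHq] m pm f mf f0.
  have mfg : measurable_fun setT (fun Y : 'M[R[i]]_(m, 0) => f (gram Y)).
    by mxmeas.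
  rewrite [LHS](mx_integral_col0 _ (0%R : 'M[R[i]]_(m, 0)) mfg) => [|Y];
    last exact: f0.
  rewrite (@hermitian_integral0 R _ 0%R).
  - rewrite wishart_const0 mul1e /pd_det_pow det_mx00 expr1n.
    rewrite ifT ?mul1e; first by congr f; apply/matrixP => -[].
    apply/pdP; split; first by apply/matrixP => -[].
    by move=> v /eqP[]; apply/matrixP => -[].
  - by mxmeas.
  - by move=> X; rewrite mule_ge0// lee_fin pd_det_pow_ge0.
case: m pm => // m; rewrite ltnS => qm.
rewrite -[q.+1]add1n in f mf f0 *; rewrite -[m.+1]add1n.
pose k := (m - q)%N.
have kE : (1 + m - (1 + q) = k)%N by rewrite subnDl.
pose w b (r : 'rV[R[i]]_q) (C : 'M[R[i]]_q) : \bar R :=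
  (pd_det_pow k (schur b r C))%:E * f (hermitian_block b r C).
have w0 b r C : 0 <= w b r C by rewrite mule_ge0// lee_fin pd_det_pow_ge0.
(* The integral over the other columns depends on y only through b = |y| ^ 2; the case b <= 0
   concerns only the null set y = 0. *)
pose phi (b : R) : \bar R :=
  (if (0 < b)%R then wishart_const m q / b ^+ q else 0)%:E *
  \int[L 1 q]_r \int[H q]_C w b r C.
have phi0 b : 0 <= phi b.
  apply: mule_ge0; last by apply: integral_ge0 => r _; exact: integral_ge0.
  rewrite lee_fin; case: ifPn => // b0.
  by rewrite divr_ge0 ?exprn_ge0// ltW// wishart_const_gt0.
have mw2 : measurable_fun setT (fun b : measurableTypeR R =>
    \int[L 1 q]_r \int[H q]_C w b r C).
  rewrite /w; apply: measurable_fun_integral; last first.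
    by move=> b r; apply: integral_ge0 => C _; exact: w0.
  cbv beta; apply: measurable_fun_integral; last first.
    by move=> b C; exact: w0.
  by mxmeas.
have mphi : measurable_fun setT phi.
  apply: emeasurable_funM => //; apply/measurable_EFinP.
  apply: measurable_fun_ifT; first by mxmeas.
    by apply: measurable_funM => //; apply: measurable_fun_invr; mxmeas.
  exact: measurable_cst.
have mfg : measurable_fun setT (fun Y : 'M[R[i]]_(1 + m, 1 + q) => f (gram Y)).
  by mxmeas.
rewrite [LHS](mx_integral_row_mx _ mfg) => [|Y]; last exact: f0.
transitivity (\int[L (1 + m) 1]_y phi (normsq y)).
  apply: eq_normsq_integral.
  - by [].
  - by mxmeas.
  - by move=> y; apply: integral_ge0 => Z _; exact: f0.
  - by apply: (measurableT_comp mphi); exact: measurable_fun_normsq.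
  - by move=> y; exact: phi0.
  - move=> y y0; rewrite (wishart_first_column qm (IHq _ qm) y0 erefl mf f0).
    by rewrite /phi y0.
have [_ normsqI] := @normsq_integral R (1 + m) isT.
rewrite [LHS](normsqI _ mphi phi0).
rewrite kE [wishart_const _ _](wishart_const_rec qm) [in RHS]EFinM -[RHS]muleA.
congr (_ * _).
have mW : measurable_fun setT
    (fun X : 'M[R[i]]_(1 + q) => (pd_det_pow k X)%:E * f X) by mxmeas.
rewrite [in RHS](hermitian_integral_block mW); last first.
  by move=> X; rewrite mule_ge0// lee_fin pd_det_pow_ge0.
pose W s := \int[L 1 q]_r \int[H q]_C
  ((pd_det_pow k (hermitian_block s r C))%:E * f (hermitian_block s r C)).
have mWs : measurable_fun setT (W : measurableTypeR R -> \bar R).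
  rewrite /W; apply: measurable_fun_integral; last first.
    move=> s r; apply: integral_ge0 => C _.
    by rewrite mule_ge0// lee_fin pd_det_pow_ge0.
  cbv beta; apply: measurable_fun_integral; last first.
    by move=> s C; rewrite mule_ge0// lee_fin pd_det_pow_ge0.
  by mxmeas.
have Ws0 s : 0 <= W s.
  apply: integral_ge0 => r _; apply: integral_ge0 => C _.
  by rewrite mule_ge0// lee_fin pd_det_pow_ge0.
transitivity (\int[mu]_s ((wishart_const m q)%:E * W s)); last first.
  apply: (@ge0_integralZlT _ (measurableTypeR R)) => //.
  exact/ltW/wishart_const_gt0.
apply: eq_integral => s _; rewrite /phi; case: ifPn => s0; last first.
  rewrite mul0e; have -> : W s = 0; last by rewrite mule0.
  rewrite /W integral0_eq// => r _; rewrite integral0_eq// => C _.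
  by rewrite pd_det_pow_hermitian_block (negPf s0) mul0e.
have -> : W s = (s ^+ k)%:E * \int[L 1 q]_r \int[H q]_C w s r C.
  have sk0 : (0 <= s ^+ k)%R by rewrite exprn_ge0// ltW.
  have mwr r : measurable_fun setT (w s r) by rewrite /w; mxmeas.
  have mwr' : measurable_fun setT (fun r => \int[H q]_C w s r C).
    by rewrite /w; apply: measurable_fun_integral; [cbv beta; mxmeas|exact: w0].
  rewrite -[RHS](ge0_integralZlT _ mwr')//; last first.
    by move=> r; apply: integral_ge0 => C _; exact: w0.
  apply: eq_integral => r _.
  rewrite -[RHS](ge0_integralZlT _ (mwr r))//.
  apply: eq_integral => C _.
  by rewrite pd_det_pow_hermitian_block s0 /w EFinM muleA.
rewrite !muleA -!EFinM; congr (_%:E * _).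
(* Of the radial weight s ^ m, with m = k + q, the part s ^ q cancels the rescaling of the first
   row, and s ^ k completes the determinant, which is s times that of the Schur complement. *)
have -> : ((1 + m).-1 = k + q)%N by rewrite add1n/= subnK.
by rewrite exprD; field; rewrite expf_neq0// gt_eqF.
Qed.

End wishart.

(** * Matrix beta integrals *)

Section gauss_weight.
Context {R : realType}.
Local Notation L m n := (mx_measure m n (@complex_lebesgue R)).
Local Open Scope ereal_scope.

Definition gauss_weight p (X : 'M[R[i]]_p) : R := expR (- complex.Re (\tr X)).

Lemma gauss_weight_ge0 p (X : 'M[R[i]]_p) : (0 <= gauss_weight X)%R.
Proof. exact: expR_ge0. Qed.

Lemma measurable_fun_mxtrace d (U : measurableType d) p (f : U -> 'M[R[i]]_p) :
  measurable_fun setT f -> measurable_fun setT (fun u => \tr (f u)).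
Proof. by move=> mf; apply: measurable_fun_csum => i; mxmeas. Qed.

Lemma measurable_fun_gauss_weight d (U : measurableType d) p
    (f : U -> 'M[R[i]]_p) :
  measurable_fun setT f -> measurable_fun setT (fun u => gauss_weight (f u)).
Proof.
move=> mf; rewrite /gauss_weight; mxmeas; exact: measurable_fun_mxtrace.
Qed.

Lemma Re_trace_gram m p (Z : 'M[R[i]]_(m, p)) :
  complex.Re (\tr (gram Z)) = (\sum_i \sum_j sqnormc (Z i j))%R.
Proof.
rewrite exchange_big/= /mxtrace raddf_sum; apply: eq_bigr => j _.
rewrite /gram mxE raddf_sum; apply: eq_bigr => i _.
by rewrite !mxE mulrC -sqnormcE.
Qed.

(* Junk unless gram Z is positive definite, and then an isometry. *)
Definition isometry_of n p (Z : 'M[R[i]]_(n, p)) : 'M[R[i]]_(n, p) :=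
  Z *m invmx ((cholesky (gram Z))^t*).

Definition beta_ratio p (A C : 'M[R[i]]_p) : 'M[R[i]]_p :=
  invmx (cholesky C) *m A *m (invmx (cholesky C))^t*.

Lemma gauss_weight_integral n p :
  \int[L n p]_Z (gauss_weight (gram Z))%:E = (pi ^+ (n * p))%:E.
Proof.
rewrite -mx_gaussian_integral; apply: eq_integral => Z _.
by rewrite /gauss_weight Re_trace_gram.
Qed.

End gauss_weight.

Ltac mxmeas_law ::=
  lazymatch goal with
  | |- measurable_fun _ (fun u => gauss_weight _) =>
    apply: measurable_fun_gauss_weight
  | |- measurable_fun _ (fun u => isometry_of _) => rewrite /isometry_of
  | |- measurable_fun _ (fun u => beta_ratio _ _) => rewrite /beta_ratio
  | |- measurable_fun _ (fun u => proj_rowspace _) => rewrite /proj_rowspace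
  end.

Section matrix_beta.
Context {R : realType}.
Local Notation L m n := (mx_measure m n (@complex_lebesgue R)).
Local Notation H p := (@hermitian_lebesgue R p).
Local Open Scope ereal_scope.

Lemma pd_det_pow_congr p k (T V : 'M[R[i]]_p) : T \in unitmx ->
  pd_det_pow k (T *m V *m T^t*) = (sqnormc (\det T) ^+ k * pd_det_pow k V)%R.
Proof.
move=> Tu; have Tu' : T^t* \in unitmx by rewrite adjmx_unit.
have pdE : pd (T *m V *m T^t*) = pd V.
  by rewrite -{1}(trmxCK T); apply/pdP/pdP => /(pdmx_congr _ Tu').
rewrite /pd_det_pow pdE; case: ifP => _; last by rewrite mulr0.
rewrite !det_mulmx det_adjmx mulrAC -sqnormcE ReM_real.
by rewrite exprMn.
Qed.

Lemma pd_det_pow0 p (V : 'M[R[i]]_p) :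
  pd_det_pow 0 V = (if pd V then 1 else 0)%R.
Proof. by rewrite /pd_det_pow expr0. Qed.

(* The Jacobian of X |-> T X T^H on Hermitian matrices is read off the Wishart
   formula, where this map lifts to Y |-> Y T^H. *)
Lemma hermitian_integral_congr p (T : 'M[R[i]]_p) (f : 'M[R[i]]_p -> \bar R) :
  T \in unitmx -> measurable_fun setT f -> (forall X, 0 <= f X) ->
  \int[H p]_A ((pd_det_pow 0 A)%:E * f A) =
  (sqnormc (\det T) ^+ p)%:E *
  \int[H p]_V ((pd_det_pow 0 V)%:E * f (T *m V *m T^t*)).
Proof.
move=> Tu mf f0; have Tu' : T^t* \in unitmx by rewrite adjmx_unit.
have K0 := @wishart_const_gt0 R p p (leqnn p).
have mfT : measurable_fun setT (fun V : 'M[R[i]]_p => f (T *m V *m T^t*)).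
  by mxmeas.
have mfg : measurable_fun setT (fun Y : 'M[R[i]]_p => f (gram Y)) by mxmeas.
(* For square Y the exponent m - p is 0, and the Wishart weight is the indicator of the cone. Both
   formulas carry the same positive constant, which is cancelled. *)
have := wishart (leqnn p) mfT (fun V => f0 _).
have := wishart (leqnn p) mf f0.
rewrite subnn -[X in X = _ -> _](mx_integral_rmul Tu' mfg (fun Y => f0 _)).
rewrite det_adjmx sqnormc_conj.
rewrite (_ : \int[L p p]_A f (gram (A *m T^t*)) =
   \int[L p p]_A f (T *m gram A *m T^t*)); last first.
  apply: eq_integral => Y _; congr f.
  by rewrite /gram adjmxM trmxCK !mulmxA.
move=> + E2; rewrite E2 => E1.
apply/esym; move: E1; rewrite muleCA.
move=> /(congr1 (fun x => (wishart_const p p)^-1%:E * x)).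
have KV : (wishart_const (R := R) p p)^-1%:E * (wishart_const p p)%:E = 1.
  by rewrite -EFinM mulVf// gt_eqF.
by rewrite !muleA KV !mul1e.
Qed.

Lemma pd_det_pow_ge0E p k (X : 'M[R[i]]_p) : 0 <= (pd_det_pow k X)%:E.
Proof. by rewrite lee_fin pd_det_pow_ge0. Qed.

Lemma pd_det_powD p j k (X : 'M[R[i]]_p) :
  pd_det_pow (j + k) X = (pd_det_pow j X * pd_det_pow k X)%R.
Proof.
rewrite /pd_det_pow; case: ifP => _; last by rewrite mul0r.
by rewrite exprD.
Qed.

Lemma pd_det_pow_npd p k (X : 'M[R[i]]_p) : ~~ pd X -> pd_det_pow k X = 0%R.
Proof. by rewrite /pd_det_pow => /negPf ->. Qed.

Lemma pd_add p (A B : 'M[R[i]]_p) : pd A -> pd B -> pd (A + B)%R.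
Proof.
by move=> /pdP/pdmx_psdmx A0 /pdP B0; apply/pdP/pdmx_add.
Qed.

(** Substitute A = T V T^H with T the Cholesky factor of C, so that C - A = T (1 - V) T^H. The
    exponent p comes from the Jacobian, j and k from the two determinants. If C is not positive
    definite, A and C - A are never both so, and both sides vanish. *)
Lemma matrix_beta_inner p j k (C : 'M[R[i]]_p) (h : 'M[R[i]]_p -> \bar R) :
  measurable_fun setT h -> (forall X, 0 <= h X) ->
  \int[H p]_A ((pd_det_pow j A)%:E *
    ((pd_det_pow k (C - A)%R)%:E * h (beta_ratio A C))) =
  (pd_det_pow (p + j + k) C)%:E * \int[H p]_V
    ((pd_det_pow j V)%:E * ((pd_det_pow k (1%:M - V)%R)%:E * h V)).
Proof.
move=> mh h0; have [pC|nC] := boolP (pd C); last first.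
  rewrite (pd_det_pow_npd _ nC) mul0e integral0_eq// => A _.
  have [pA|nA] := boolP (pd A); last by rewrite (pd_det_pow_npd _ nA) mul0e.
  have [pB|nB] := boolP (pd (C - A)%R); last first.
    by rewrite (pd_det_pow_npd _ nB) mul0e mule0.
  by move: nC; rewrite -(subrK A C) pd_add.
have {}pC' : pdmx C by exact/pdP.
set T := cholesky C; have Tu : T \in unitmx by exact: cholesky_unit.
have TT : T *m T^t* = C by exact: choleskyK.
pose F A := (pd_det_pow j A)%:E *
  ((pd_det_pow k (C - A)%R)%:E * h (beta_ratio A C)).
have mF : measurable_fun setT F by rewrite /F; mxmeas.
have F0 A : 0 <= F A by rewrite /F !mule_ge0// pd_det_pow_ge0E.
transitivity (\int[H p]_A ((pd_det_pow 0 A)%:E * F A)).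
  by apply: eq_integral => A _; rewrite /F [RHS]muleA -EFinM -pd_det_powD.
rewrite (hermitian_integral_congr Tu mF F0).
have dC : sqnormc (\det T) = complex.Re (\det C).
  by have /(congr1 (@complex.Re R)) := sqnormc_det_cholesky pC'.
have d0 : (0 <= sqnormc (\det T))%R by exact: sqnormc_ge0.
pose c := (sqnormc (\det T) ^+ (j + k))%R.
pose E V := (pd_det_pow j V)%:E * ((pd_det_pow k (1%:M - V)%R)%:E * h V).
have mE : measurable_fun setT E by rewrite /E; mxmeas.
have E0 V : 0 <= E V by rewrite /E !mule_ge0// pd_det_pow_ge0E.
transitivity ((sqnormc (\det T) ^+ p)%:E * \int[H p]_V (c%:E * E V)).
  apply: (congr1 (mule _)); apply: eq_integral => V _; rewrite /F.
  have -> : beta_ratio (T *m V *m T^t*) C = V.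
    rewrite /beta_ratio -/T !mulmxA mulVmx// mul1mx -mulmxA -adjmxM mulVmx//.
    by rewrite adjmx1 mulmx1.
  have -> : (C - T *m V *m T^t* = T *m (1%:M - V) *m T^t*)%R.
    by rewrite mulmxBr mulmxBl mulmx1 TT.
  rewrite !(pd_det_pow_congr _ _ Tu) pd_det_pow0 /E /c exprD.
  have [pV|nV] := boolP (pd V); last first.
    by rewrite !(pd_det_pow_npd _ nV) !(mulr0, mul0e, mule0).
  rewrite mul1e !muleA -!EFinM; congr (_%:E * _); ring.
rewrite ge0_integralZlT//; last by rewrite exprn_ge0.
rewrite muleA -EFinM; congr (_%:E * _).
by rewrite /c /pd_det_pow pC -dC -exprD addnA.
Qed.

(** The powers of pi cancel, which leaves the reciprocal of the multivariate Beta function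
    ([beta_constE]). *)
Definition beta_const m l p : R :=
  (wishart_const m p * wishart_const l p / wishart_const (m + l) p)%R.

(* The matrix analogue of B(a, b) Gamma(a + b) = Gamma(a) Gamma(b): pass from
   (A, B) = (gram Y, gram Z) to (A, C) = (A, A + B), then to the ratio of A
   and C, which separates from C. *)
Lemma matrix_beta m l p (h : 'M[R[i]]_p -> \bar R) :
  (p <= m)%N -> (p <= l)%N ->
  measurable_fun setT h -> (forall X, 0 <= h X) ->
  \int[L m p]_Y \int[L l p]_Z ((gauss_weight (gram Y + gram Z)%R)%:E *
    h (beta_ratio (gram Y) (gram Y + gram Z)%R)) =
  (pi ^+ ((m + l) * p))%:E * ((beta_const m l p)%:E * \int[H p]_V
    ((pd_det_pow (m - p) V)%:E * ((pd_det_pow (l - p) (1%:M - V)%R)%:E * h V))).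
Proof.
move=> pm pl mh h0.
have gw0 (X : 'M[R[i]]_p) : 0 <= (gauss_weight X)%:E.
  by rewrite lee_fin gauss_weight_ge0.
have Km := wishart_const_gt0 (R := R) pm.
have Kl := wishart_const_gt0 (R := R) pl.
have pml : (p <= m + l)%N by rewrite (leq_trans pm)// leq_addr.
have Kml := wishart_const_gt0 (R := R) pml.
set j := (m - p)%N; set k := (l - p)%N.
pose Q A B := (pd_det_pow k B)%:E *
  ((gauss_weight (A + B)%R)%:E * h (beta_ratio A (A + B)%R)).
have Q0 A B : 0 <= Q A B by rewrite /Q !mule_ge0// pd_det_pow_ge0E.
have mQ : measurable_fun setT (fun A => \int[H p]_B Q A B).
  by rewrite /Q; apply: measurable_fun_integral; [cbv beta; mxmeas|exact: Q0].
have IQ0 A : 0 <= \int[H p]_B Q A B by apply: integral_ge0 => B _; exact: Q0.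
transitivity (\int[L m p]_Y ((wishart_const l p)%:E * \int[H p]_B Q (gram Y) B)).
  apply: eq_integral => Y _; rewrite (wishart pl (f := fun B =>
    (gauss_weight (gram Y + B)%R)%:E * h (beta_ratio (gram Y) (gram Y + B)%R)))//.
    by mxmeas.
  by move=> B; rewrite mule_ge0.
have mQg : measurable_fun setT
    (fun Y : 'M[R[i]]_(m, p) => \int[H p]_B Q (gram Y) B).
  by apply: (measurable_fun_app mQ); mxmeas.
rewrite (ge0_integralZlT _ mQg (fun Y => IQ0 _)); last exact: ltW.
rewrite (wishart pm mQ IQ0) -/j.
pose P A C := (pd_det_pow j A)%:E *
  ((pd_det_pow k (C - A)%R)%:E * h (beta_ratio A C)).
have P0 A C : 0 <= P A C by rewrite /P !mule_ge0// pd_det_pow_ge0E.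
transitivity ((wishart_const l p)%:E * ((wishart_const m p)%:E *
    \int[H p]_A \int[H p]_C ((gauss_weight C)%:E * P A C))).
  apply: (congr1 (mule _)); apply: (congr1 (mule _)); apply: eq_integral => A _.
  (* The translation C = A + B requires A to be Hermitian; where A is not positive definite, both
     sides vanish. *)
  have [pA|nA] := boolP (pd A); last first.
    rewrite (pd_det_pow_npd _ nA) mul0e integral0_eq// => C _.
    by rewrite /P (pd_det_pow_npd _ nA) mul0e mule0.
  have Ah : A^t* = A by have /pdP[] := pA.
  have mP : measurable_fun setT (fun C => (gauss_weight C)%:E * P A C).
    by rewrite /P; mxmeas.
  rewrite -[RHS](hermitian_integral_translate Ah mP); last first.
    by move=> C; rewrite mule_ge0.
  have mQA : measurable_fun setT (Q A) by rewrite /Q; mxmeas.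
  rewrite -[LHS](ge0_integralZlT _ mQA (Q0 A)); last exact: pd_det_pow_ge0.
  apply: eq_integral => C _; rewrite /Q /P addrK [(A + C)%R]addrC.
  by rewrite [RHS]muleCA; apply: (congr1 (mule _)); rewrite muleCA.
rewrite (exchange_integral (H p) (H p)
  (fun A C => (gauss_weight C)%:E * P A C)); last 2 first.
- by rewrite /P; mxmeas.
- by move=> A C; rewrite mule_ge0.
set I := \int[H p]_V _.
have I0 : 0 <= I.
  by apply: integral_ge0 => V _; rewrite !mule_ge0// pd_det_pow_ge0E.
pose D (C : 'M[R[i]]_p) := (pd_det_pow (p + j + k) C)%:E * (gauss_weight C)%:E.
have mD : measurable_fun setT D by rewrite /D; mxmeas.
have D0 C : 0 <= D C by rewrite /D mule_ge0// pd_det_pow_ge0E.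
transitivity ((wishart_const l p)%:E * ((wishart_const m p)%:E *
    (\int[H p]_C D C * I))).
  apply: (congr1 (mule _)); apply: (congr1 (mule _)).
  rewrite -ge0_integralZr//.
  apply: eq_integral => C _.
  have mPC : measurable_fun setT (fun A => P A C) by rewrite /P; mxmeas.
  rewrite (ge0_integralZlT _ mPC (fun A => P0 A C) (gauss_weight_ge0 C)).
  rewrite [X in _ * X](matrix_beta_inner _ _ C mh h0) -/I /D.
  by rewrite muleA; apply: (congr1 (mule^~ I)); rewrite muleC.
have mgw : measurable_fun setT (fun C : 'M[R[i]]_p => (gauss_weight C)%:E).
  by mxmeas.
have jkE : (m + l - p = p + j + k)%N by rewrite /j /k subnKC// addnBA.
(* The integral over C is identified by reading the Wishart formula backwards, with m + l rows, as a
   Gaussian integral. *)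
have E : (pi ^+ ((m + l) * p))%:E =
    (wishart_const (m + l) p)%:E * \int[H p]_C D C.
  by rewrite -gauss_weight_integral (wishart pml mgw gw0) jkE.
rewrite E; move: (\int[H p]_C D C) => J; rewrite /beta_const.
move: (wishart_const m p) (wishart_const l p) (wishart_const (m + l) p) Kml.
move=> a b c c0.
rewrite [RHS]muleACA -EFinM [LHS]muleA -[in LHS]EFinM.
by apply: (congr1 (fun c => c%:E * _)); field; rewrite gt_eqF.
Qed.

End matrix_beta.


(** * The boundary of the positive semidefinite cone *)

Section positive_semidefinite_null.
Context {R : realType}.
Local Notation mu := (@lebesgue_measure R).
Local Notation L m n := (mx_measure m n (@complex_lebesgue R)).
Local Notation LR m n := (mx_measure m n (@lebesgue_measure R)).
Local Notation H p := (@hermitian_lebesgue R p).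
Local Open Scope ereal_scope.

(* The Hermitian matrices on the boundary of the positive semidefinite cone:
   complex_betaI_pdf is supported on a closed set while the Wishart formula
   only sees positive definite matrices. *)
Definition degenerate p (V : 'M[R[i]]_p) : bool := psd V && ~~ pd V.

Lemma psd_pd_off_degenerate p (V : 'M[R[i]]_p) :
  ~~ degenerate V -> psd V = pd V.
Proof.
rewrite /degenerate; case pV : (pd V); last by rewrite andbT => /negPf.
by move=> _; apply/psdP/pdmx_psdmx/pdP.
Qed.

Lemma measurable_fun_degenerate d (U : measurableType d) p
    (f : U -> 'M[R[i]]_p) :
  measurable_fun setT f -> measurable_fun setT (fun u => degenerate (f u)).
Proof.
move=> mf; apply: measurable_and; first exact: measurable_fun_psd.
by apply: (measurable_neg); exact: measurable_fun_pd.
Qed.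

(** Induction through Schur complements: a zero corner has measure 0, a negative one excludes
    semidefiniteness, and for a positive one degeneracy passes to the complement, which differs from
    C by a translation. *)
Lemma degenerate_null p : \int[H p]_V (if degenerate V then 1 else 0)%:E = 0.
Proof.
elim: p => [|q IHq].
  apply: integral0_eq => V _; rewrite /degenerate ifF// andbC.
  have -> // : pd V.
  apply/pdP; split; first by apply/matrixP => -[].
  by move=> v /eqP[]; apply/matrixP => -[].
rewrite -[q.+1]add1n; pose f p' (V : 'M[R[i]]_p') : \bar R :=
  (if degenerate V then 1 else 0)%:E.
have mf p' : measurable_fun setT (f p').
  apply/measurable_EFinP; apply: measurable_fun_ifT => //.
  exact: measurable_fun_degenerate.
have f0 p' V : 0 <= f p' V by rewrite lee_fin; case: ifP.
have mf1 := mf (1 + q)%N; have mfq := mf q.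
rewrite -/(f _ _) [LHS](hermitian_integral_block mf1); last exact: f0.
rewrite -(integral_setD1 (r := 0%R)); first last.
  apply: measurable_funTS; apply: measurable_fun_integral; [|by nonneg].
  by cbv beta; mxmeas.
  exact: measurableD.
apply: integral0_eq => a [_ /eqP a0]; apply: integral0_eq => r _.
have [a1|a1] := ltP 0%R a; last first.
  apply: integral0_eq => C _; rewrite /f /degenerate.
  case: ifPn => // /andP[/psdP/psdmx_corner_ge0].
  rewrite corner_hermitian_block => a2.
  by move: a0; rewrite eq_le a1 a2.
have mBh : (- ((a^-1)%:C%C *: gram r))%R^t* = (- ((a^-1)%:C%C *: gram r))%R.
  by rewrite linearN map_mxN/= adjmxZr gram_adj.
rewrite -[RHS]IHq -[RHS](hermitian_integral_translate mBh mfq (f0 q)).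
apply: eq_integral => C _; rewrite /f /degenerate.
have -> : psd (hermitian_block a r C) = psd (schur a r C).
  apply/psdP/psdP => [/(hermitian_block_psdmx _ _ a0)[]//|pS].
  by apply/hermitian_block_psdmx => //; split=> //; exact: ltW.
have -> // : pd (hermitian_block a r C) = pd (schur a r C).
apply/pdP/pdP => [/(hermitian_block_pdmx _ _ a0)[]//|pS].
exact/hermitian_block_pdmx.
Qed.

Lemma hermitian_integral_opp p (f : 'M[R[i]]_p -> \bar R) :
  measurable_fun setT f -> (forall A, 0 <= f A) ->
  \int[H p]_V f (- V)%R = \int[H p]_V f V.
Proof.
move=> mf f0; rewrite [RHS](hermitian_integral mf f0).
rewrite [LHS]hermitian_integral; [|by mxmeas|by nonneg].
transitivity (\int[LR p p]_A
    f (hermitian_of_coords (\matrix_(i, j) (- A i j)%R))).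
  apply: eq_integral => A _; congr f.
  apply/matrixP => i j; rewrite !mxE; case: ifP => _.
    by rewrite /GRing.opp/=; congr Complex; rewrite oppr0.
  by case: ifP => _.
have mh : measurable_fun setT (fun A : 'M[R]_p => f (hermitian_of_coords A)).
  exact: (measurable_fun_app mf (measurable_fun_hermitian_of_coords _)).
have := @mx_integral_entrywise _ (measurableTypeR R) R mu p p
  (fun i j (z : R) => (- z)%R) 1%R _ ler01 _ _ mh (fun _ => f0 _).
rewrite expr1n mul1e; apply.
- by move=> i j; exact: measurable_funN.
- by move=> i j A mA; rewrite mul1e; exact: lebesgue_measureN.
Qed.

(** V |-> 1 - V preserves the measure, being a reflection followed by a translation. *)
Lemma degenerate_compl_null p :
  \int[H p]_V (if degenerate (1%:M - V)%R then 1 else 0)%:E = 0.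
Proof.
pose f (V : 'M[R[i]]_p) : \bar R := (if degenerate V then 1 else 0)%:E.
have mf : measurable_fun setT f.
  apply/measurable_EFinP; apply: measurable_fun_ifT => //.
  exact: measurable_fun_degenerate.
have f0 V : 0 <= f V by rewrite lee_fin; case: ifP.
have mf1 : measurable_fun setT (fun V : 'M[R[i]]_p => f (V + 1%:M)%R) by mxmeas.
rewrite -[RHS](degenerate_null p) -/(f _).
rewrite -[RHS](hermitian_integral_translate (adjmx1 p) mf f0).
rewrite -[RHS](hermitian_integral_opp mf1 (fun _ => f0 _)).
by apply: eq_integral => V _; rewrite addrC.
Qed.

(** The Schur recursion requires a nonzero corner, so the spectral theorem takes its place: each
    eigenvalue is the value of the form at a unit eigenvector. *)
Lemma psdmx_det_ge0 p (V : 'M[R[i]]_p) : psdmx V -> (0 <= \det V)%R.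
Proof.
move=> [/hermitian_normalmx/orthomx_spectralP VE V0].
set P := spectralmx V in VE; set d := spectral_diag V in VE.
have Pu : P \is unitarymx by exact: spectral_unitarymx.
have Pun : P \in unitmx by exact: unitarymx_unit.
have PP : invmx P = P^t* by rewrite invmx_unitary.
have dE : diag_mx d = P *m V *m P^t*.
  by rewrite VE -PP !mulmxA mulmxV// mul1mx -mulmxA mulmxV// mulmx1.
rewrite VE !det_mulmx det_diag mulrAC -det_mulmx mulVmx// det1 mul1r.
apply: prodr_ge0 => i _.
pose e : 'cV[R[i]]_p := delta_mx i ord0.
have := V0 (P^t* *m e); rewrite adjmxM trmxCK.
have -> : (e^t* *m P *m V *m (P^t* *m e) = e^t* *m diag_mx d *m e)%R.
  by rewrite dE !mulmxA.
rewrite -mulmxA mul_diag_mx mxE (bigD1 i)//= big1 ?addr0 => [|k ki].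
  by rewrite !mxE !eqxx/= conjC1 mul1r mulr1.
by rewrite !mxE (negPf ki) mulr0n conjC0 mul0r.
Qed.

End positive_semidefinite_null.

(** * The density of the matrix beta law *)

Section beta_density.
Context {R : realType}.
Local Notation H p := (@hermitian_lebesgue R p).
Local Open Scope ereal_scope.

Lemma complex_betaI_pdfE p m l (V : 'M[R[i]]_p) :
  complex_betaI_pdf m l V = (if psd V && psd (1%:M - V)%R then
    complex_multigamma p (m + l)%:R
      / (complex_multigamma p m%:R * complex_multigamma p l%:R)
    * complex.Re (\det V) ^+ (m - p) * complex.Re (\det (1%:M - V)%R) ^+ (l - p)
  else 0)%R.
Proof.
rewrite /complex_betaI_pdf /lemx subr0; congr (if _ then _ else _).
by apply/asboolP/andP => [[/psdP ? /psdP ?]|[/psdP ? /psdP ?]].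
Qed.

Lemma measurable_complex_betaI_pdf p m l :
  measurable_fun setT (@complex_betaI_pdf R p m l).
Proof.
rewrite (funext (@complex_betaI_pdfE p m l)).
by mxmeas.
Qed.

Lemma complex_betaI_pdf_ge0 p m l (V : 'M[R[i]]_p) :
  (p <= m)%N -> (p <= l)%N -> (0 <= complex_betaI_pdf m l V)%R.
Proof.
move=> pm pl; have pml : (p <= m + l)%N by rewrite (leq_trans pm)// leq_addr.
have Re_det_ge0 (A : 'M[R[i]]_p) : psd A -> (0 <= complex.Re (\det A))%R.
  by move=> /psdP/psdmx_det_ge0; rewrite lecE => /andP[].
rewrite complex_betaI_pdfE; case: ifPn => // /andP[V0 V1].
apply: mulr_ge0; last by rewrite exprn_ge0// Re_det_ge0.
apply: mulr_ge0; last by rewrite exprn_ge0// Re_det_ge0.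
apply/ltW/divr_gt0; first exact: complex_multigamma_gt0.
by apply: mulr_gt0; exact: complex_multigamma_gt0.
Qed.

Lemma beta_constE p m l : beta_const m l p =
  (complex_multigamma p (m + l)%:R
    / (complex_multigamma p m%:R * complex_multigamma p l%:R) :> R)%R.
Proof.
rewrite /beta_const /wishart_const mulnDl exprD.
have u0 k : (pi ^+ k : R)%R != 0%R by rewrite expf_neq0// gt_eqF// pi_gt0.
move: (u0 (m * p)%N) (u0 (l * p)%N).
set a := (pi ^+ (m * p))%R; set b := (pi ^+ (l * p))%R => a0 b0.
move: (complex_multigamma p m%:R) (complex_multigamma p l%:R) => x y.
rewrite [in RHS]invfM [in LHS]invfM invrK [((a * b)^-1)%R]invfM.
move: (x^-1)%R (y^-1)%R => {}x {}y.
by field; rewrite a0 b0.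
Qed.

(** The density is supported on 0 <= V <= 1, the weights on the set where V and 1 - V are positive
    definite. The two supports differ only where V or 1 - V is degenerate. *)
Lemma integral_complex_betaI_pdf p m l (B : set 'M[R[i]]_p) :
  (p <= m)%N -> (p <= l)%N -> measurable B ->
  \int[H p]_(V in B) (complex_betaI_pdf m l V)%:E =
  (beta_const m l p)%:E * \int[H p]_V ((pd_det_pow (m - p) V)%:E *
    ((pd_det_pow (l - p) (1%:M - V)%R)%:E * (\1_B V)%:E)).
Proof.
move=> pm pl mB; have mpdf := @measurable_complex_betaI_pdf p m l.
have pml : (p <= m + l)%N by rewrite (leq_trans pm)// leq_addr.
have mI : measurable_fun setT (\1_B : 'M[R[i]]_p -> R) by [].
pose F V := (pd_det_pow (m - p) V)%:E *
  ((pd_det_pow (l - p) (1%:M - V)%R)%:E * (\1_B V)%:E).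
have mF : measurable_fun setT F.
  by rewrite /F; mxmeas.
have F0 V : 0 <= F V by rewrite /F !mule_ge0// pd_det_pow_ge0E.
have c0 : (0 <= beta_const m l p :> R)%R.
  apply/ltW/divr_gt0; last exact: wishart_const_gt0.
  by apply: mulr_gt0; exact: wishart_const_gt0.
apply: (etrans (integral_mul_indic (H p) B _)).
apply: (etrans _ (ge0_integralZlT (H p) mF F0 c0)).
have mE : measurable_fun setT
    (fun V : 'M[R[i]]_p => (complex_betaI_pdf m l V)%:E * (\1_B V)%:E).
  by mxmeas.
have E0 V : 0 <= (complex_betaI_pdf m l V)%:E * (\1_B V)%:E.
  by rewrite mule_ge0// lee_fin ?complex_betaI_pdf_ge0.
have mcF : measurable_fun setT (fun V => (beta_const m l p)%:E * F V).
  by mxmeas.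
have cF0 V : 0 <= (beta_const m l p)%:E * F V by rewrite mule_ge0.
have md1 : measurable_fun setT
    (fun V : 'M[R[i]]_p => degenerate (1%:M - V)%R).
  by apply: measurable_fun_degenerate; mxmeas.
have md0 : measurable_fun setT (@degenerate R p).
  exact: (@measurable_fun_degenerate R _ _ p id).
have mN : measurable_fun setT (fun V : 'M[R[i]]_p =>
  degenerate V || degenerate (1%:M - V)%R) := measurable_or md0 md1.
have mif (b : 'M[R[i]]_p -> bool) : measurable_fun setT b ->
    measurable_fun setT (fun V => (if b V then 1 else 0)%:E : \bar R).
  by move=> mb; apply/measurable_EFinP; exact: measurable_fun_ifT.
have if0 (b : bool) : 0 <= (if b then 1 else 0)%:E :> \bar R by case: b.
have N0 : \int[H p]_V
    (if degenerate V || degenerate (1%:M - V)%R then 1 else 0)%:E = 0.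
  (* Off the first null set, the indicator of the union is that of the second null set. *)
  have N0 := ge0_eq_integral_off_null md0 (degenerate_null p) (mif _ mN).
  have {}N0 := N0 _ (fun V => if0 _) (mif _ md1) (fun V => if0 _).
  apply: (etrans _ (@degenerate_compl_null R p)).
  by apply: N0 => V nV; rewrite (negPf nV).
have EF V : ~~ (degenerate V || degenerate (1%:M - V)%R) ->
    (complex_betaI_pdf m l V)%:E * (\1_B V)%:E =
    (beta_const m l p)%:E * F V; last first.
  exact: (ge0_eq_integral_off_null mN N0 mE E0 mcF cF0 EF).
rewrite negb_or => /andP[dV dV1].
rewrite complex_betaI_pdfE (psd_pd_off_degenerate dV).
rewrite (psd_pd_off_degenerate dV1) /F /pd_det_pow beta_constE.
case: (pd V); last by rewrite !mul0e mule0.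
case: (pd _); last by rewrite !(mul0e, mule0).
by rewrite [RHS]muleA [RHS]muleA -!EFinM.
Qed.

End beta_density.

(** * The law of a compressed Fisher information matrix *)

Section projection_law.
Context {R : realType}.
Local Notation L m n := (mx_measure m n (@complex_lebesgue R)).
Local Notation H p := (@hermitian_lebesgue R p).
Local Open Scope ereal_scope.

Lemma proj_rowspace_rmul_unitary m n (A : 'M[R[i]]_(m, n)) (U : 'M[R[i]]_n) :
  U *m U^t* = 1%:M ->
  proj_rowspace (A *m U) = U^t* *m proj_rowspace A *m U.
Proof.
move=> UU; rewrite /proj_rowspace adjmxM.
by rewrite (_ : A *m U *m _ = A *m A^t*) ?mulmxA// -!mulmxA (mulmxA U) UU mul1mx.
Qed.

Definition first_axes m l : 'M[R[i]]_(m + l) := block_mx 1%:M 0 0 0.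

Lemma quad_first_axes m l p (Y : 'M[R[i]]_(m, p)) (Z : 'M[R[i]]_(l, p)) :
  (col_mx Y Z)^t* *m first_axes m l *m col_mx Y Z = gram Y.
Proof.
rewrite tr_col_mx map_row_mx mul_row_block !mulmx0 !addr0 mulmx1.
by rewrite mul_row_col mul0mx addr0.
Qed.

(** With T the Cholesky factor of A A^H, the rows of T^-1 A form an orthonormal basis of the row
    space of A; they are completed to a unitary matrix. *)
Lemma proj_rowspace_diag m l (A : 'M[R[i]]_(m, m + l)) : pd (A *m A^t*) ->
  exists2 U : 'M[R[i]]_(m + l), U *m U^t* = 1%:M &
    proj_rowspace A = U^t* *m first_axes m l *m U.
Proof.
move=> /pdP AA; set T := cholesky (A *m A^t*).
have TT : T *m T^t* = A *m A^t* by exact: choleskyK.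
have Tu : T \in unitmx by exact: cholesky_unit.
have Tu' : T^t* \in unitmx by rewrite adjmx_unit.
pose V := invmx T *m A.
have VV : V *m V^t* = 1%:M.
  rewrite /V adjmxM adjmx_inv -!mulmxA (mulmxA A) -TT !mulmxA mulVmx// mul1mx.
  by rewrite mulmxV.
have [V2 UU] := unitary_completion VV; exists (col_mx V V2) => //.
rewrite quad_first_axes /gram /V adjmxM adjmx_inv /proj_rowspace -TT.
rewrite -!mulmxA; congr (_ *m _); rewrite !mulmxA; congr (_ *m _).
have TTu : T *m T^t* \in unitmx by rewrite unitmx_mul Tu.
rewrite -[RHS](mulKmx TTu) -[LHS]mulmx1; congr (_ *m _).
by rewrite !mulmxA mulmxK// mulmxV.
Qed.

Lemma isometry_of_lmul_unitary n p (U : 'M[R[i]]_n) (Z : 'M[R[i]]_(n, p)) :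
  U *m U^t* = 1%:M -> isometry_of (U *m Z) = U *m isometry_of Z.
Proof. by move=> UU; rewrite /isometry_of gram_unitary// mulmxA. Qed.

Lemma isometry_ofP n p (Z : 'M[R[i]]_(n, p)) : pd (gram Z) ->
  (isometry_of Z)^t* *m isometry_of Z = 1%:M.
Proof.
move=> /pdP ZZ; set T := cholesky (gram Z).
have TT : T *m T^t* = gram Z by exact: choleskyK.
have Tu : T \in unitmx by exact: cholesky_unit.
have Tu' : T^t* \in unitmx by rewrite adjmx_unit.
rewrite /isometry_of -/T adjmxM adjmx_inv trmxCK -!mulmxA (mulmxA (Z^t*)).
by rewrite -/(gram Z) -TT !mulmxA mulVmx// mul1mx mulmxV.
Qed.

(** Read off the Wishart formula, whose weight vanishes off the positive definite cone. *)
Lemma gram_not_pd_null n p : (p <= n)%N ->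
  \int[L n p]_Z (if ~~ pd (gram Z) then 1 else 0)%:E = 0.
Proof.
move=> pn; rewrite (wishart pn (f := fun X => (if ~~ pd X then 1 else 0)%:E)).
- rewrite integral0_eq ?mule0// => X _; case: ifPn => nX; last by rewrite mule0.
  by rewrite pd_det_pow_npd// mul0e.
- apply/measurable_EFinP/measurable_fun_ifT => //.
  by apply: measurable_neg; apply: measurable_fun_pd.
- by move=> X; case: ifP.
Qed.

Lemma row_gram_not_pd_null m n : (m <= n)%N ->
  \int[L m n]_A (if ~~ pd ((A : 'M[R[i]]_(m, n)) *m A^t*) then 1 else 0)%:E = 0.
Proof.
move=> mn; rewrite -[RHS](gram_not_pd_null mn) [LHS]mx_integral_adj.
- by apply: eq_integral => A _; rewrite trmxCK.
- apply/measurable_EFinP/measurable_fun_ifT => //.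
  by apply: measurable_neg; mxmeas.
- by move=> X; case: ifP.
Qed.

End projection_law.

Section projection_beta_law.
Context {R : realType}.
Local Notation L m n := (mx_measure m n (@complex_lebesgue R)).
Local Notation H p := (@hermitian_lebesgue R p).
Local Open Scope ereal_scope.

(** The unitary change of variables in Z leaves [gram] invariant and commutes with [isometry_of].
    After it, the quadratic form is the [beta_ratio] of the Gram matrix of the first m rows to the
    Gram matrix of all rows. *)
Lemma gauss_proj_integral m l p (A : 'M[R[i]]_(m, m + l))
    (h : 'M[R[i]]_p -> \bar R) :
  (p <= m)%N -> (p <= l)%N -> pd (A *m A^t*) ->
  measurable_fun setT h -> (forall X, 0 <= h X) ->
  \int[L (m + l) p]_Z ((gauss_weight (gram Z))%:E *
    h ((isometry_of Z)^t* *m proj_rowspace A *m isometry_of Z)) =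
  (pi ^+ ((m + l) * p))%:E * ((beta_const m l p)%:E * \int[H p]_V
    ((pd_det_pow (m - p) V)%:E * ((pd_det_pow (l - p) (1%:M - V)%R)%:E * h V))).
Proof.
move=> pm pl pA mh h0; have [U UU PA] := proj_rowspace_diag pA.
have gw0 (X : 'M[R[i]]_p) : 0 <= (gauss_weight X)%:E.
  by rewrite lee_fin gauss_weight_ge0.
pose F (Z : 'M[R[i]]_(m + l, p)) := (gauss_weight (gram Z))%:E *
  h ((isometry_of Z)^t* *m first_axes m l *m isometry_of Z).
have mF : measurable_fun setT F by rewrite /F; mxmeas.
have F0 Z : 0 <= F Z by rewrite /F mule_ge0.
rewrite -[RHS](matrix_beta pm pl mh h0).
transitivity (\int[L (m + l) p]_Z F Z).
  rewrite -[RHS](mx_integral_lmul_unitary UU mF F0).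
  apply: eq_integral => Z _; rewrite /F (gram_unitary _ UU) PA.
  rewrite (isometry_of_lmul_unitary _ UU).
  by move: (isometry_of Z) => K; rewrite adjmxM !mulmxA.
rewrite [LHS](mx_integral_col_mx _ mF F0).
apply: eq_integral => Y _; apply: eq_integral => Z _; rewrite /F.
rewrite gram_col_mx; apply: (congr1 (fun X => _ * h X)).
rewrite /isometry_of adjmxM !mulmxA -(mulmxA _ _ (first_axes m l)).
rewrite -(mulmxA _ _ (col_mx Y Z)) quad_first_axes gram_col_mx /beta_ratio.
by rewrite -adjmx_inv trmxCK.
Qed.

(* The left-hand side does not depend on the isometry Q, so Q may be replaced
   by the isometric part of a Gaussian matrix Z and averaged over Z. After
   exchanging the integrals A is fixed, and its projection may be taken to be
   the one on the first m coordinates. *)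
Lemma proj_law m l p (G : 'M[R[i]]_(m, m + l) -> \bar R)
    (h : 'M[R[i]]_p -> \bar R) (Q : 'M[R[i]]_(m + l, p)) :
  (p <= m)%N -> (p <= l)%N -> measurable_fun setT G -> (forall A, 0 <= G A) ->
  (forall A (U : 'M[R[i]]_(m + l)), U *m U^t* = 1%:M -> G (A *m U) = G A) ->
  Q^t* *m Q = 1%:M -> measurable_fun setT h -> (forall X, 0 <= h X) ->
  \int[L m (m + l)]_A (G A * h (Q^t* *m proj_rowspace A *m Q)) =
  (\int[L m (m + l)]_A G A) * ((beta_const m l p)%:E * \int[H p]_V
    ((pd_det_pow (m - p) V)%:E * ((pd_det_pow (l - p) (1%:M - V)%R)%:E * h V))).
Proof.
move=> pm pl mG G0 GU QQ mh h0; set I := (beta_const m l p)%:E * _.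
have I0 : 0 <= I.
  rewrite /I mule_ge0//.
    rewrite lee_fin; apply/ltW/divr_gt0; last first.
      by apply: wishart_const_gt0; rewrite (leq_trans pm)// leq_addr.
    by apply: mulr_gt0; exact: wishart_const_gt0.
  by apply: integral_ge0 => V _; rewrite !mule_ge0// pd_det_pow_ge0E.
have gw0 (X : 'M[R[i]]_p) : 0 <= (gauss_weight X)%:E.
  by rewrite lee_fin gauss_weight_ge0.
pose n := (m + l)%N.
pose psi (Q : 'M[R[i]]_(n, p)) :=
  \int[L m n]_A (G A * h (Q^t* *m proj_rowspace A *m Q)).
have mpsi : measurable_fun setT psi.
  rewrite /psi; apply: measurable_fun_integral; first by cbv beta; mxmeas.
  by move=> Q' A; rewrite mule_ge0.
have psi0 Q' : 0 <= psi Q'.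
  by apply: integral_ge0 => A _; rewrite mule_ge0.
(* Two isometries differ by a unitary U, and right multiplication of A by a unitary matrix
   conjugates the projection while preserving G and Lebesgue measure. *)
have psiE Q' : Q'^t* *m Q' = 1%:M -> psi Q' = psi Q.
  move=> QQ'; have [U UU <-] := isometry_transitive QQ QQ'.
  have UU' : U *m U^t* = 1%:M by exact: mulmx1C.
  have mF : measurable_fun setT
      (fun A => G A * h (Q^t* *m proj_rowspace A *m Q)) by mxmeas.
  rewrite /psi -[RHS](mx_integral_rmul_unitary UU' mF); last first.
    by move=> A; rewrite mule_ge0.
  apply: eq_integral => A _; rewrite (GU _ _ UU').
  by rewrite (proj_rowspace_rmul_unitary _ UU') adjmxM !mulmxA.
pose N : \bar R := (pi ^+ (n * p))%:E.
have NI0 : 0 <= N * I by rewrite mule_ge0// lee_fin exprn_ge0// pi_ge0.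
have pn : (p <= n)%N by rewrite (leq_trans pm)// leq_addr.
(* N is the total Gaussian mass, finite and nonzero, hence it can be cancelled in the extended
   reals. *)
suff : N * psi Q = N * ((\int[L m n]_A G A) * I).
  move=> /(congr1 (fun x => (pi ^+ (n * p))^-1%:E * x)).
  have NV : ((pi ^+ (n * p) : R)^-1)%:E * N = 1.
    by rewrite -EFinM mulVf// expf_neq0// gt_eqF// pi_gt0.
  by rewrite !muleA NV !mul1e.
pose w (Z : 'M[R[i]]_(n, p)) (A : 'M[R[i]]_(m, n)) :=
  (gauss_weight (gram Z))%:E *
  (G A * h ((isometry_of Z)^t* *m proj_rowspace A *m isometry_of Z)).
have w0 Z A : 0 <= w Z A by rewrite !mule_ge0.
have mw : measurable_fun setT (fun z => w z.1 z.2) by rewrite /w; mxmeas.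
have mif d (U : measurableType d) (b : U -> bool) : measurable_fun setT b ->
    measurable_fun setT (fun u => (if b u then 1 else 0)%:E : \bar R).
  by move=> mb; apply/measurable_EFinP; exact: measurable_fun_ifT.
transitivity (\int[L n p]_Z \int[L m n]_A w Z A).
  have mgw : measurable_fun setT
    (fun Z : 'M[R[i]]_(n, p) => (gauss_weight (gram Z))%:E) by mxmeas.
  have mN : measurable_fun setT
      (fun Z : 'M[R[i]]_(n, p) => ~~ pd (gram Z)).
    by apply: measurable_neg; mxmeas.
  rewrite /N -gauss_weight_integral.
  apply: (etrans (esym
    (ge0_integralZr _ measurableT mgw (fun _ _ => gw0 _) (psi0 Q)))).
  have mf : measurable_fun setT
    (fun Z : 'M[R[i]]_(n, p) => (gauss_weight (gram Z))%:E * psi Q) by mxmeas.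
  have mg : measurable_fun setT (fun Z => \int[L m n]_A w Z A).
    exact: (measurable_fun_integral (L m n) w mw w0).
  have E := ge0_eq_integral_off_null mN (gram_not_pd_null pn) mf.
  have {}E := E _ (fun Z => mule_ge0 (gw0 _) (psi0 Q)) mg.
  apply: E => [Z|Z]; first by apply: integral_ge0 => A _; exact: w0.
  rewrite negbK => pZ; rewrite -(psiE _ (isometry_ofP pZ)) /psi.
  have mH : measurable_fun setT (fun A => G A *
      h ((isometry_of Z)^t* *m proj_rowspace A *m isometry_of Z)) by mxmeas.
  apply/esym; apply: (ge0_integralZlT _ mH _ (gauss_weight_ge0 _)).
  by move=> A; rewrite mule_ge0.
apply: (etrans (exchange_integral (L n p) (L m n) w mw w0)).
have mN : measurable_fun setT
    (fun A : 'M[R[i]]_(m, n) => ~~ pd (A *m A^t*)).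
  by apply: measurable_neg; mxmeas.
transitivity (\int[L m n]_A (G A * (N * I))); last first.
  rewrite [RHS]muleCA.
  exact: (ge0_integralZr _ measurableT mG (fun _ _ => G0 _) NI0).
have mf : measurable_fun setT (fun A => \int[L n p]_Z w Z A).
  by apply: measurable_fun_integral; [rewrite /w; cbv beta; mxmeas|].
have mg : measurable_fun setT (fun A => G A * (N * I)) by mxmeas.
have f0 A : 0 <= \int[L n p]_Z w Z A by apply: integral_ge0 => Z _; exact: w0.
have g0 A : 0 <= G A * (N * I).
  exact: mule_ge0 (G0 _) NI0.
(* [proj_rowspace A] is known to be a projection of rank m when A A^H is positive definite, which
   fails only on a null set of A. *)
have E := ge0_eq_integral_off_null mN (row_gram_not_pd_null (leq_addr l m)) mf f0.
apply: (E _ mg g0) => A; rewrite negbK => pA.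
have mH : measurable_fun setT (fun Z : 'M[R[i]]_(n, p) =>
  (gauss_weight (gram Z))%:E *
    h ((isometry_of Z)^t* *m proj_rowspace A *m isometry_of Z)) by mxmeas.
transitivity (G A * \int[L n p]_Z ((gauss_weight (gram Z))%:E *
    h ((isometry_of Z)^t* *m proj_rowspace A *m isometry_of Z))).
  rewrite -[RHS](ge0_integralZl _ measurableT mH)//.
    by apply: eq_integral => Z _; rewrite /w muleCA.
  by move=> Z _; rewrite mule_ge0.
by rewrite gauss_proj_integral.
Qed.

End projection_beta_law.

(** * From isometries to normalized Fisher matrices *)

Section normalized_fisher_law.
Context {R : realType}.
Local Notation L m n := (mx_measure m n (@complex_lebesgue R)).
Local Notation H p := (@hermitian_lebesgue R p).

Lemma gram_pdmx n p (G : 'M[R[i]]_(n, p)) : \rank G = p -> pdmx (gram G).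
Proof.
move=> rG; split=> [|v v0]; first exact: gram_adj.
have -> : qform (gram G) v = qform 1%:M (G *m v).
  by rewrite /qform adjmxM mulmx1 /gram !mulmxA.
apply: qform1_gt0; rewrite -trmx_eq0 trmx_mul mulmx_free_eq0 ?trmx_eq0//.
by rewrite /row_free mxrank_tr rG.
Qed.

Lemma fisher_sqrt_unit n p (sigma2 : R) (G : 'M[R[i]]_(n, p))
    (S : 'M[R[i]]_p) : \rank G = p -> 0 < sigma2 ->
  S *m S^t* = fisher sigma2 G -> S \in unitmx.
Proof.
move=> rG s0 SS; suff : S *m S^t* \in unitmx by rewrite unitmx_mul => /andP[].
rewrite SS /fisher -/(gram G).
by apply/pdmx_unit/pdmxZ; [rewrite invr_gt0|exact: gram_pdmx].
Qed.

Definition whitened_sensitivity n p (sigma2 : R) (G : 'M[R[i]]_(n, p))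
    (S : 'M[R[i]]_p) : 'M[R[i]]_(n, p) :=
  (Num.sqrt sigma2^-1)%:C%C *: (G *m invmx (S^t*)).

Lemma normalized_fisherE n m p (sigma2 : R) (G : 'M[R[i]]_(n, p))
    (S : 'M[R[i]]_p) (A : 'M[R[i]]_(m, n)) : 0 < sigma2 ->
  normalized_fisher sigma2 G S A =
  (whitened_sensitivity sigma2 G S)^t* *m proj_rowspace A *m
    whitened_sensitivity sigma2 G S.
Proof.
move=> s0; rewrite /whitened_sensitivity adjmxZr -scalemxAr -!scalemxAl scalerA.
rewrite -rmorphM/= -expr2 sqr_sqrtr ?invr_ge0; last exact: ltW.
rewrite /normalized_fisher /compressed_fisher -scalemxAr -scalemxAl.
by rewrite adjmxM adjmx_inv trmxCK !mulmxA.
Qed.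

Lemma whitened_sensitivity_isometry n p (sigma2 : R) (G : 'M[R[i]]_(n, p))
    (S : 'M[R[i]]_p) : \rank G = p -> 0 < sigma2 ->
  S *m S^t* = fisher sigma2 G ->
  (whitened_sensitivity sigma2 G S)^t* *m whitened_sensitivity sigma2 G S =
  1%:M.
Proof.
move=> rG s0 SS; have Su := fisher_sqrt_unit rG s0 SS.
have Su' : S^t* \in unitmx by rewrite adjmx_unit.
rewrite /whitened_sensitivity adjmxZr -scalemxAr -!scalemxAl scalerA.
rewrite -rmorphM/= -expr2 sqr_sqrtr ?invr_ge0; last exact: ltW.
rewrite adjmxM adjmx_inv trmxCK mulmxA -(mulmxA _ (G^t*)) scalemxAl scalemxAr.
by rewrite -/(fisher sigma2 G) -SS mulmxA mulVmx// mul1mx mulmxV.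
Qed.

Lemma measurable_normalized_fisher n m p (sigma2 : R) (G : 'M[R[i]]_(n, p))
    (S : 'M[R[i]]_p) :
  measurable_fun setT
    (normalized_fisher sigma2 G S : 'M[R[i]]_(m, n) -> 'M[R[i]]_p).
Proof.
rewrite /normalized_fisher /compressed_fisher /proj_rowspace.
by mxmeas.
Qed.

(** [proj_law] is applied to the indicator of B with the density of Phi as weight. This weight is
    invariant because U U^H = 1 gives (A U) (A U)^H = A A^H, and its integral is the total
    probability 1. *)
Lemma has_density_normalized_fisher m l p (sigma2 : R)
    (G : 'M[R[i]]_(m + l, p)) (S : 'M[R[i]]_p) d (T : measurableType d)
    (P : probability T R) (Phi : T -> 'M[R[i]]_(m, m + l))
    (g : 'M[R[i]]_m -> R) :
  (p <= m)%N -> (p <= l)%N -> \rank G = p -> 0 < sigma2 ->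
  S *m S^t* = fisher sigma2 G ->
  has_density P Phi (mx_measure m (m + l) complex_lebesgue)
    (fun A => g (A *m A^t*)) ->
  has_density P (fun t => normalized_fisher sigma2 G S (Phi t))
    hermitian_lebesgue (complex_betaI_pdf m l).
Proof.
move=> pm pl rG s0 SS [mPhi mg g0 PhiE].
pose w (A : 'M[R[i]]_(m, m + l)) := normalized_fisher sigma2 G S A.
have mw : measurable_fun setT w by exact: measurable_normalized_fisher.
split.
- exact: (measurableT_comp mw mPhi).
- exact: measurable_complex_betaI_pdf.
- by move=> V; exact: complex_betaI_pdf_ge0.
move=> B mB.
have mwB : measurable (w @^-1` B).
  by rewrite -[X in measurable X]setTI; exact: mw.
rewrite (PhiE _ mwB) integral_mul_indic.
have QQ := whitened_sensitivity_isometry rG s0 SS.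
set Q := whitened_sensitivity sigma2 G S in QQ.
pose h (V : 'M[R[i]]_p) : \bar R := (\1_B V)%:E.
have mh : measurable_fun setT h by apply/measurable_EFinP.
have h0 V : (0 <= h V)%E by rewrite lee_fin.
pose F (A : 'M[R[i]]_(m, m + l)) : \bar R := (g (A *m A^t*))%:E.
have mF : measurable_fun setT F by apply/measurable_EFinP.
have F0 A : (0 <= F A)%E by rewrite lee_fin.
have FU A (U : 'M[R[i]]_(m + l)) : U *m U^t* = 1%:M -> F (A *m U) = F A.
  by move=> UU; rewrite /F adjmxM mulmxA -(mulmxA A) UU mulmx1.
have F1 : (\int[L m (m + l)]_A F A = 1)%E.
  by rewrite -(PhiE _ measurableT) preimage_setT probability_setT.
rewrite (integral_complex_betaI_pdf pm pl mB).
have := proj_law pm pl mF F0 FU QQ mh h0; rewrite F1 mul1e => <-.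
apply: eq_integral => A _; apply: (congr1 (mule _)).
by rewrite /h /Q -normalized_fisherE.
Qed.

End normalized_fisher_law.

(** * Compression by Gaussian matrices *)

Section density_measure.
Context d (T : measurableType d) (R : realType).
Variables (mu : {measure set T -> \bar R}) (f : T -> \bar R).
Local Open Scope ereal_scope.
Hypotheses (mf : measurable_fun setT f) (f0 : forall x, 0 <= f x).

(** The two proofs are carried by the term so that its measure structure can be inferred from it. *)
Definition density_measure of measurable_fun setT f & (forall x, 0 <= f x) :=
  fun A : set T => \int[mu]_(x in A) f x.

Let nu := density_measure mf f0.

Let nu_set0 : nu set0 = 0. Proof. exact: integral_set0. Qed.

Let nu_ge0 A : 0 <= nu A. Proof. exact: integral_ge0. Qed.

Let nu_sigma_additive : semi_sigma_additive nu.
Proof.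
move=> F mF tF mUF; rewrite /nu /density_measure ge0_integral_bigcup//; last first.
  exact: measurable_funTS.
by apply: is_cvg_ereal_nneg_natsum_cond => n _ _; exact: integral_ge0.
Qed.

HB.instance Definition _ := isMeasure.Build _ _ _ (density_measure mf f0)
  nu_set0 nu_ge0 nu_sigma_additive.

Lemma density_measureE A :
  density_measure mf f0 A = \int[mu]_x (f x * (\1_A x)%:E).
Proof. exact: integral_mul_indic. Qed.

End density_measure.

Section complex_normal.
Context {R : realType}.
Local Notation mu := (@lebesgue_measure R).
Local Notation L m n := (mx_measure m n (@complex_lebesgue R)).
Local Open Scope ereal_scope.

Local Notation std := (Num.sqrt (2^-1)%R : R).

Lemma normal_pdf_half (x : R) :
  normal_pdf 0 std x = ((Num.sqrt pi)^-1 * expR (- x ^+ 2))%R.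
Proof.
have s0 : std != 0%R by rewrite gt_eqF// sqrtr_gt0 invr_gt0.
have ss : (std ^+ 2 = 2^-1)%R by rewrite sqr_sqrtr// invr_ge0.
rewrite normal_pdfE// /normal_peak /normal_fun ss subr0.
by congr ((Num.sqrt _)^-1 * expR _)%R; field.
Qed.

(** A product of measures is determined by its values on rectangles, where a product of densities
    splits by Tonelli. With variance 1 / 2, each real density is exp (- x ^ 2) / sqrt pi. *)
Lemma complex_normal01E (B : set R[i]) : measurable B ->
  complex_normal01 B = \int[@complex_lebesgue R]_z
    ((pi^-1 * expR (- sqnormc z))%:E * (\1_B z)%:E).
Proof.
move=> mB; pose q x := normal_pdf 0 std x.
have mq : measurable_fun setT q by exact: measurable_normal_pdf.
have q0 x : (0 <= q x)%R by exact: normal_pdf_ge0.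
pose F (z : R * R) := (q z.1 * q z.2)%:E.
have mF : measurable_fun setT F.
  apply/measurable_EFinP; apply: measurable_funM.
    exact: (measurableT_comp mq measurable_fst).
  exact: (measurableT_comp mq measurable_snd).
have F0 z : 0 <= F z by rewrite lee_fin mulr_ge0.
have mphi := @measurable_complex_of_coords R.
have mphiB : measurable (@complex_of_coords R @^-1` B).
  by rewrite -[X in measurable X]setTI; exact: mphi.
have mg : measurable_fun setT (fun z : R[i] =>
    (pi^-1 * expR (- sqnormc z))%:E * (\1_B z)%:E).
  by have mI : measurable_fun setT (\1_B : R[i] -> R) by []; mxmeas.
have g0 (z : R[i]) : 0 <= (pi^-1 * expR (- sqnormc z))%:E * (\1_B z)%:E.
  by rewrite mule_ge0// lee_fin mulr_ge0 ?expR_ge0// invr_ge0 pi_ge0.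
pose N := normal_prob 0 std.
have NE D : N D = \int[mu]_x ((q x)%:E * (\1_D x)%:E).
  by rewrite -integral_mul_indic.
rewrite /complex_normal01 /pushforward.
have -> : (N \x N) (@complex_of_coords R @^-1` B) =
    density_measure (mu \x mu) mF F0 (@complex_of_coords R @^-1` B).
  apply: product_measure_unique => // C D mC mD.
  apply: (etrans (density_measureE (mu \x mu) mF F0 _)).
  pose u (A : set R) x := (q x)%:E * (\1_A x)%:E.
  have mu_ A : measurable A -> measurable_fun setT (u A).
    by move=> mA; apply: emeasurable_funM; apply/measurable_EFinP.
  have u0 A x : 0 <= u A x by rewrite mule_ge0// lee_fin.
  transitivity (\int[mu \x mu]_z (u C z.1 * u D z.2)).
    apply: eq_integral => -[x y] _; rewrite /F /u /= EFinM muleACA -EFinM.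
    by congr (_ * _%:E); rewrite !indicE in_setX; case: (x \in C); case: (y \in D);
      rewrite ?mulr1 ?mulr0.
  have muCD : measurable_fun setT (fun z : R * R => u C z.1 * u D z.2).
    apply: emeasurable_funM.
      exact: (measurableT_comp (mu_ _ mC) measurable_fst).
    exact: (measurableT_comp (mu_ _ mD) measurable_snd).
  rewrite (product_integral mu mu (fun x y => u C x * u D y) muCD); last first.
    by move=> x y; rewrite mule_ge0.
  transitivity ((\int[mu]_x u C x) * (\int[mu]_x u D x)); last first.
    by rewrite /u -!NE.
  have ID0 : 0 <= \int[mu]_x u D x by exact: integral_ge0.
  have E := @ge0_integralZr _ (measurableTypeR R) R mu setT measurableT
    _ (mu_ _ mC) _ (fun x _ => u0 C x) ID0.
  rewrite -[RHS]E; apply: eq_integral => x _.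
  exact: (@ge0_integralZl _ (measurableTypeR R) R mu setT measurableT
    _ (mu_ _ mD) _ (fun y _ => u0 D y) (u0 C x)).
rewrite (ge0_integral_image (mu := mu \x mu) (phi := @complex_of_coords R))//.
apply: (etrans (density_measureE (mu \x mu) mF F0 _)).
apply: eq_integral => -[x y] _; rewrite /F /q !normal_pdf_half/=.
apply: (congr1 (fun c => c%:E * _)); rewrite mulrACA -invfM -expr2 -expRD.
by rewrite sqr_sqrtr ?pi_ge0// -opprD.
Qed.

End complex_normal.

Section gaussian_matrix_density.
Context {R : realType}.
Local Notation L m n := (mx_measure m n (@complex_lebesgue R)).
Local Open Scope ereal_scope.

(** Written as a function of X = A A^H, the form in which the general case takes its density; the
    trace of X is then the sum of the squared moduli of the entries of A. *)
Definition gaussian_density n m (X : 'M[R[i]]_m) : R :=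
  (pi ^- (m * n) * gauss_weight X)%R.

Lemma gaussian_densityE m n (A : 'M[R[i]]_(m, n)) :
  gaussian_density n (A *m A^t*) =
  (\prod_(i < m) \prod_(j < n) (pi^-1 * expR (- sqnormc (A i j))))%R.
Proof.
under eq_bigr do rewrite big_split/= prodr_const card_ord.
rewrite big_split/= prodr_const card_ord -exprM exprVn mulnC; congr (_ * _)%R.
under eq_bigr do rewrite -expR_sum.
rewrite -expR_sum /gauss_weight; congr expR.
under eq_bigr do rewrite sumrN.
rewrite sumrN -{1}(trmxCK A) -/(gram _) Re_trace_gram exchange_big/=.
congr (- _)%R; apply: eq_bigr => i _; apply: eq_bigr => j _.
by rewrite !mxE sqnormc_conj.
Qed.

Lemma indic_mx_box m n (B : 'I_m -> 'I_n -> set R[i]) (A : 'M[R[i]]_(m, n)) :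
  \1_(mx_box B) A = (\prod_(i < m) \prod_(j < n) \1_(B i j) (A i j))%R :> R.
Proof.
rewrite indicE; have [AB|AB] := boolP (A \in mx_box B).
  rewrite big1// => i _; rewrite big1// => j _.
  by rewrite indicE mem_set//; move/set_mem: AB; exact.
have : ~ forall i j, B i j (A i j) by move=> BA; move/negP: AB; apply; exact: mem_set.
move=> /existsNP[i /existsNP[j ABij]].
rewrite (bigD1 i)//= (bigD1 j)//= indicE memNset// !mul0r.
by [].
Qed.

(** Independence gives the law of X on boxes, where it agrees with the integral of the product
    density; boxes determine a finite measure. *)
Lemma has_density_iid_complex_normal01 m n d (T : measurableType d)
    (P : probability T R) (X : T -> 'M[R[i]]_(m, n)) :
  iid_complex_normal01 P X ->
  has_density P X (L m n) (fun A => gaussian_density n (A *m A^t*)).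
Proof.
move=> [mX X01 Xind].
have mg : measurable_fun setT
    (fun A : 'M[R[i]]_(m, n) => gaussian_density n (A *m A^t*)).
  by rewrite /gaussian_density; mxmeas.
have g0 (A : 'M[R[i]]_(m, n)) : (0 <= gaussian_density n (A *m A^t*))%R.
  by rewrite mulr_ge0 ?expR_ge0// invr_ge0 exprn_ge0// pi_ge0.
split=> // B mB.
pose f (A : 'M[R[i]]_(m, n)) := (gaussian_density n (A *m A^t*))%:E.
have mf : measurable_fun setT f by apply/measurable_EFinP.
have f0 A : 0 <= f A by rewrite lee_fin.
pose X_mix := isMeasurableFun.Build _ _ _ _ X mX.
pose X_mfun : {mfun T >-> 'M[R[i]]_(m, n)} := HB.pack X X_mix.
apply: (@measure_unique _ R _ (@mx_boxes _ R[i] m n)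
  (fun _ => mx_box (fun _ _ => setT))
  _ _ _ _ (pushforward P X_mfun) (density_measure (L m n) mf f0)) => //.
- exact: measurable_mx_boxesE.
- move=> _ _ [C mC <-] [D mD <-]; exists (fun i j => C i j `&` D i j).
    by move=> i j; exact: measurableI.
  by apply/seteqP; split => [A BCX|A [BX CX] i j];
    [split => i j; have [] := BCX i j|split; [exact: BX|exact: CX]].
- by move=> _; exists (fun _ _ => setT).
- by apply/seteqP; split => // A _; exists 0%N.
- move=> _ [C mC <-].
  apply: (etrans (Xind C mC)); under eq_bigr do under eq_bigr do rewrite X01//.
  pose q i j (z : R[i]) := (pi^-1 * expR (- sqnormc z))%:E * (\1_(C i j) z)%:E.
  have mq i j : measurable_fun setT (q i j).
    have mI : measurable_fun setT (\1_(C i j) : R[i] -> R) by [].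
    by rewrite /q; mxmeas.
  have q0 i j z : 0 <= q i j z.
    by rewrite mule_ge0// lee_fin mulr_ge0 ?expR_ge0// invr_ge0 pi_ge0.
  under eq_bigr do under eq_bigr do rewrite complex_normal01E//.
  rewrite -(mx_integral_prod (@complex_lebesgue R) mq q0).
  apply: (etrans _ (esym (density_measureE _ mf f0 _))).
  apply: eq_integral => A _; rewrite /f gaussian_densityE indic_mx_box.
  rewrite -EFinM -big_split/= -prodEFin; apply: eq_bigr => i _.
  by rewrite -big_split/= -prodEFin.
- move=> _; have mU : measurable
      (X @^-1` mx_box (fun (_ : 'I_m) (_ : 'I_n) => [set: R[i]])).
    rewrite -[Y in measurable Y]setTI; apply: (mX) => //.
    exact: measurable_mx_box.
  exact: le_lt_trans (probability_le1 P mU) (ltry 1).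
Qed.

End gaussian_matrix_density.

Theorem mainTheorem1 (R : realType) (n m p : nat)
  (n_gt0 : (0 < n)%N) (m_gt0 : (0 < m)%N) (p_gt0 : (0 < p)%N)
  (le_pm : (p <= m)%N) (le_mnp : (m <= n - p)%N)
  (x : 'cV[R]_p -> 'cV[R[i]]_n) (theta : 'cV[R]_p)
  (G : 'M[R[i]]_(n, p)) (G_dx : is_sensitivity_mx x theta G)
  (G_rank : \rank G = p)
  (sigma2 : R) (sigma2_gt0 : 0 < sigma2)
  (S : 'M[R[i]]_p) (S_sqrt : S *m S^t* = fisher sigma2 G)
  (d : measure_display) (T : measurableType d) (P : probability T R)
  (Phi : T -> 'M[R[i]]_(m, n)) :
  let W t := normalized_fisher sigma2 G S (Phi t) in
  (forall g : 'M[R[i]]_m -> R,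
     has_density P Phi (mx_measure m n complex_lebesgue)
       (fun A => g (A *m A^t*)) ->
     has_density P W hermitian_lebesgue (complex_betaI_pdf m (n - m)))
  /\
  (iid_complex_normal01 P Phi ->
     has_density P W hermitian_lebesgue (complex_betaI_pdf m (n - m))).
Proof.
(* Block matrices are typed by sums of dimensions, hence n is replaced by m + l. *)
have [l nE] : exists l, n = (m + l)%N.
  by exists (n - m)%N; rewrite subnKC// (leq_trans le_mnp)// leq_subr.
subst n; rewrite addKn => W.
(* The truncated subtraction n - p in the hypothesis is genuine because p <= m <= n. *)
have le_pl : (p <= l)%N.
  move: le_mnp; rewrite leq_subRL ?(leq_trans le_pm (leq_addr _ _))//.
  by rewrite addnC leq_add2l.
have main g := has_density_normalized_fisher le_pm le_pl G_rank sigma2_gt0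
  S_sqrt (Phi := Phi) (P := P) (g := g).
by split=> [g /main|/has_density_iid_complex_normal01/main].
Qed.
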